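(* Let $\alpha\ge1$, $\beta\ge 1$. If there is a polynomial-time bicriteria $(\alpha,\beta)$-approximation algorithm for Precedence Constrained Min-Sum Set Cover (PCMSSC), then there is a polynomial-time $\mathcal{O}\!\left(\frac{\alpha}{\log\left(\frac{5\beta}{5\beta-1}\right)}\cdot \log n\right)$-approximation algorithm for Precedence Constrained Average Case Decision Tree (PCACDT), where $n$ is the number of hypotheses.
   Context: Decision trees: $\mathcal{H}$ is a set of $n$ hypotheses and $\mathcal{T}$ a set of tests, each a partition of $\mathcal{H}$; performing a test reveals the part containing the unknown target. A decision tree is a rooted tree with tests at internal nodes, edges labeled by replies, and leaves corresponding to identified hypotheses. Given a partial order $\preceq$ on $\mathcal{T}$, a decision tree is precedence-closed if on every root-to-node path each test is preceded on the path by all its $\preceq$-predecessors. $\mathrm{COST}(D,h)$ is the number of tests on the root-to-leaf path for $h$, and $\mathrm{COST}_A(D)=\sum_{h\in\mathcal{H}}\mathrm{COST}(D,h)$. PCACDT: given $(\mathcal{H},\mathcal{T},\preceq)$, find a precedence-closed decision tree minimizing $\mathrm{COST}_A$. Set cover: universe $\mathcal{U}$ of $n$ items, family $\mathcal{S}$ of $m$ subsets with union $\mathcal{U}$, partial order $\preceq$ on $\mathcal{S}$. A subfamily is precedence-closed if it is downward closed under $\preceq$; $\mathrm{cov}$ denotes union. A precedence-closed sequence $\mathcal{C}=(C_1,\dots,C_l)$ is an ordering of a precedence-closed subfamily such that $C_i\preceq C_j$ implies $i<j$. The coverage time of an element $x$ in $\mathcal{C}$ is the minimum $i$ with $x\in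 C_i$ if $x\in\mathrm{cov}(\mathcal{C})$, and $|\mathcal{C}|$ otherwise; $\mathrm{CoverTime}(\mathcal{C})$ denotes the sum of coverage times of all elements of $\mathrm{cov}(\mathcal{C})$. PCMSSC: given $(\mathcal{U},\mathcal{S},\preceq,f)$, $0<f\le1$, find a precedence-closed sequence $\mathcal{C}$ with $|\mathrm{cov}(\mathcal{C})|\ge fn$ minimizing $\mathrm{CoverTime}(\mathcal{C})$. An $(\alpha,\beta)$-approximation returns on every instance $\mathcal{I}$ a precedence-closed sequence $\mathcal{C}$ with $|\mathrm{cov}(\mathcal{C})|\ge fn/\beta$ and $\mathrm{CoverTime}(\mathcal{C})\le\alpha\cdot\mathrm{OPT}(\mathcal{I})$. *)

(* Defs.v *)
From HB Require Import structures.
From mathcomp Require Import all_boot all_order all_algebra.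
From mathcomp Require Import reals exp.

Set Implicit Arguments.
Unset Strict Implicit.
Unset Printing Implicit Defensive.

Import Order.TTheory GRing.Theory Num.Theory.
Local Open Scope ring_scope.

(*  The machine model is the weak call-by-value lambda-calculus, time being the
    number of beta-steps.  It is a reasonable model: it and Turing machines
    simulate each other with a polynomial overhead in time (Forster, Kunze and
    Roth, "The weak call-by-value lambda-calculus is reasonable for both time
    and space", POPL 2020), so it defines the usual class of polynomial-time
    algorithms. *)

Inductive term : Type :=
| Var of nat
| App of term & term
| Lam of term.

Fixpoint closed_under (k : nat) (s : term) : bool :=
  match s with
  | Var i => (i < k)%N
  | App s t => closed_under k s && closed_under k t
  | Lam s => closed_under k.+1 s
  end.

(* De Bruijn indices; no shifting of [u] is needed, since evaluating a closed
   term only ever substitutes closed terms. *)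
Fixpoint subst (s : term) (k : nat) (u : term) : term :=
  match s with
  | Var i => if i == k then u else Var i
  | App s t => App (subst s k u) (subst t k u)
  | Lam s => Lam (subst s k.+1 u)
  end.

(* [evaluates i s v]: [s] has value [v], reached in [i] beta-steps. *)
Inductive evaluates : nat -> term -> term -> Prop :=
| EvalLam s : evaluates 0 (Lam s) (Lam s)
| EvalApp i j k s s' t t' v :
    evaluates i s (Lam s') -> evaluates j t t' ->
    evaluates k (subst s' 0 t') v ->
    evaluates (i + j + k).+1 (App s t) v.

Inductive data : Type :=
| DNil
| DCons of data & data.

Fixpoint data_size (d : data) : nat :=
  match d with
  | DNil => 1
  | DCons a b => (data_size a + data_size b).+1
  end.

(* Scott encoding: [DNil] is [fun n c => n] and [DCons a b] is
   [fun n c => c a b]. *)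
Fixpoint quote (d : data) : term :=
  match d with
  | DNil => Lam (Lam (Var 1))
  | DCons a b => Lam (Lam (App (App (Var 0) (quote a)) (quote b)))
  end.

(* [p] answers every instance [x] with a solution [y] such that [ok x y], in
   time polynomial in the size of the encoding of [x]. *)
Definition polytime_algorithm (I : Type) (S : I -> Type) (enc_in : I -> data)
    (enc_out : forall x, S x -> data) (ok : forall x, S x -> Prop)
    (p : term) : Prop :=
  closed_under 0 p /\
  exists q : {poly nat}, forall x : I, exists (y : S x) (i : nat),
    [/\ evaluates i (App p (quote (enc_in x))) (quote (enc_out x y)),
        (i <= q.[data_size (enc_in x)])%N
      & ok x y].

Definition enc_seq (s : seq data) : data := foldr DCons DNil s.

Definition enc_bool (b : bool) : data := if b then DCons DNil DNil else DNil.

(* Unary; only used for quantities and indices bounded by the instance size. *)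
Definition enc_nat (k : nat) : data := enc_seq (nseq k DNil).

Fixpoint bits_of_pos (p : BinNums.positive) : seq bool :=
  match p with
  | BinNums.xH => [:: true]
  | BinNums.xO p => false :: bits_of_pos p
  | BinNums.xI p => true :: bits_of_pos p
  end.

Definition bits_of_nat (k : nat) : seq bool :=
  match bin_of_nat k with
  | BinNums.N0 => [::]
  | BinNums.Npos p => bits_of_pos p
  end.

(* Binary, least significant bit first. *)
Definition enc_binary (k : nat) : data :=
  enc_seq [seq enc_bool b | b <- bits_of_nat k].

Definition enc_set (n : nat) (A : {set 'I_n}) : data :=
  enc_seq [seq enc_bool (x \in A) | x <- enum 'I_n].

Definition enc_rel (m : nat) (r : rel 'I_m) : data :=
  enc_seq [seq enc_seq [seq enc_bool (r s t) | t <- enum 'I_m]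
          | s <- enum 'I_m].

Definition partial_order (T : Type) (r : rel T) : Prop :=
  [/\ reflexive r, antisymmetric r & transitive r].

Definition is_optimum (S : Type) (feasible : S -> Prop) (cost : S -> nat)
    (v : nat) : Prop :=
  (exists2 s, feasible s & cost s = v) /\
  (forall s, feasible s -> (v <= cost s)%N).

Record pcmssc : Type := Pcmssc {
  sc_n : nat;
  sc_m : nat;
  sc_set : 'I_sc_m -> {set 'I_sc_n};
  sc_prec : rel 'I_sc_m;
  sc_frac : rat;
  sc_union : \bigcup_(t : 'I_sc_m) sc_set t = [set: 'I_sc_n];
  sc_prec_po : partial_order sc_prec;
  sc_frac_gt0 : 0 < sc_frac;
  sc_frac_le1 : sc_frac <= 1
}.

Definition enc_pcmssc (I : pcmssc) : data :=
  enc_seq [:: enc_nat (sc_n I); enc_nat (sc_m I);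
     enc_seq [seq enc_set (sc_set t) | t <- enum 'I_(sc_m I)];
     enc_rel (@sc_prec I);
     enc_binary `|numq (sc_frac I)|%N;
     enc_binary `|denq (sc_frac I)|%N].

(* A sequence of members of the family is the sequence of their indices. *)
Definition enc_cover (I : pcmssc) (C : seq 'I_(sc_m I)) : data :=
  enc_seq [seq enc_nat t | t : 'I_(sc_m I) <- C].

Definition cov (I : pcmssc) (C : seq 'I_(sc_m I)) : {set 'I_(sc_n I)} :=
  \bigcup_(t <- C) sc_set t.

Definition precedence_closed_seq (I : pcmssc) (C : seq 'I_(sc_m I)) : Prop :=
  [/\ uniq C,
      forall s t : 'I_(sc_m I), t \in C -> sc_prec s t -> s \in C
    & forall s t : 'I_(sc_m I), s \in C -> t \in C -> s != t ->
        sc_prec s t ->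
        (index s C < index t C)%N].

(* Positions in a sequence are counted from 1. *)
Definition coverage_time (I : pcmssc) (C : seq 'I_(sc_m I))
    (x : 'I_(sc_n I)) : nat :=
  if x \in cov C then (find (fun t => x \in sc_set t) C).+1 else size C.

Definition cover_time (I : pcmssc) (C : seq 'I_(sc_m I)) : nat :=
  (\sum_(x in cov C) coverage_time C x)%N.

Definition pcmssc_feasible (I : pcmssc) (C : seq 'I_(sc_m I)) : Prop :=
  precedence_closed_seq C /\ sc_frac I * (sc_n I)%:R <= #|cov C|%:R.

Definition pcmssc_opt (I : pcmssc) (v : nat) : Prop :=
  is_optimum (@pcmssc_feasible I) (@cover_time I) v.

Definition bicriteria_solution (R : realType) (alpha beta : R) (I : pcmssc)
    (C : seq 'I_(sc_m I)) : Prop :=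
  [/\ precedence_closed_seq C,
      ratr (sc_frac I) * (sc_n I)%:R / beta <= #|cov C|%:R
    & forall v, pcmssc_opt I v -> (cover_time C)%:R <= alpha * v%:R].

Definition pcmssc_bicriteria_algorithm (R : realType) (alpha beta : R) :
    term -> Prop :=
  polytime_algorithm enc_pcmssc enc_cover (bicriteria_solution alpha beta).

(* [dt_separated] holds exactly when some decision tree exists. *)
Record pcacdt : Type := Pcacdt {
  dt_n : nat;
  dt_m : nat;
  dt_test : 'I_dt_m -> {set {set 'I_dt_n}};
  dt_prec : rel 'I_dt_m;
  dt_n_gt0 : (0 < dt_n)%N;
  dt_test_partition : forall t, partition (dt_test t) [set: 'I_dt_n];
  dt_prec_po : partial_order dt_prec;
  dt_separated : forall g h, g != h ->
    exists t, pblock (dt_test t) g != pblock (dt_test t) h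
}.

(* A test is written as the table of its replies to all hypotheses. *)
Definition enc_test (n : nat) (P : {set {set 'I_n}}) : data :=
  enc_seq [seq enc_set (pblock P h) | h <- enum 'I_n].

Definition enc_pcacdt (I : pcacdt) : data :=
  enc_seq [:: enc_nat (dt_n I); enc_nat (dt_m I);
     enc_seq [seq enc_test (dt_test t) | t <- enum 'I_(dt_m I)];
     enc_rel (@dt_prec I)].

(* The children of a node are listed with the labels of the edges to them; a
   label is a reply, i.e. a part of the test performed at the node. *)
Inductive dtree (n m : nat) : Type :=
| Leaf of 'I_n
| Node of 'I_m & seq ({set 'I_n} * dtree n m).

Fixpoint enc_dtree (n m : nat) (D : dtree n m) : data :=
  match D with
  | Leaf h => enc_seq [:: enc_bool false; enc_nat h]
  | Node t cs => enc_seq [:: enc_bool true; enc_nat t;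
      enc_seq [seq DCons (enc_set c.1) (enc_dtree c.2) | c <- cs]]
  end.

(* [D] identifies the target, known to lie in [H]: there is exactly one child
   for each reply still possible, and a leaf is reached only when a single
   hypothesis is left. *)
Fixpoint identifies (I : pcacdt) (H : {set 'I_(dt_n I)})
    (D : dtree (dt_n I) (dt_m I)) : bool :=
  match D with
  | Leaf h => H == [set h]
  | Node t cs =>
      [&& uniq (unzip1 cs),
          [set:: unzip1 cs] == [set B in dt_test t | B :&: H != set0]
        & all (fun c => identifies (H :&: c.1) c.2) cs]
  end.

(* [done] lists the tests already performed on the path to the root of [D]. *)
Fixpoint precedence_closed_from (I : pcacdt) (done : seq 'I_(dt_m I))
    (D : dtree (dt_n I) (dt_m I)) : bool :=
  match D with
  | Leaf _ => true
  | Node t cs =>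
      [forall s, dt_prec s t && (s != t) ==> (s \in done)] &&
      all (fun c => precedence_closed_from (t :: done) c.2) cs
  end.

Definition precedence_closed_dtree (I : pcacdt)
    (D : dtree (dt_n I) (dt_m I)) : Prop :=
  identifies [set: 'I_(dt_n I)] D /\ precedence_closed_from [::] D.

(* On a tree that does not identify [h], the default 0 is junk. *)
Fixpoint cost (n m : nat) (D : dtree n m) (h : 'I_n) : nat :=
  match D with
  | Leaf _ => 0%N
  | Node _ cs =>
      ((fix reply (cs : seq ({set 'I_n} * dtree n m)) : nat :=
          match cs with
          | [::] => 0%N
          | c :: cs => if h \in c.1 then cost c.2 h else reply cs
          end) cs).+1
  end.

Definition cost_A (n m : nat) (D : dtree n m) : nat :=
  (\sum_(h < n) cost D h)%N.

Definition pcacdt_opt (I : pcacdt) (v : nat) : Prop :=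
  is_optimum (@precedence_closed_dtree I) (@cost_A (dt_n I) (dt_m I)) v.

(* [ratio] is a function of the number of hypotheses. *)
Definition pcacdt_solution (R : realType) (ratio : nat -> R) (I : pcacdt)
    (D : dtree (dt_n I) (dt_m I)) : Prop :=
  precedence_closed_dtree D /\
  forall v, pcacdt_opt I v -> (cost_A D)%:R <= ratio (dt_n I) * v%:R.

Definition pcacdt_approximation_algorithm (R : realType) (ratio : nat -> R) :
    term -> Prop :=
  polytime_algorithm enc_pcacdt
    (fun I => @enc_dtree (dt_n I) (dt_m I)) (pcacdt_solution ratio).

(* Main.v *)
(* Call a hypothesis of [H] covered by a test when the reply to it leaves at
   most half of [H]. Following in an optimal tree the replies that keep more than
   half of [H] shows that some precedence-closed set of k tests covers half of [H],
   with k |H| at most twice the cost of the optimal tree on [H].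

   An (alpha, beta)-approximation of this instance would only give a closed set
   whose density (number of covered elements per test) is off by a factor of order
   alpha beta^2, because the elements left uncovered do not count in the cover
   time. It is therefore applied to the square of the instance: the universe and the
   family are squared, a pair of tests covers the product of the two covered sets,
   and the order is the product order. Density is multiplicative, and from a closed
   set of pairs one of its sections is a closed set of tests with at least the
   square root of its density; this brings the loss down to order alpha beta.

   Performing a closed set P that covers c elements of [H] costs at most |P| |H| and
   leaves parts of size at most |H| / 2 or |H| - c, so that ln |H| decreases by at
   least ln 2 * c / |H| everywhere. Summing this against the cost of the optimal
   tree gives the ratio 64 alpha beta ln n / ln 2, and
   beta <= 1 / (4 ln (5 beta / (5 beta - 1))).

   The tree has polynomially many nodes, since the children of a node partition its
   hypotheses and no test is repeated on a branch; at each of them the squared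
   instance is solved once. *)

Require Import Defs.
From mathcomp Require Import all_boot all_order all_algebra.
From mathcomp Require Import zify ring lra.
From mathcomp Require Import boolp reals exp.

Set Implicit Arguments.
Unset Strict Implicit.
Unset Printing Implicit Defensive.

Import Order.TTheory GRing.Theory Num.Theory.
Local Open Scope nat_scope.

(** * Polynomial bounds *)

(** Why the square helps: write a for |H|, q for the size of the closed set taken from the optimal
    tree, N for what the approximation covers and j for the length of its useful prefix. On the
    plain instance N is of order a / beta and j N of order alpha a q, so N / j loses alpha beta^2
    against a / q. On the square both bounds are squared except in alpha and beta, so the square
    root of the density loses only sqrt(alpha) beta, with constant 32; [1 <= alpha] then rounds this
    to alpha beta.

    The algorithm knows neither the optimum nor the good section, so it takes the densest section of
    all prefixes of the answer.

    No optimum of a subproblem is ever used: the cost of one optimal tree of the whole instance,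
    summed over [H], is the yardstick. It is additive over the parts of [H], so it survives every
    branching.

    In the lambda-calculus a value can be exponentially larger than the number of steps producing
    it. A time bound alone therefore does not compose, and every program below carries a bound on
    the size of its value; for the recursive construction of the tree this needs a measure that
    bounds the number of nodes. *)

Definition poly_bounded (X : Type) (s g : X -> nat) : Prop :=
  exists q : {poly nat}, forall x, g x <= q.[s x]%R.

(** The coefficients are natural numbers, so every monomial is monotone. *)
Lemma horner_nat_mono (q : {poly nat}) (x y : nat) :
  x <= y -> q.[x]%R <= q.[y]%R.
Proof.
move=> xy; rewrite !horner_coef; elim/big_ind2: _ => //.
- by move=> a b c d ab cd; exact: leq_add.
- move=> i _; apply: leq_mul => //; elim: (nat_of_ord i) => // k IHk.
  by rewrite !exprS; exact: leq_mul.
Qed.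

Section PolyBounded.
Variable X : Type.
Implicit Types s t g : X -> nat.

Lemma pb_id s : poly_bounded s s.
Proof. by exists 'X%R => x; rewrite hornerX. Qed.

Lemma pb_const s c : poly_bounded s (fun=> c).
Proof. by exists (c%:P)%R => x; rewrite hornerC. Qed.

Lemma pb_add s g1 g2 : poly_bounded s g1 -> poly_bounded s g2 ->
  poly_bounded s (fun x => g1 x + g2 x).
Proof.
move=> [p Hp] [q Hq]; exists (p + q)%R => x.
by rewrite hornerD; exact: leq_add.
Qed.

Lemma pb_mul s g1 g2 : poly_bounded s g1 -> poly_bounded s g2 ->
  poly_bounded s (fun x => g1 x * g2 x).
Proof.
move=> [p Hp] [q Hq]; exists (p * q)%R => x.
by rewrite hornerM; exact: leq_mul.
Qed.

Lemma pb_le s g1 g2 : (forall x, g1 x <= g2 x) -> poly_bounded s g2 ->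
  poly_bounded s g1.
Proof. by move=> le [q Hq]; exists q => x; exact: leq_trans (le x) (Hq x). Qed.

Lemma pb_horner s g (q : {poly nat}) : poly_bounded s g ->
  poly_bounded s (fun x => q.[g x]%R).
Proof.
move=> [p Hp]; exists (q \Po p)%R => x; rewrite horner_comp.
exact: horner_nat_mono.
Qed.

Lemma pb_trans s t g : poly_bounded s t -> poly_bounded t g ->
  poly_bounded s g.
Proof. by move=> st [q Hq]; apply: pb_le Hq (pb_horner q st). Qed.

Lemma pb_S s g : poly_bounded s g -> poly_bounded s (fun x => (g x).+1).
Proof.
move=> H; apply: (pb_le (g2 := fun x => g x + 1)) => [x|]; first by rewrite addn1.
exact: pb_add H (pb_const _ _).
Qed.

End PolyBounded.

Lemma pb_comp (X Y : Type) (u : Y -> X) (s g : X -> nat) :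
  poly_bounded s g -> poly_bounded (fun y => s (u y)) (fun y => g (u y)).
Proof. by move=> [q Hq]; exists q => y. Qed.

Ltac pb := repeat first
  [ eassumption | apply: pb_id | apply: pb_const | apply: pb_add | apply: pb_mul
  | apply: pb_S | apply: pb_horner ].

(** * Polynomial-time programs *)

Lemma closed_under_leq s j k : j <= k -> closed_under j s -> closed_under k s.
Proof.
elim: s j k => /= [i j k|s IHs t IHt j k|s IHs j k] jk.
- by move=> /leq_trans; apply.
- by move=> /andP[cs ct]; rewrite (IHs j k jk cs) (IHt j k jk ct).
- by apply: IHs; rewrite ltnS.
Qed.

Lemma subst_closed_under s k u : closed_under k s -> subst s k u = s.
Proof.
elim: s k => /= [i k|s IHs t IHt k|s IHs k].
- by case: ltngtP.
- by move=> /andP[cs ct]; rewrite IHs ?IHt.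
- by move=> cs; rewrite IHs.
Qed.

Lemma subst_closed s k u : closed_under 0 s -> subst s k u = s.
Proof. by move=> cs; exact/subst_closed_under/(closed_under_leq _ cs). Qed.

Lemma closed_quote d k : closed_under k (quote d).
Proof.
by elim: d k => //= a IHa b IHb k; rewrite IHa IHb.
Qed.

Lemma subst_quote d k u : subst (quote d) k u = quote d.
Proof. exact/subst_closed/closed_quote. Qed.

(** * Evaluation within a bounded number of steps *)

Definition ev n s v := exists2 i, i <= n & evaluates i s v.

Lemma ev_lam s : ev 0 (Lam s) (Lam s).
Proof. by exists 0 => //; exact: EvalLam. Qed.

Lemma ev_quote d : ev 0 (quote d) (quote d).
Proof. by case: d => [|a b]; exact: ev_lam. Qed.

Lemma ev_le a n s v : ev a s v -> a <= n -> ev n s v.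
Proof. by move=> [i ia E] an; exists i => //; exact: leq_trans an. Qed.

Lemma ev_of i s v : evaluates i s v -> ev i s v.
Proof. by exists i. Qed.

Lemma ev_app a b c n s s' t t' v : ev a s (Lam s') -> ev b t t' ->
  ev c (subst s' 0 t') v -> a + b + c < n -> ev n (App s t) v.
Proof.
move=> [i ia Es] [j jb Et] [k kc Ev] abcn; exists (i + j + k).+1; first by lia.
exact: EvalApp Es Et Ev.
Qed.

Lemma ev_app_lam b c n s' t t' v : ev b t t' -> ev c (subst s' 0 t') v ->
  b + c < n -> ev n (App (Lam s') t) v.
Proof. by move=> Et Ev; apply: ev_app (ev_lam s') Et Ev. Qed.

(* Programs are arbitrary closed terms, not necessarily abstractions; hence the
   inversion instead of a single beta-step. *)
Lemma ev_arg m n p t d v : ev m t (quote d) -> ev n (App p (quote d)) v ->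
  ev (m + n) (App p t) v.
Proof.
move=> Et [i iN Ep]; inversion Ep as [|j0 j1 j2 s0 s' t0 t' v0 E1 E2 E3]; subst.
have Et' : t' = quote d by case: (d) E2 => [|a b] /= E2; inversion E2.
subst t'; case: Et => k km Et; exists (j0 + k + j2).+1; last exact: EvalApp E1 Et E3.
lia.
Qed.

Lemma ev_arg2 m n p t d e v : ev m t (quote d) ->
  ev n (App (App p (quote d)) e) v -> ev (m + n) (App (App p t) e) v.
Proof.
move=> Et [i iN Ep]; inversion Ep as [|j0 j1 j2 s0 s' t0 t' v0 E1 E2 E3]; subst.
have [k km E1'] := ev_arg Et (ev_of E1).
by exists (k + j1 + j2).+1; [lia|exact: EvalApp E1' E2 E3].
Qed.

Definition cons_term := Lam (Lam (Lam (Lam (App (App (Var 0) (Var 3)) (Var 2))))).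

Lemma ev_cons m n s t a b : ev m s (quote a) -> ev n t (quote b) ->
  ev (m + n).+2 (App (App cons_term s) t) (quote (DCons a b)).
Proof.
move=> Es Et.
have E1 : ev m.+1 (App cons_term s)
    (Lam (Lam (Lam (App (App (Var 0) (quote a)) (Var 2))))).
  by apply: ev_app_lam Es _ _; [exact: ev_lam | lia].
apply: (ev_app (c := 0) E1 Et); last by lia.
by rewrite /= !subst_quote; exact: ev_lam.
Qed.

(** * Polynomial-time functions of a list of data *)

Definition env_size (X : Type) (E : X -> seq data) (x : X) : nat :=
  data_size (enc_seq (E x)).

(** A Scott-encoded datum is its own case analysis. Call by value evaluates both branches as
    arguments before the choice is made, so each of them has to be an abstraction. *)
Lemma ev_match_nil m s N C : closed_under 0 (Lam N) -> ev m s (quote DNil) ->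
  ev m.+2 (App (App s (Lam N)) (Lam C)) (Lam N).
Proof.
move=> cN Es; apply: (@ev_app m.+1 0 0 _ _ (Lam N) _ (Lam C)).
- by apply: (ev_app (c := 0) Es (ev_lam _) (ev_lam _)); lia.
- exact: ev_lam.
- by rewrite (subst_closed 0 (Lam C) cN); exact: ev_lam.
- by lia.
Qed.

Lemma ev_match_cons m k s N C a b v : ev m s (quote (DCons a b)) ->
  ev k (App (App (Lam C) (quote a)) (quote b)) v ->
  ev (m + k).+2 (App (App s (Lam N)) (Lam C)) v.
Proof.
move=> Es Ek; apply: (@ev_app m.+1 0 k _ _
  (App (App (Var 0) (quote a)) (quote b)) _ (Lam C)).
- apply: (ev_app (c := 0) Es (ev_lam _)); last by lia.
  by rewrite /= !subst_quote; exact: ev_lam.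
- exact: ev_lam.
- by rewrite /= !subst_quote.
- by lia.
Qed.

(* [f] is computable in polynomial time from the list of data [E]; the bound
   [T] also has to dominate the size of the value, which can be exponential in
   the number of beta-steps. *)
Definition polytime (X : Type) (E : X -> seq data) (f : X -> data) : Prop :=
  exists2 p, closed_under 0 p & exists2 T : X -> nat,
    poly_bounded (env_size E) T
  & forall x, ev (T x) (App p (quote (enc_seq (E x)))) (quote (f x)) /\
              data_size (f x) <= T x.

Section Polytime.
Variables (X : Type) (E : X -> seq data).
Implicit Types f g : X -> data.

Lemma pt_ext f g : f =1 g -> polytime E f -> polytime E g.
Proof.
move=> fg [p cp [T bT H]]; exists p => //; exists T => // x.
by rewrite -fg.
Qed.

Lemma pt_const d : polytime E (fun=> d).
Proof.
exists (Lam (quote d)); first by rewrite /= closed_quote.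
exists (fun=> (data_size d).+1); first by pb.
move=> x; split; last by [].
apply: ev_app_lam (ev_quote _) _ _; first by rewrite subst_quote; exact: ev_quote.
by [].
Qed.

Lemma pt_env : polytime E (fun x => enc_seq (E x)).
Proof.
exists (Lam (Var 0)) => //; exists (fun x => (env_size E x).+1); first by pb.
move=> x; split; last by rewrite /env_size.
by apply: ev_app_lam (ev_quote _) _ _; first exact: ev_quote.
Qed.

Lemma pt_cons f g : polytime E f -> polytime E g ->
  polytime E (fun x => DCons (f x) (g x)).
Proof.
move=> [p cp [T bT Hf]] [q cq [U bU Hg]].
exists (Lam (App (App cons_term (App p (Var 0))) (App q (Var 0)))).
  by rewrite /= !(closed_under_leq _ cp, closed_under_leq _ cq).
exists (fun x => T x + U x + 4); first by pb.
move=> x; have [[Ef sf] [Eg sg]] := (Hf x, Hg x); split=> /=; last by lia.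
apply: ev_app_lam (ev_quote _) _ _.
  by rewrite /= !subst_closed //; apply: ev_cons Ef Eg.
lia.
Qed.

Lemma pt_if_nil (s f g : X -> data) :
  polytime E s -> polytime E f -> polytime E g ->
  polytime E (fun x => if s x is DNil then f x else g x).
Proof.
move=> [r cr [S bS Hs]] [p cp [T bT Hf]] [q cq [U bU Hg]].
(* Both branches wait for the environment as a last argument, so only the selected one runs; the
   cons branch first discards the head and the tail. *)
exists (Lam (App (App (App (App r (Var 0)) (Lam (App p (Var 0))))
                      (Lam (Lam (Lam (App q (Var 0)))))) (Var 0))).
  by rewrite /= !(closed_under_leq _ cr, closed_under_leq _ cp,
                  closed_under_leq _ cq).
exists (fun x => S x + T x + U x + 10); first by pb.
move=> x; have [[Es _] [[Ef sf] [Eg sg]]] := (Hs x, (Hf x, Hg x)).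
split; last by case: (s x); lia.
apply: (@ev_app_lam 0 (S x + T x + U x + 8) _ _ _ _ _ (ev_quote _)); last by lia.
rewrite /= !subst_closed //; case: (s x) Es => [|a b] Es.
  apply: (ev_app (ev_match_nil _ _ Es) (ev_quote _)).
  - by rewrite /= (@closed_under_leq _ 0).
  - by rewrite /= subst_closed //; exact: Ef.
  - by lia.
apply: (ev_app (s' := App q (Var 0)) (c := U x)
                (ev_match_cons (k := 2) _ Es _) (ev_quote _)).
- apply: (@ev_app 1 0 0 _ _ (Lam (App q (Var 0))) _ (quote b)).
  + apply: (ev_app_lam (c := 0) (ev_quote _)) => //.
    by rewrite /= subst_closed //; exact: ev_lam.
  + exact: ev_quote.
  + by rewrite /= subst_closed //; exact: ev_lam.
  + by [].
- by rewrite /= subst_closed.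
- by lia.
Qed.

Lemma pt_head f : polytime E f ->
  polytime E (fun x => if f x is DCons a _ then a else DNil).
Proof.
move=> [p cp [T bT Hf]].
exists (Lam (App (App (App p (Var 0)) (quote DNil)) (Lam (Lam (Var 1))))).
  by rewrite /= (@closed_under_leq _ 0).
exists (fun x => T x + 10); first by pb.
move=> x; have [Ef sf] := Hf x; split; last by case: (f x) sf => /=; lia.
apply: (@ev_app_lam 0 (T x + 8) _ _ _ _ _ (ev_quote _)); last by lia.
rewrite /= !subst_closed //; case: (f x) Ef => [|a b] Ef.
  by apply: ev_le (ev_match_nil _ _ Ef) _; [|lia].
apply: ev_le (ev_match_cons (k := 2) _ Ef _) _; last by lia.
apply: (@ev_app 1 0 0 _ _ (quote a) _ (quote b)).
- by apply: (ev_app_lam (c := 0) (ev_quote _)); [exact: ev_lam|].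
- exact: ev_quote.
- by rewrite subst_quote; exact: ev_quote.
- by [].
Qed.

Lemma pt_behead f : polytime E f ->
  polytime E (fun x => if f x is DCons _ b then b else DNil).
Proof.
move=> [p cp [T bT Hf]].
exists (Lam (App (App (App p (Var 0)) (quote DNil)) (Lam (Lam (Var 0))))).
  by rewrite /= (@closed_under_leq _ 0).
exists (fun x => T x + 10); first by pb.
move=> x; have [Ef sf] := Hf x; split; last by case: (f x) sf => /=; lia.
apply: (@ev_app_lam 0 (T x + 8) _ _ _ _ _ (ev_quote _)); last by lia.
rewrite /= !subst_closed //; case: (f x) Ef => [|a b] Ef.
  by apply: ev_le (ev_match_nil _ _ Ef) _; [|lia].
apply: ev_le (ev_match_cons (k := 2) _ Ef _) _; last by lia.
apply: (@ev_app 1 0 0 _ _ (Var 0) _ (quote b)).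
- by apply: (ev_app_lam (c := 0) (ev_quote _)); [exact: ev_lam|].
- exact: ev_quote.
- exact: ev_quote.
- by [].
Qed.

Lemma pt_env_nth i : polytime E (fun x => nth DNil (E x) i).
Proof.
apply: (pt_ext (f := fun x => if enc_seq (drop i (E x)) is DCons a _ then a
                             else DNil)).
  by move=> x; rewrite -[in RHS](addn0 i) -nth_drop; case: (drop i (E x)).
apply: pt_head; elim: i => [|i IHi].
  by apply: pt_ext pt_env => x; rewrite drop0.
apply: pt_ext (pt_behead IHi) => x.
by rewrite -addn1 addnC -drop_drop; case: (drop i (E x)) => //= a s; rewrite drop0.
Qed.

End Polytime.

(** Composition. The size half of [polytime] for the inner program bounds the environment handed to
    the outer one, whose time is then polynomial in the original input. *)
Lemma pt_call X Y (u : Y -> X) (E : X -> seq data) (F : Y -> seq data) f :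
  polytime E f -> polytime F (fun y => enc_seq (E (u y))) ->
  polytime F (fun y => f (u y)).
Proof.
move=> [p cp [T bT Hf]] [q cq [U bU Hg]].
exists (Lam (App p (App q (Var 0)))).
  by rewrite /= !(closed_under_leq _ cp, closed_under_leq _ cq).
exists (fun y => U y + T (u y) + 3).
  have bT' : poly_bounded (env_size F) (fun y => T (u y)).
    apply: pb_trans (pb_comp u bT).
    by apply: pb_le bU => y; rewrite /env_size; case: (Hg y).
  by pb.
move=> y; have [[Ef sf] [Eg sg]] := (Hf (u y), Hg y); split; last by lia.
apply: ev_app_lam (ev_quote _) _ _.
  by rewrite /= !subst_closed //; apply: ev_arg Eg Ef.
lia.
Qed.

(** Recursion by self-application: the first argument is the loop itself, then come the list and the
    environment. In the cons branch [Var 2], [Var 1] and [Var 0] are the head, the tail and the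
    environment, and [Var 5] is the loop; [step] receives the head and the accumulator in front of
    the environment. *)
Definition fold_loop (init step : term) : term :=
  Lam (Lam (Lam (App (App (App (Var 1) (Lam (App init (Var 0))))
    (Lam (Lam (Lam (App step (App (App cons_term (Var 2))
       (App (App cons_term (App (App (App (Var 5) (Var 5)) (Var 1)) (Var 0)))
          (Var 0)))))))) (Var 0)))).

Lemma ev_fold_loop init step W d e k v :
  closed_under 0 init -> closed_under 0 step -> W = fold_loop init step ->
  ev k (App (App (App (quote d) (Lam (App init (Var 0))))
    (Lam (Lam (Lam (App step (App (App cons_term (Var 2))
       (App (App cons_term (App (App (App W W) (Var 1)) (Var 0)))
          (Var 0)))))))) (quote e)) v ->
  ev (k + 3) (App (App (App W W) (quote d)) (quote e)) v.
Proof.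
move=> ci cs EW Ek.
have cW : closed_under 0 W.
  by rewrite EW /= !(closed_under_leq _ ci, closed_under_leq _ cs).
have EVW : ev 0 W W by rewrite EW; exact: ev_lam.
apply: (@ev_app 2 0 k).
- apply: (@ev_app 1 0 0).
  + rewrite {1}EW; apply: (ev_app_lam (b := 0) (c := 0) EVW) => //.
    by rewrite /= !subst_closed //; exact: ev_lam.
  + exact: ev_quote.
  + by rewrite /= !subst_closed //; exact: ev_lam.
  + by [].
- exact: ev_quote.
- by rewrite /= !subst_quote !subst_closed.
- by lia.
Qed.

Lemma data_size_seq (s : seq data) (i : nat) : i < size s ->
  data_size (nth DNil s i) < data_size (enc_seq s).
Proof.
elim: s i => [|a s IHs] [|i] //= lti; first by lia.
by apply: leq_trans (IHs i lti) _; lia.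
Qed.

Lemma size_data_seq (s : seq data) : size s < data_size (enc_seq s).
Proof. by elim: s => //= a s IHs; lia. Qed.

(* [R x i] is the accumulator once the entries of index at least [i] have been
   processed. The step program is only required to be correct on the accumulators
   that do occur, hence the index type of the third hypothesis. *)
Lemma pt_foldr_gen X (E l : X -> seq data) (R : X -> nat -> data) (B : X -> nat) :
  polytime E (fun x => enc_seq (l x)) ->
  polytime E (fun x => R x (size (l x))) ->
  polytime (X := {x : X & 'I_(size (l x))})
    (fun y => nth DNil (l (tag y)) (tagged y) :: R (tag y) (tagged y).+1
              :: E (tag y))
    (fun y => R (tag y) (tagged y)) ->
  poly_bounded (env_size E) B ->
  (forall x i, i <= size (l x) -> data_size (R x i) <= B x) ->
  polytime E (fun x => R x 0).
Proof.
move=> [pl cl [Tl bl Hl]] [p0 c0 [T0 b0 H0]] [ps cs [Ts [q bs] Hs]] bB HB.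
set W := fold_loop p0 ps; have EW : W = fold_loop p0 ps by [].
have cW : closed_under 0 W.
  by rewrite /= !(closed_under_leq _ c0, closed_under_leq _ cs).
clearbody W.
exists (Lam (App (App (App W W) (App pl (Var 0))) (Var 0))).
  by rewrite /= !(closed_under_leq _ cl, closed_under_leq _ cW).
(* One bound for the environment of the step program at every iteration: the current entry is
   smaller than the list, and the accumulator has size at most [B x]. *)
pose m x := (Tl x + B x + env_size E x).+2.
pose C x := q.[m x]%R + 30.
exists (fun x => Tl x + T0 x + Tl x * C x + C x + B x).
  by rewrite /C /m; pb.
move=> x; have [[El sl] [E0 s0]] := (Hl x, H0 x).
split; last by have := HB x 0 isT; lia.
have loop i : i <= size (l x) ->
  ev (T0 x + (size (l x) - i) * C x + 10)
    (App (App (App W W) (quote (enc_seq (drop i (l x)))))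
       (quote (enc_seq (E x)))) (quote (R x i)).
  move=> ile; move: {2}(size (l x) - i) (erefl (size (l x) - i)) => k.
  elim: k i ile => [|k IHk] i ile ki.
    have -> : i = size (l x) by lia.
    rewrite drop_size subnn.
    apply: (@ev_le (T0 x + 4 + 3)); last by lia.
    apply: (ev_fold_loop c0 cs EW).
    apply: (ev_app (ev_match_nil (m := 0) _ _ (ev_quote _)) (ev_quote _)).
    + by rewrite /= (@closed_under_leq _ 0).
    + by rewrite /= !subst_closed //; exact: E0.
    + by lia.
  have ilt : i < size (l x) by lia.
  have {}IHk := IHk i.+1 ilt ltac:(lia).
  have [Es _] := Hs (Tagged (fun x => 'I_(size (l x))) (Ordinal ilt)).
  have := bs (Tagged (fun x => 'I_(size (l x))) (Ordinal ilt)).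
  move: Es; rewrite /env_size /=.
  set a := nth DNil (l x) i; set r := R x i.+1 => Es leTs.
  have {leTs} leTs : Ts (Tagged (fun x => 'I_(size (l x))) (Ordinal ilt)) <= q.[m x]%R.
    apply: leq_trans leTs _; apply: horner_nat_mono; rewrite /m /env_size.
    have := data_size_seq ilt; have := HB x i.+1 ilt; rewrite -/a -/r; lia.
  have {leTs} Es := ev_le Es leTs.
  rewrite (drop_nth DNil ilt) -/a [enc_seq (_ :: _)]/=.
  apply: (@ev_le (T0 x + (size (l x) - i.+1) * C x + q.[m x]%R + 25 + 3)).
    apply: (ev_fold_loop c0 cs EW).
    apply: (ev_app (a := 4) (b := 0)
      (c := T0 x + (size (l x) - i.+1) * C x + q.[m x]%R + 20) _ (ev_quote _)).
    + apply: (ev_match_cons (m := 0) (k := 2) _ (ev_quote (DCons _ _))).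
      apply: (@ev_app 1 0 0).
      * apply: (ev_app_lam (c := 0) (ev_quote _)) => //.
        by rewrite /= !subst_closed //; exact: ev_lam.
      * exact: ev_quote.
      * by rewrite /= !subst_quote !subst_closed //; exact: ev_lam.
      * by [].
    + rewrite /= !subst_quote !subst_closed //.
      apply: ev_le (ev_arg (ev_cons (ev_quote a) (ev_cons IHk (ev_quote _))) Es) _.
      by lia.
    + by lia.
  by rewrite /C; nia.
apply: ev_app_lam (ev_quote _) _ _.
  rewrite /= !subst_closed //.
  by have := loop 0 isT; rewrite drop0 subn0; exact: ev_arg2 El.
have lT : size (l x) <= Tl x by have := size_data_seq (l x); lia.
have : size (l x) * C x <= Tl x * C x by rewrite leq_mul2r lT orbT.
have : 30 <= C x by rewrite /C; lia.
lia.
Qed.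

(** The mapped function is passed as [W] and applied as [W W], since it is going to be a tree
    recursion that calls this loop. The final [DNil] is a dummy that triggers the suspended
    branch. *)
Definition map_loop : term :=
  Lam (Lam (Lam (App (App (App (Var 0) (Lam (quote DNil)))
    (Lam (Lam (Lam (App (App cons_term (App (App (Var 4) (Var 4)) (Var 2)))
       (App (App (App (Var 5) (Var 5)) (Var 4)) (Var 1))))))) (quote DNil)))).

Lemma ev_map_loop_step L W l k v : L = map_loop -> closed_under 0 W ->
  ev 0 W W ->
  ev k (App (App (App (quote l) (Lam (quote DNil)))
    (Lam (Lam (Lam (App (App cons_term (App (App W W) (Var 2)))
       (App (App (App L L) W) (Var 1))))))) (quote DNil)) v ->
  ev (k + 3) (App (App (App L L) W) (quote l)) v.
Proof.
move=> EL cW EvW Ek.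
have cL : closed_under 0 L by rewrite EL.
have EvL : ev 0 L L by rewrite EL; exact: ev_lam.
apply: (@ev_app 2 0 k).
- apply: (@ev_app 1 0 0).
  + rewrite {1}EL; apply: (ev_app_lam (b := 0) (c := 0) EvL) => //.
    exact: ev_lam.
  + exact: EvW.
  + by rewrite /= !subst_closed //; exact: ev_lam.
  + by [].
- exact: ev_quote.
- by rewrite /= !subst_closed.
- by lia.
Qed.

Lemma ev_map_loop Y (y0 : Y) (d r : Y -> data) (T : Y -> nat) W (s : seq Y) :
  closed_under 0 W -> ev 0 W W ->
  (forall i, i < size s -> ev (T (nth y0 s i)) (App (App W W)
     (quote (d (nth y0 s i)))) (quote (r (nth y0 s i)))) ->
  ev (\sum_(y <- s) T y + 20 * size s + 10)
    (App (App (App map_loop map_loop) W) (quote (enc_seq [seq d y | y <- s])))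
    (quote (enc_seq [seq r y | y <- s])).
Proof.
move=> cW EvW.
have [L EL] : exists L, L = map_loop by eexists.
have cL : closed_under 0 L by rewrite EL.
rewrite -!EL; elim: s => [|y s IHs] H.
- rewrite big_nil; apply: (@ev_le (3 + 3)); last by [].
  apply: (ev_map_loop_step EL cW EvW).
  apply: (ev_app (ev_match_nil (m := 0) _ _ (ev_quote DNil)) (ev_quote DNil)) => //.
    exact: (ev_quote DNil).
  by [].
- have Hy := H 0 isT; rewrite /= in Hy.
  have {}IHs := IHs (fun i => H i.+1).
  rewrite big_cons [size _]/=.
  apply: (@ev_le (T y + \sum_(y <- s) T y + 20 * size s + 20 + 3)); last by lia.
  apply: (ev_map_loop_step EL cW EvW).
  apply: (@ev_app 4 0 (T y + \sum_(y <- s) T y + 20 * size s + 15)).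
  + apply: (ev_match_cons (m := 0) (k := 2) _ (ev_quote (DCons _ _))).
    apply: (@ev_app 1 0 0).
    * apply: (ev_app_lam (c := 0) (ev_quote _)) => //.
      by rewrite /= !subst_closed //; exact: ev_lam.
    * exact: ev_quote.
    * by rewrite /= !subst_quote !subst_closed //; exact: ev_lam.
    * by [].
  + exact: (ev_quote DNil).
  + rewrite /= !subst_quote !subst_closed //.
    apply: ev_le (ev_cons Hy IHs) _; lia.
  + lia.
Qed.

Definition tree_loop (split comb : term) : term :=
  Lam (Lam (App comb (App (App cons_term
    (App (App (App map_loop map_loop) (Var 1)) (App split (Var 0)))) (Var 0)))).

(* Recursion on a tree of subproblems. The program needs no fuel; [k] only makes
   [tree_rec] structurally recursive. The time is polynomial because [w] bounds the
   number of subproblems and [M] is the same for all of them. *)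
Section TreeRec.
Variables (X : Type) (split : X -> seq X) (comb : X -> seq data -> data).

Fixpoint tree_rec (k : nat) (x : X) : data :=
  if k is k'.+1 then comb x [seq tree_rec k' y | y <- split x] else DNil.

Variables (E : X -> seq data) (M w b : X -> nat).
Hypothesis pt_split :
  polytime E (fun x => enc_seq [seq enc_seq (E y) | y <- split x]).
Hypothesis pt_comb : polytime (fun z : X * seq data => enc_seq z.2 :: E z.1)
  (fun z => comb z.1 z.2).
Hypothesis comb_size :
  forall x rs, data_size (comb x rs) <= b x + data_size (enc_seq rs).
Hypothesis M_split : forall x i, i < size (split x) -> M (nth x (split x) i) = M x.
Hypothesis w_split : forall x, \sum_(y <- split x) w y < w x.
Hypothesis bM : poly_bounded (env_size E) M.
Hypothesis bE : poly_bounded M (env_size E).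
Hypothesis bw : poly_bounded M w.
Hypothesis bb : poly_bounded M b.

Lemma size_split x : size (split x) <= \sum_(y <- split x) w y.
Proof.
elim: (split x) => [|y s IHs]; first by rewrite big_nil.
by rewrite big_cons /=; have := w_split y; lia.
Qed.

Lemma sum_split_nth (G : X -> nat) x :
  \sum_(y <- split x) G y = \sum_(i < size (split x)) G (nth x (split x) i).
Proof. by rewrite (big_nth x) big_mkord. Qed.

(** By [w_split] the weight exceeds the total weight of the children, so it pays a fixed allowance
    for every node of the recursion. Both the size of the result and the time are bounded by the
    weight times an allowance that depends on [M] only, hence is the same at all nodes. *)
Lemma pt_tree_rec (k : X -> nat) : (forall x, w x <= k x) ->
  polytime E (fun x => tree_rec (k x) x).
Proof.
have [qE HE] := bE; have [qw Hw] := bw; have [qb Hb] := bb.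
(* The size allowance of a node: the overhead of [comb], the end of the list of results, and one
   more for a strict inequality, which pays for the cell holding the result in the list of the
   parent. *)
pose c x := qb.[M x]%R + 2.
have size_rec j x : w x <= j -> data_size (tree_rec j x) < w x * c x.
  elim: j x => [|j IHj] x wj; first by have := w_split x; lia.
  rewrite /=; apply: (@leq_ltn_trans (b x + (1 + (\sum_(y <- split x) w y) * c x))).
    apply: leq_trans (comb_size _ _) _; rewrite leq_add2l.
    have -> : data_size (enc_seq [seq tree_rec j y | y <- split x]) =
        1 + \sum_(y <- split x) (data_size (tree_rec j y)).+1.
      elim: (split x) => [|y s IHs]; rewrite ?big_nil ?big_cons //= IHs; lia.
    rewrite leq_add2l big_distrl /= !sum_split_nth; apply: leq_sum => i _.
    have yM := M_split (ltn_ord i).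
    have -> : c x = c (nth x (split x) i) by rewrite /c yM.
    apply: IHj; rewrite -ltnS; apply: leq_trans wj.
    apply: leq_ltn_trans (w_split x); rewrite sum_split_nth.
    by rewrite (bigD1 i) //= leq_addr.
  have := w_split x; have := Hb x; rewrite -/(c x) => bx wx.
  have : (\sum_(y <- split x) w y).+1 * c x <= w x * c x by rewrite leq_mul2r wx orbT.
  by rewrite mulSn /c; lia.
move=> wk.
have [ps cs [Ts [qs bs] Hs]] := pt_split; have [pc cc [Tc [qc bc] Hc]] := pt_comb.
set W := tree_loop ps pc; have EW : W = tree_loop ps pc by [].
have cW : closed_under 0 W.
  by rewrite /= !(closed_under_leq _ cs, closed_under_leq _ cc).
clearbody W.
have EvW : ev 0 W W by rewrite EW; exact: ev_lam.
exists (App W W); first by rewrite /= !cW.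
(* The time allowance of a node: running [split], running [comb] on results of the size bounded
   above, and a linear term for the traversal of the children. *)
pose D x := qs.[qE.[M x]]%R + qc.[qw.[M x]%R * c x + qE.[M x]%R + 2]%R +
  20 * qw.[M x]%R + 50.
exists (fun x => qw.[M x]%R * D x + qw.[M x]%R * c x); first by rewrite /D /c; pb.
(* The fuel occurs only in the specification; the program evaluated is [W W] for every [j]. *)
suff loop j x : w x <= j -> ev (w x * D x)
    (App (App W W) (quote (enc_seq (E x)))) (quote (tree_rec j x)).
  move=> x; split.
    apply: ev_le (loop _ _ (wk x)) _.
    have := leq_mul (Hw x) (leqnn (D x)); lia.
  have := size_rec _ _ (wk x); have := leq_mul (Hw x) (leqnn (c x)); lia.
elim: j x => [|j IHj] x wj; first by have := w_split x; lia.
set rs := [seq tree_rec j y | y <- split x].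
have [Es _] := Hs x; have [Ec _] := Hc (x, rs).
have {}Es : ev qs.[qE.[M x]]%R (App ps (quote (enc_seq (E x))))
    (quote (enc_seq [seq enc_seq (E y) | y <- split x])).
  by apply: ev_le Es _; apply: leq_trans (bs x) _; exact: horner_nat_mono.
have lt_w i : i < size (split x) -> w (nth x (split x) i) <= j.
  move=> lti; rewrite -ltnS; apply: leq_trans wj.
  apply: leq_ltn_trans (w_split x); rewrite sum_split_nth.
  by rewrite (bigD1 (Ordinal lti)) //= leq_addr.
have size_rs : data_size (enc_seq rs) <= qw.[M x]%R * c x.
  have -> : data_size (enc_seq rs) =
      1 + \sum_(y <- split x) (data_size (tree_rec j y)).+1.
    rewrite /rs; elim: (split x) => [|y s IHs]; rewrite ?big_nil ?big_cons //= IHs; lia.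
  have le1 : \sum_(y <- split x) (data_size (tree_rec j y)).+1 <=
      (\sum_(y <- split x) w y) * c x.
    rewrite big_distrl /= !sum_split_nth; apply: leq_sum => i _.
    have yM := M_split (ltn_ord i).
    have -> : c x = c (nth x (split x) i) by rewrite /c yM.
    by apply: size_rec; exact: lt_w.
  have := leq_mul (leq_trans (w_split x) (Hw x)) (leqnn (c x)).
  by rewrite mulSn {1}/c; lia.
have {}Ec : ev qc.[qw.[M x]%R * c x + qE.[M x]%R + 2]%R
    (App pc (quote (DCons (enc_seq rs) (enc_seq (E x))))) (quote (comb x rs)).
  apply: ev_le Ec _; apply: leq_trans (bc (x, rs)) _; apply: horner_nat_mono.
  by rewrite /env_size /=; have := HE x; rewrite /env_size; lia.
have Em : ev (\sum_(y <- split x) w y * D y + 20 * size (split x) + 10)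
    (App (App (App map_loop map_loop) W)
       (quote (enc_seq [seq enc_seq (E y) | y <- split x]))) (quote (enc_seq rs)).
  apply: (ev_map_loop (y0 := x) cW EvW) => i lti.
  by apply: IHj; exact: lt_w.
apply: (@ev_app 1 0 (\sum_(y <- split x) w y * D y + 20 * size (split x) + 10 +
   qs.[qE.[M x]]%R + qc.[qw.[M x]%R * c x + qE.[M x]%R + 2]%R + 10)).
- rewrite {1}EW; apply: (ev_app_lam (b := 0) (c := 0) EvW) => //.
  by rewrite /= !subst_closed //; exact: ev_lam.
- exact: ev_quote.
- rewrite /= !subst_closed //.
  apply: ev_le (ev_arg (ev_cons (ev_arg Es Em) (ev_quote _)) Ec) _; lia.
- have -> : \sum_(y <- split x) w y * D y = (\sum_(y <- split x) w y) * D x.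
    rewrite big_distrl /= !sum_split_nth; apply: eq_bigr => i _.
    by rewrite /D /c M_split.
  have := leq_mul (w_split x) (leqnn (D x)); rewrite mulSn.
  have := size_split x; have := leq_trans (w_split x) (Hw x).
  have : D x = qs.[qE.[M x]]%R + qc.[qw.[M x]%R * c x + qE.[M x]%R + 2]%R +
    20 * qw.[M x]%R + 50 by [].
  move: (D x) (w x * D x) (_ * D x) => d B A; lia.
Qed.

End TreeRec.

(** * Programs on lists, numbers and finite sets *)

Ltac pt_var := solve
  [ exact: (pt_env_nth _ 0) | exact: (pt_env_nth _ 1) | exact: (pt_env_nth _ 2)
  | exact: (pt_env_nth _ 3) | exact: (pt_env_nth _ 4) | exact: (pt_env_nth _ 5)
  | exact: (pt_env_nth _ 6) | exact: (pt_env_nth _ 7) | exact: (pt_env_nth _ 8)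
  | exact: (pt_env_nth _ 9) | exact: (pt_env_nth _ 10) | exact: (pt_env_nth _ 11)
  | exact: (pt_env_nth _ 12) | exact: (pt_env_nth _ 13) ].

Lemma pt_weaken X Y (u : Y -> X) (a : Y -> data) (E : X -> seq data) f :
  polytime E f -> polytime (fun y => a y :: E (u y)) (fun y => f (u y)).
Proof.
move=> Hf; apply: (pt_call Hf).
exact: (pt_behead (pt_env (fun y => a y :: E (u y)))).
Qed.

(** A polynomial-time step does not keep the accumulator polynomial, since it could double it at
    each entry; hence the explicit [bound] on all intermediate accumulators. *)
Lemma pt_foldr X (E : X -> seq data) (A : X -> Type) (B : Type)
    (ea : forall x, A x -> data) (eb : B -> data) (l : forall x, seq (A x))
    (b0 : X -> B) (g : forall x, A x -> B -> B) (bound : X -> nat) :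
  polytime E (fun x => enc_seq [seq ea x a | a <- l x]) ->
  polytime E (fun x => eb (b0 x)) ->
  polytime (X := {x : X & (A x * B)%type})
    (fun y => ea (tag y) (tagged y).1 :: eb (tagged y).2 :: E (tag y))
    (fun y => eb (g (tag y) (tagged y).1 (tagged y).2)) ->
  poly_bounded (env_size E) bound ->
  (forall x i, data_size (eb (foldr (g x) (b0 x) (drop i (l x)))) <= bound x) ->
  polytime E (fun x => eb (foldr (g x) (b0 x) (l x))).
Proof.
move=> Hl Hb Hg bb sb.
pose R x i := eb (foldr (g x) (b0 x) (drop i (l x))).
apply: (pt_ext (f := fun x => R x 0)); first by move=> x; rewrite /R drop0.
apply: pt_foldr_gen Hl _ _ bb _.
- by apply: pt_ext Hb => x; rewrite /R size_map drop_size.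
- pose iy (y : {x : X & 'I_(size [seq ea x a | a <- l x])}) : 'I_(size (l (tag y))) :=
    cast_ord (size_map (ea (tag y)) (l (tag y))) (tagged y).
  pose el y := tnth (in_tuple (l (tag y))) (iy y).
  pose u y := Tagged (fun x => (A x * B)%type)
    (el y, foldr (g (tag y)) (b0 (tag y)) (drop (iy y).+1 (l (tag y)))).
  have Hel y : nth DNil [seq ea (tag y) a | a <- l (tag y)] (iy y) = ea (tag y) (el y).
    by rewrite (nth_map (el y)) // -[in LHS](tnth_nth _ (in_tuple (l (tag y)))).
  apply: (pt_ext (f := fun y => eb (g (tag (u y)) (tagged (u y)).1 (tagged (u y)).2))).
    move=> y; rewrite /R; congr (eb _); rewrite [RHS](_ : _ =
      foldr (g (tag y)) (b0 (tag y)) (drop (iy y) (l (tag y)))) //.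
    rewrite (drop_nth (el y)) //.
    by rewrite -[nth _ _ _](tnth_nth _ (in_tuple (l (tag y)))).
  apply: (pt_call (u := u) Hg); apply: (pt_ext (f := fun y => enc_seq
      (nth DNil [seq ea (tag y) a | a <- l (tag y)] (iy y) ::
       R (tag y) (iy y).+1 :: E (tag y)))).
    by move=> y; rewrite Hel.
  exact: pt_env.
- by move=> x i _; exact: sb.
Qed.


Lemma pt_if X (E : X -> seq data) (b : X -> bool) f g : polytime E (fun x => enc_bool (b x)) ->
  polytime E f -> polytime E g -> polytime E (fun x => if b x then f x else g x).
Proof.
move=> Hb Hf Hg; apply: pt_ext (pt_if_nil Hb Hg Hf) => x.
by case: (b x).
Qed.

Lemma pt_not X (E : X -> seq data) (b : X -> bool) : polytime E (fun x => enc_bool (b x)) ->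
  polytime E (fun x => enc_bool (~~ b x)).
Proof.
move=> Hb; apply: pt_ext (pt_if Hb (pt_const _ (enc_bool false))
  (pt_const _ (enc_bool true))) => x; by case: (b x).
Qed.

Lemma pt_and X (E : X -> seq data) (a b : X -> bool) : polytime E (fun x => enc_bool (a x)) ->
  polytime E (fun x => enc_bool (b x)) ->
  polytime E (fun x => enc_bool (a x && b x)).
Proof.
move=> Ha Hb; apply: pt_ext (pt_if Ha Hb (pt_const _ (enc_bool false))) => x.
by case: (a x).
Qed.

Lemma pt_or X (E : X -> seq data) (a b : X -> bool) : polytime E (fun x => enc_bool (a x)) ->
  polytime E (fun x => enc_bool (b x)) ->
  polytime E (fun x => enc_bool (a x || b x)).
Proof.
move=> Ha Hb; apply: pt_ext (pt_if Ha (pt_const _ (enc_bool true)) Hb) => x.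
by case: (a x).
Qed.

Lemma pt_isnil X (E : X -> seq data) (s : X -> seq data) : polytime E (fun x => enc_seq (s x)) ->
  polytime E (fun x => enc_bool (nilp (s x))).
Proof.
move=> Hs; apply: pt_ext (pt_if_nil Hs (pt_const _ (enc_bool true))
  (pt_const _ (enc_bool false))) => x; by case: (s x).
Qed.

Lemma data_size_drop i (s : seq data) :
  data_size (enc_seq (drop i s)) <= data_size (enc_seq s).
Proof. by elim: s i => [|a s IHs] [|i] //=; apply: leq_trans (IHs i) _; lia. Qed.

Lemma data_size_cat (s t : seq data) :
  data_size (enc_seq (s ++ t)) <= data_size (enc_seq s) + data_size (enc_seq t).
Proof. by elim: s => [|a s IHs] /=; lia. Qed.

Lemma pt_size X (E : X -> seq data) (f : X -> data) : polytime E f ->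
  poly_bounded (env_size E) (fun x => data_size (f x)).
Proof. by move=> [p cp [T bT H]]; apply: pb_le bT => x; case: (H x). Qed.

Lemma pt_cat X (E : X -> seq data) (s t : X -> seq data) : polytime E (fun x => enc_seq (s x)) ->
  polytime E (fun x => enc_seq (t x)) ->
  polytime E (fun x => enc_seq (s x ++ t x)).
Proof.
move=> Hs Ht; have bs := pt_size Hs; have bt := pt_size Ht.
have cat_foldr (s1 s2 : seq data) : s1 ++ s2 = foldr cons s2 s1.
  by elim: s1 => //= a s1 ->.
apply: (pt_ext (f := fun x => enc_seq (foldr cons (t x) (s x)))).
  by move=> x; rewrite cat_foldr.
apply: (pt_foldr (A := fun=> data) (ea := fun=> id) (eb := enc_seq)
  (l := s) (b0 := t) (g := fun=> cons) (bound := fun x =>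
  data_size (enc_seq (s x)) + data_size (enc_seq (t x)))) => //.
- by apply: pt_ext Hs => x; rewrite map_id.
- by apply: pt_cons; pt_var.
- by pb.
- move=> x i; rewrite -cat_foldr; apply: leq_trans (data_size_cat _ _) _.
  by rewrite leq_add2r data_size_drop.
Qed.

Lemma pt_flatten X (E : X -> seq data) (s : X -> seq (seq data)) :
  polytime E (fun x => enc_seq [seq enc_seq t | t <- s x]) ->
  polytime E (fun x => enc_seq (flatten (s x))).
Proof.
move=> Hs; have bs := pt_size Hs.
apply: (pt_foldr (A := fun=> seq data) (ea := fun=> enc_seq) (eb := enc_seq)
  (l := s) (b0 := fun=> [::]) (g := fun=> cat) (bound := fun x =>
  data_size (enc_seq [seq enc_seq t | t <- s x]))) => //.
- exact: pt_const.
- by apply: pt_cat; pt_var.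
- move=> x i; apply: leq_trans (data_size_drop i _); rewrite -map_drop.
  elim: (drop i (s x)) => //= a r IHr; apply: leq_trans (data_size_cat _ _) _.
  lia.
Qed.

Lemma pt_drop X (E : X -> seq data) (i : X -> nat) (s : X -> seq data) :
  polytime E (fun x => enc_nat (i x)) -> polytime E (fun x => enc_seq (s x)) ->
  polytime E (fun x => enc_seq (drop (i x) (s x))).
Proof.
move=> Hi Hs; have bs := pt_size Hs.
have drop_foldr k (r : seq data) : foldr (fun _ => behead) r (nseq k DNil) = drop k r.
  by elim: k => [|k /= ->]; rewrite ?drop0 // -add1n -drop_drop drop1.
apply: (pt_ext (f := fun x =>
    enc_seq (foldr (fun _ => behead) (s x) (nseq (i x) DNil)))).
  by move=> x; rewrite drop_foldr.
apply: (pt_foldr (A := fun=> data) (ea := fun=> id) (eb := enc_seq)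
  (l := fun x => nseq (i x) DNil) (b0 := s) (g := fun _ _ => behead)
  (bound := fun x => data_size (enc_seq (s x)))) => //.
- by apply: pt_ext Hi => x; rewrite map_id.
- have H1 : polytime (fun y : {_ : X & (data * seq data)%type} =>
      (tagged y).1 :: enc_seq (tagged y).2 :: E (tag y))
    (fun y => enc_seq (tagged y).2) by pt_var.
  by apply: pt_ext (pt_behead H1) => y; case: ((tagged y).2).
- by move=> x k; rewrite drop_nseq drop_foldr data_size_drop.
Qed.

Lemma pt_nth X (E : X -> seq data) (i : X -> nat) (s : X -> seq data) :
  polytime E (fun x => enc_nat (i x)) -> polytime E (fun x => enc_seq (s x)) ->
  polytime E (fun x => nth DNil (s x) (i x)).
Proof.
move=> Hi Hs; apply: pt_ext (pt_head (pt_drop Hi Hs)) => x.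
by rewrite -[in RHS](addn0 (i x)) -nth_drop; case: (drop _ _).
Qed.

Lemma pt_succ X (E : X -> seq data) (i : X -> nat) : polytime E (fun x => enc_nat (i x)) ->
  polytime E (fun x => enc_nat (i x).+1).
Proof. exact/pt_cons/pt_const. Qed.

Lemma pt_add X (E : X -> seq data) (i j : X -> nat) : polytime E (fun x => enc_nat (i x)) ->
  polytime E (fun x => enc_nat (j x)) ->
  polytime E (fun x => enc_nat (i x + j x)).
Proof.
move=> Hi Hj; apply: pt_ext (pt_cat Hi Hj) => x.
by rewrite -nseqD.
Qed.

Lemma pt_leq X (E : X -> seq data) (i j : X -> nat) : polytime E (fun x => enc_nat (i x)) ->
  polytime E (fun x => enc_nat (j x)) ->
  polytime E (fun x => enc_bool (i x <= j x)).
Proof.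
move=> Hi Hj; apply: pt_ext (pt_isnil (pt_drop Hj Hi)) => x.
by rewrite /nilp size_drop size_nseq.
Qed.

Lemma pt_eqn X (E : X -> seq data) (i j : X -> nat) : polytime E (fun x => enc_nat (i x)) ->
  polytime E (fun x => enc_nat (j x)) ->
  polytime E (fun x => enc_bool (i x == j x)).
Proof.
move=> Hi Hj; apply: pt_ext (pt_and (pt_leq Hi Hj) (pt_leq Hj Hi)) => x.
by rewrite -eqn_leq.
Qed.

Lemma data_size_nat k : data_size (enc_nat k) = k.*2.+1.
Proof. by elim: k => //= k ->; lia. Qed.

Lemma data_size_bool b : data_size (enc_bool b) <= 3.
Proof. by case: b. Qed.

Lemma data_size_map_leq (T : Type) (f : T -> data) (r : seq T) c :
  (forall a, data_size (f a) <= c) ->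
  data_size (enc_seq [seq f a | a <- r]) <= (size r * c.+1).+1.
Proof. by move=> H; elim: r => //= a r IHr; have := H a; lia. Qed.

Lemma pt_iota X (E : X -> seq data) (n : X -> nat) : polytime E (fun x => enc_nat (n x)) ->
  polytime E (fun x => enc_seq [seq enc_nat i | i <- iota 0 (n x)]).
Proof.
move=> Hn; have bn := pt_size Hn.
(* A right fold meets the entries from the last one on. Carrying a counter and appending at the end
   still produces the numbers in increasing order. *)
pose g (_ : data) (z : nat * seq data) := (z.1.+1, rcons z.2 (enc_nat z.1)).
pose eb (z : nat * seq data) := DCons (enc_nat z.1) (enc_seq z.2).
have gE k : foldr g (0, [::]) (nseq k DNil) = (k, [seq enc_nat i | i <- iota 0 k]).
  elim: k => // k IHk; rewrite [LHS]/= IHk /g /=; congr (_, _).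
  by rewrite -map_rcons -cats1 -(iotaD 0 k 1) addn1.
apply: (pt_ext (f := fun x =>
    if eb (foldr g (0, [::]) (nseq (n x) DNil)) is DCons _ b then b else DNil)).
  by move=> x; rewrite gE.
apply: (pt_behead (f := fun x => eb (foldr g (0, [::]) (nseq (n x) DNil)))).
apply: (pt_foldr (A := fun=> data) (ea := fun=> id) (eb := eb)
  (l := fun x => nseq (n x) DNil) (b0 := fun=> (0, [::])) (g := fun=> g)
  (bound := fun x => data_size (enc_nat (n x)) +
    (data_size (enc_nat (n x)) * (data_size (enc_nat (n x))).+1).+1 + 1)) => //.
- by apply: pt_ext Hn => x; rewrite map_id.
- exact: pt_const.
- apply: (pt_ext (f := fun y : {_ : X & (data * (nat * seq data))%type} =>
    DCons (enc_nat (tagged y).2.1.+1)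
      (enc_seq ((tagged y).2.2 ++ [:: enc_nat (tagged y).2.1])))).
    by move=> y; rewrite /eb /g /= cats1.
  have Hz : polytime (fun y : {_ : X & (data * (nat * seq data))%type} =>
      (tagged y).1 :: eb (tagged y).2 :: E (tag y)) (fun y => eb (tagged y).2).
    by pt_var.
  have H1 := pt_head Hz; have H2 := pt_behead Hz.
  apply: pt_cons; first exact: pt_succ H1.
  by apply: pt_cat H2 _; apply: pt_cons H1 (pt_const _ _).
- by pb.
- move=> x i; rewrite drop_nseq gE /eb /= !data_size_nat.
  set k := n x - i; have le_k : k <= n x by rewrite leq_subr.
  have : data_size (enc_seq [seq enc_nat j | j <- iota 0 k]) <= (k * k.*2.+2).+1.
    have : forall j, j \in iota 0 k -> data_size (enc_nat j) <= k.*2.+1.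
      by move=> j; rewrite mem_iota data_size_nat; lia.
    rewrite -[X in (X * _).+1](size_iota 0 k); elim: (iota 0 k) => //= a r IHr H.
    have := IHr (fun j jr => H j (mem_behead (s := a :: r) jr)).
    by have := H a (mem_head _ _); rewrite -/enc_seq -/data_size; nia.
  have : k * k.*2.+2 <= (n x).*2.+1 * (n x).*2.+2 by apply: leq_mul; lia.
  lia.
Qed.

(** In contrast with a fold, results are not fed back, so the bound on the accumulator follows from
    the size bound of [f] and need not be assumed. *)
Lemma pt_map X (E : X -> seq data) (A : X -> Type) (ea : forall x, A x -> data)
    (l : forall x, seq (A x)) (f : forall x, A x -> data) :
  polytime E (fun x => enc_seq [seq ea x a | a <- l x]) ->
  polytime (X := {x : X & A x}) (fun y => ea (tag y) (tagged y) :: E (tag y))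
    (fun y => f (tag y) (tagged y)) ->
  polytime E (fun x => enc_seq [seq f x a | a <- l x]).
Proof.
move=> Hl Hf; have [p cp [T [q bT] H]] := Hf; have bl := pt_size Hl.
pose c x := q.[data_size (enc_seq [seq ea x a | a <- l x]) + env_size E x + 1]%R.
have map_foldr x r : foldr (fun a r => f x a :: r) [::] r = [seq f x a | a <- r].
  by elim: r => //= a r ->.
apply: (pt_ext (f := fun x => enc_seq (foldr (fun a r => f x a :: r) [::] (l x)))).
  by move=> x; rewrite map_foldr.
apply: (pt_foldr (ea := ea) (eb := enc_seq) (b0 := fun=> [::])
  (g := fun x a r => f x a :: r) (bound := fun x =>
    (data_size (enc_seq [seq ea x a | a <- l x]) * (c x).+1).+1)) => //.
- exact: pt_const.
- apply: pt_cons; last by pt_var.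
  apply: (pt_call (u := fun y : {x : X & (A x * seq data)%type} =>
    Tagged A (tagged y).1) Hf).
  apply: pt_cons; first by pt_var.
  by do 2 apply: (pt_behead (f := fun y => DCons _ _)); exact: pt_env.
- by rewrite /c; pb.
- move=> x i; rewrite map_foldr.
  have leq_l : data_size (enc_seq [seq ea x a | a <- drop i (l x)]) <=
      data_size (enc_seq [seq ea x a | a <- l x]) by rewrite map_drop data_size_drop.
  have Hc a r : data_size (enc_seq [seq ea x b | b <- a :: r]) <=
      data_size (enc_seq [seq ea x a | a <- l x]) -> data_size (f x a) <= c x.
    move=> le; case: (H (Tagged A a)) => _ /= le1.
    apply: leq_trans le1 _; apply: leq_trans (bT _) _; apply: horner_nat_mono.
    by rewrite /env_size /=; move: le => /=; lia.
  suff le2 : data_size (enc_seq [seq f x a | a <- drop i (l x)]) <=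
      (data_size (enc_seq [seq ea x a | a <- drop i (l x)]) * (c x).+1).+1.
    by apply: leq_trans le2 _; rewrite ltnS leq_mul2r leq_l orbT.
  elim: (drop i (l x)) leq_l => //= a r IHr le.
  have := Hc a r le; have := IHr ltac:(move: le => /=; lia).
  rewrite mulSn mulnDl; lia.
Qed.

Lemma pt_filter X (E : X -> seq data) (A : X -> Type) (ea : forall x, A x -> data)
    (l : forall x, seq (A x)) (b : forall x, A x -> bool) :
  polytime E (fun x => enc_seq [seq ea x a | a <- l x]) ->
  polytime (X := {x : X & A x}) (fun y => ea (tag y) (tagged y) :: E (tag y))
    (fun y => enc_bool (b (tag y) (tagged y))) ->
  polytime E (fun x => enc_seq [seq ea x a | a <- l x & b x a]).
Proof.
move=> Hl Hb.
apply: (pt_ext (f := fun x =>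
    enc_seq (flatten [seq if b x a then [:: ea x a] else [::] | a <- l x]))).
  by move=> x; elim: (l x) => //= a r; case: ifP => _ /= [->].
apply: pt_flatten; apply: (pt_ext (f := fun x =>
    enc_seq [seq enc_seq (if b x a then [:: ea x a] else [::]) | a <- l x])).
  by move=> x; rewrite -map_comp.
apply: (pt_map (f := fun x a => enc_seq (if b x a then [:: ea x a] else [::])) Hl).
apply: (pt_ext (f := fun y : {x : X & A x} => if b (tag y) (tagged y)
    then enc_seq [:: ea (tag y) (tagged y)] else enc_seq [::])).
  by move=> y; case: ifP.
by apply: pt_if Hb _ (pt_const _ _); apply: pt_cons (pt_const _ _); pt_var.
Qed.

Lemma pt_has X (E : X -> seq data) (A : X -> Type) (ea : forall x, A x -> data)
    (l : forall x, seq (A x)) (b : forall x, A x -> bool) :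
  polytime E (fun x => enc_seq [seq ea x a | a <- l x]) ->
  polytime (X := {x : X & A x}) (fun y => ea (tag y) (tagged y) :: E (tag y))
    (fun y => enc_bool (b (tag y) (tagged y))) ->
  polytime E (fun x => enc_bool (has (b x) (l x))).
Proof.
move=> Hl Hb; apply: pt_ext (pt_not (pt_isnil (pt_filter Hl Hb))) => x.
by rewrite /nilp size_map size_filter has_count lt0n.
Qed.

Lemma pt_all X (E : X -> seq data) (A : X -> Type) (ea : forall x, A x -> data)
    (l : forall x, seq (A x)) (b : forall x, A x -> bool) :
  polytime E (fun x => enc_seq [seq ea x a | a <- l x]) ->
  polytime (X := {x : X & A x}) (fun y => ea (tag y) (tagged y) :: E (tag y))
    (fun y => enc_bool (b (tag y) (tagged y))) ->
  polytime E (fun x => enc_bool (all (b x) (l x))).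
Proof.
move=> Hl Hb; apply: pt_ext (pt_not (pt_has Hl (pt_not Hb))) => x.
by rewrite -[in RHS](negbK (all _ _)) -has_predC.
Qed.

Lemma pt_count X (E : X -> seq data) (A : X -> Type) (ea : forall x, A x -> data)
    (l : forall x, seq (A x)) (b : forall x, A x -> bool) :
  polytime E (fun x => enc_seq [seq ea x a | a <- l x]) ->
  polytime (X := {x : X & A x}) (fun y => ea (tag y) (tagged y) :: E (tag y))
    (fun y => enc_bool (b (tag y) (tagged y))) ->
  polytime E (fun x => enc_nat (count (b x) (l x))).
Proof.
move=> Hl Hb; apply: pt_ext (pt_map (f := fun _ _ => DNil) (pt_filter Hl Hb)
  (pt_const _ DNil)) => x.
by rewrite -size_filter; congr enc_seq; elim: [seq _ <- _ | _] => //= a r ->.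
Qed.

Definition enc_option (A : Type) (ea : A -> data) (o : option A) : data :=
  if o is Some a then DCons (ea a) DNil else DNil.

Lemma pt_ohead_filter X (E : X -> seq data) (A : X -> Type)
    (ea : forall x, A x -> data)
    (l : forall x, seq (A x)) (b : forall x, A x -> bool) :
  polytime E (fun x => enc_seq [seq ea x a | a <- l x]) ->
  polytime (X := {x : X & A x}) (fun y => ea (tag y) (tagged y) :: E (tag y))
    (fun y => enc_bool (b (tag y) (tagged y))) ->
  polytime E (fun x => enc_option (@ea x) (ohead [seq a <- l x | b x a])).
Proof.
move=> Hl Hb; have Hf := pt_filter Hl Hb.
apply: pt_ext (pt_if_nil Hf (pt_const _ DNil) (pt_cons (pt_head Hf) (pt_const _ DNil))) => x.
by case: [seq _ <- _ | _].
Qed.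

Lemma pt_mul X (E : X -> seq data) (i j : X -> nat) :
  polytime E (fun x => enc_nat (i x)) -> polytime E (fun x => enc_nat (j x)) ->
  polytime E (fun x => enc_nat (i x * j x)).
Proof.
move=> Hi Hj; apply: (pt_ext (f := fun x => enc_seq (flatten
    [seq nseq (j x) DNil | _ <- nseq (i x) DNil]))).
  move=> x; rewrite map_nseq; congr enc_seq; elim: (i x) => //= k ->.
  by rewrite mulSn nseqD.
apply: pt_flatten; apply: (pt_ext (f := fun x => enc_seq
    [seq enc_nat (j x) | _ <- nseq (i x) DNil])).
  by move=> x; rewrite -map_comp.
apply: (pt_map (A := fun=> data) (ea := fun=> id) (f := fun x _ => enc_nat (j x))).
  by apply: pt_ext Hi => x; rewrite map_id.
exact: (pt_weaken tag (fun y : {_ : X & data} => tagged y) Hj).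
Qed.

Section Ordinals.
Variables (X : Type) (E : X -> seq data) (n : X -> nat).
Hypothesis Hn : polytime E (fun x => enc_nat (n x)).

Lemma pt_enum_ord :
  polytime E (fun x => enc_seq [seq enc_nat i | i : 'I_(n x) <- enum 'I_(n x)]).
Proof.
apply: pt_ext (pt_iota Hn) => x.
by rewrite -val_enum_ord -map_comp.
Qed.

Definition ord_env (y : {x : X & 'I_(n x)}) : seq data :=
  enc_nat (tagged y : 'I_(n (tag y))) :: E (tag y).

Lemma pt_exists (b : forall x, 'I_(n x) -> bool) :
  polytime ord_env (fun y => enc_bool (b (tag y) (tagged y))) ->
  polytime E (fun x => enc_bool [exists i, b x i]).
Proof.
move=> Hb; apply: pt_ext (pt_has pt_enum_ord Hb) => x; congr enc_bool.
by apply/hasP/existsP => [[i _ bi]|[i bi]]; exists i; rewrite ?mem_enum.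
Qed.

Lemma pt_forall (b : forall x, 'I_(n x) -> bool) :
  polytime ord_env (fun y => enc_bool (b (tag y) (tagged y))) ->
  polytime E (fun x => enc_bool [forall i, b x i]).
Proof.
move=> Hb; apply: pt_ext (pt_all pt_enum_ord Hb) => x; congr enc_bool.
by apply/allP/forallP => [H i|H i _]; apply: H; rewrite ?mem_enum.
Qed.

Lemma pt_card (A : forall x, {set 'I_(n x)}) :
  polytime ord_env (fun y => enc_bool (tagged y \in A (tag y))) ->
  polytime E (fun x => enc_nat #|A x|).
Proof.
move=> HA; apply: pt_ext (pt_count pt_enum_ord HA) => x; congr enc_nat.
by rewrite cardE -size_filter; congr size; rewrite {2}/enum_mem -enumT.
Qed.

Lemma pt_set (A : forall x, {set 'I_(n x)}) :
  polytime ord_env (fun y => enc_bool (tagged y \in A (tag y))) ->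
  polytime E (fun x => enc_set (A x)).
Proof. exact: pt_map pt_enum_ord. Qed.

Lemma pt_pick (b : forall x, 'I_(n x) -> bool) :
  polytime ord_env (fun y => enc_bool (b (tag y) (tagged y))) ->
  polytime E (fun x =>
    enc_option (fun i : 'I_(n x) => enc_nat i) [pick i | b x i]).
Proof.
move=> Hb; apply: pt_ext (pt_ohead_filter pt_enum_ord Hb) => x.
by rewrite enumT.
Qed.

End Ordinals.

(** A function on ordinals is handed over as the table of its values and called by a lookup. Sets,
    relations and tests are all encoded in this way. *)
Lemma pt_tab_nth X (E : X -> seq data) (n : X -> nat)
    (F : forall x, 'I_(n x) -> data) (i : forall x, 'I_(n x)) :
  polytime E (fun x => enc_seq [seq F x j | j <- enum 'I_(n x)]) ->
  polytime E (fun x => enc_nat (i x)) -> polytime E (fun x => F x (i x)).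
Proof.
move=> HF Hi; apply: pt_ext (pt_nth Hi HF) => x.
by rewrite (nth_map (i x)) ?size_enum_ord // nth_ord_enum.
Qed.

Lemma pt_mem X (E : X -> seq data) (n : X -> nat) (A : forall x, {set 'I_(n x)})
    (i : forall x, 'I_(n x)) :
  polytime E (fun x => enc_set (A x)) -> polytime E (fun x => enc_nat (i x)) ->
  polytime E (fun x => enc_bool (i x \in A x)).
Proof. by move=> HA; exact: (pt_tab_nth (F := fun x j => enc_bool (j \in A x)) HA). Qed.

Lemma pt_rel X (E : X -> seq data) (n : X -> nat) (r : forall x, rel 'I_(n x))
    (i j : forall x, 'I_(n x)) :
  polytime E (fun x => enc_rel (@r x)) -> polytime E (fun x => enc_nat (i x)) ->
  polytime E (fun x => enc_nat (j x)) ->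
  polytime E (fun x => enc_bool (r x (i x) (j x))).
Proof.
move=> Hr Hi Hj; apply: (pt_tab_nth (F := fun x k => enc_bool (r x (i x) k)) _ Hj).
exact: (pt_tab_nth (F := fun x k =>
  enc_seq [seq enc_bool (r x k t) | t <- enum 'I_(n x)]) Hr Hi).
Qed.

(** * The algorithm *)

Section Instance.
Variable I : pcacdt.
Local Notation n := (dt_n I).
Local Notation m := (dt_m I).
Implicit Types (H G : {set 'I_n}) (dn pd : {set 'I_m}) (s t : 'I_m) (g h : 'I_n).

Definition part t h : {set 'I_n} := pblock (dt_test t) h.

Lemma mem_part t h : h \in part t h.
Proof.
by rewrite /part mem_pblock (cover_partition (dt_test_partition t)) inE.
Qed.

Lemma eq_part t g h : g \in part t h -> part t g = part t h.
Proof.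
have /and3P[_ tI _] := dt_test_partition t.
exact: same_pblock.
Qed.

Lemma mem_part_eq t g h : (g \in part t h) = (part t g == part t h).
Proof.
by apply/idP/eqP => [/eq_part//|<-]; exact: mem_part.
Qed.

Lemma mem_part_sym t g h : (g \in part t h) = (h \in part t g).
Proof. by rewrite !mem_part_eq eq_sym. Qed.

Lemma part_in_test t h : part t h \in dt_test t.
Proof.
by rewrite pblock_mem // (cover_partition (dt_test_partition t)) inE.
Qed.

Lemma test_part t (B : {set 'I_n}) h : B \in dt_test t -> h \in B -> B = part t h.
Proof.
have /and3P[_ tI _] := dt_test_partition t => Bt hB.
by rewrite /part (def_pblock tI Bt hB).
Qed.

(** Each part of [t] that meets [H] is named by its least hypothesis in [H]. This turns the set of
    possible replies into a list without repetition, found by a scan. *)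
Definition rep H t h :=
  (h \in H) && [forall g, (g \in H) && (g \in part t h) ==> (h <= g)].

Definition reps H t : seq 'I_n := [seq h <- enum 'I_n | rep H t h].

Lemma rep_uniq H t g h : rep H t g -> rep H t h -> g \in part t h -> g = h.
Proof.
move=> /andP[gH /forallP rg] /andP[hH /forallP rh] gh; apply/val_inj/eqP.
rewrite eqn_leq; apply/andP; split.
  by have := rg h; rewrite hH mem_part_sym gh.
by have := rh g; rewrite gH gh.
Qed.

Lemma rep_exists H t g : g \in H -> exists2 h, rep H t h & g \in part t h.
Proof.
move=> gH; case: (@arg_minnP _ g (fun h => (h \in H) && (h \in part t g)) val).
  by rewrite gH mem_part.
move=> h /andP[hH hg] hmin; exists h; last by rewrite mem_part_sym.
apply/andP; split=> //; apply/forallP => k; apply/implyP => /andP[kH kh].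
by apply: hmin; rewrite kH -(eq_part hg).
Qed.

Lemma sum_reps H t (F : 'I_n -> nat) :
  \sum_(h <- reps H t) \sum_(g in part t h :&: H) F g = \sum_(g in H) F g.
Proof.
rewrite /reps big_filter big_enum_cond /=.
rewrite (exchange_big_dep (fun g => g \in H)) /=; last first.
  by move=> h g _; rewrite inE => /andP[].
apply: eq_bigr => g gH; have [h rh gh] := rep_exists t gH.
rewrite (big_pred1 h) // => k /=; rewrite inE gH andbT.
apply/andP/eqP => [[rk gk]|->]; last by [].
by apply: rep_uniq rk rh _; rewrite mem_part_eq -(eq_part gk) (eq_part gh).
Qed.

(* A hypothesis is covered by a test when the reply to it leaves at most half of
   [H]; the uncovered ones share a single reply. *)
Definition covered H t : {set 'I_n} :=
  [set h in H | #|part t h :&: H| + #|part t h :&: H| <= #|H|].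

(* The tests already performed stay in the instance, so that indices do not
   change, but they are isolated from the others. *)
Definition avail_prec dn : rel 'I_m :=
  fun s t => (s == t) || [&& s \notin dn, t \notin dn & dt_prec s t].

Lemma avail_prec_po dn : partial_order (avail_prec dn).
Proof.
have [rf asym tr] := dt_prec_po I; split.
- by move=> s; rewrite /avail_prec eqxx.
- move=> s t /andP[/orP[/eqP//|/and3P[_ _ st]] /orP[/eqP//|/and3P[_ _ ts]]].
  by apply: asym; rewrite st.
- move=> t s u /orP[/eqP->//|/and3P[sd td st]] /orP[/eqP<-|/and3P[_ ud tu]].
    by rewrite /avail_prec sd td st orbT.
  by rewrite /avail_prec sd ud (tr _ _ _ st tu) orbT.
Qed.

(** The family of a [pcmssc] must cover its universe, so hypotheses that no test covers are left
    out. *)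
Definition coverable H : {set 'I_n} := \bigcup_t covered H t.

Definition pair_universe H : seq ('I_n * 'I_n) :=
  [seq (g, h) | g <- enum (coverable H), h <- enum (coverable H)].

Definition pair_tests : seq ('I_m * 'I_m) :=
  [seq (s, t) | s <- enum 'I_m, t <- enum 'I_m].

Definition pair_covered H (p : 'I_m * 'I_m) (u : 'I_n * 'I_n) :=
  (u.1 \in covered H p.1) && (u.2 \in covered H p.2).

Definition pair_prec dn : rel ('I_m * 'I_m) :=
  fun p q => avail_prec dn p.1 q.1 && avail_prec dn p.2 q.2.

(** Pairs are addressed by their positions in a list, because [pcmssc] is stated on ordinals; the
    encoded tables are then maps over the two lists. *)
Definition product_set H (j : 'I_(size pair_tests)) :
    {set 'I_(size (pair_universe H))} :=
  [set i | pair_covered H (tnth (in_tuple pair_tests) j)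
             (tnth (in_tuple (pair_universe H)) i)].

Definition product_prec dn : rel 'I_(size pair_tests) :=
  fun i j => pair_prec dn (tnth (in_tuple pair_tests) i)
                          (tnth (in_tuple pair_tests) j).

Lemma pair_tests_uniq : uniq pair_tests.
Proof. by apply: allpairs_uniq; rewrite ?enum_uniq // => -[a b] [c d]. Qed.

Lemma pair_universe_uniq H : uniq (pair_universe H).
Proof. by apply: allpairs_uniq; rewrite ?enum_uniq // => -[a b] [c d]. Qed.

Lemma mem_pair_tests p : p \in pair_tests.
Proof. by case: p => s t; apply: allpairs_f; rewrite mem_enum. Qed.

Lemma mem_pair_universe H g h :
  ((g, h) \in pair_universe H) = (g \in coverable H) && (h \in coverable H).
Proof.
apply/allpairsP/andP => [[[a b] /=]|[gV hV]].
  by rewrite !mem_enum => -[aV bV [-> ->]].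
by exists (g, h); rewrite /= !mem_enum.
Qed.

Lemma product_union H : \bigcup_j product_set H j = [set: _].
Proof.
apply/setP => i; rewrite inE; apply/bigcupP.
have := mem_tnth i (in_tuple (pair_universe H)).
case E: (tnth _ i) => [g h]; rewrite mem_pair_universe.
move=> /andP[/bigcupP[s _ gs] /bigcupP[t _ ht]].
have /tnthP[j jE] : (s, t) \in in_tuple pair_tests := mem_pair_tests _.
by exists j => //; rewrite inE -jE E /pair_covered /= gs ht.
Qed.

Lemma product_prec_po dn : partial_order (product_prec dn).
Proof.
have [rf asym tr] := avail_prec_po dn; split.
- by move=> j; rewrite /product_prec /pair_prec !rf.
- move=> i j /andP[/andP[a1 a2] /andP[b1 b2]].
  have /tuple_uniqP inj : uniq (in_tuple pair_tests) := pair_tests_uniq.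
  apply: inj; move: a1 a2 b1 b2.
  case: (tnth _ i) (tnth _ j) => [a b] [c d] /= ac bd ca db.
  by rewrite (asym a c) ?ac // (asym b d) ?bd.
- move=> j i k /andP[a1 a2] /andP[b1 b2].
  by rewrite /product_prec /pair_prec (tr _ _ _ a1 b1) (tr _ _ _ a2 b2).
Qed.

(** The fraction 1/4 is the square of 1/2: a closed set covering half of [H] has a square covering
    at least a quarter of the pairs of coverable hypotheses. *)
Lemma quarter_gt0 : (0 < 4%:R^-1 :> rat)%R. Proof. by []. Qed.
Lemma quarter_le1 : (4%:R^-1 <= 1 :> rat)%R. Proof. by []. Qed.

Definition product_instance H dn : pcmssc :=
  Pcmssc (product_union H) (product_prec_po dn) quarter_gt0 quarter_le1.

Variable sol : forall J : pcmssc, seq 'I_(sc_m J).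

Definition sol_pairs H dn : seq ('I_m * 'I_m) :=
  [seq tnth (in_tuple pair_tests) j | j <- sol (product_instance H dn)].

Definition section_row dn (S : seq ('I_m * 'I_m)) t : {set 'I_m} :=
  [set s | ((s, t) \in S) && (s \notin dn)].

(** Not the mirror image of [section_row]: a column belongs to a hypothesis [h] and collects the
    second tests of the pairs whose first test covers [h]. With the first coordinate fixed to [h],
    covering pairs amounts to covering by this column. *)
Definition section_column H dn (S : seq ('I_m * 'I_m)) h : {set 'I_m} :=
  [set t | [exists s, ((s, t) \in S) && (h \in covered H s)] && (t \notin dn)].

(** The analysis needs a section of one prefix, the one at which half of the final coverage is
    reached. Listing all prefixes and all sections avoids having to find it. *)
Definition candidates H dn : seq {set 'I_m} :=
  flatten [seq [seq section_row dn (take k (sol_pairs H dn)) t | t <- enum 'I_m] ++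
               [seq section_column H dn (take k (sol_pairs H dn)) h | h <- enum 'I_n]
          | k <- iota 0 (size (sol_pairs H dn)).+1].

Definition covered_by H (P : {set 'I_m}) : {set 'I_n} :=
  \bigcup_(t in P) covered H t.

(** Densities are compared after cross-multiplication, so that the program only handles natural
    numbers. *)
Definition densest H (cs : seq {set 'I_m}) (P : {set 'I_m}) :=
  (P != set0) && all (fun Q => #|covered_by H Q| * #|P| <=
                               #|covered_by H P| * #|Q|) cs.

(* The fallback [~: dn] makes the output a valid tree independently of the quality of
   [sol]. *)
Definition select H dn : {set 'I_m} :=
  odflt (~: dn) (ohead [seq P <- candidates H dn | densest H (candidates H dn) P]).

(* [pd] is what remains to be performed of the set chosen at some ancestor: a chosen
   set is used up on every branch, whatever the replies. *)
Definition plan H dn pd : {set 'I_m} := if pd == set0 then select H dn else pd.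

Definition ready dn s : bool :=
  (s \notin dn) && [forall t, dt_prec t s && (t != s) ==> (t \in dn)].

Definition next_test H dn pd : option 'I_m :=
  if #|H| <= 1 then None else [pick t | (t \in plan H dn pd) && ready dn t].

(** The default, the hypothesis of index 0, is reached only when [H] is empty. *)
Definition leaf_hyp H : 'I_n := odflt (Ordinal (dt_n_gt0 I)) [pick h in H].

(* The fuel [k] suffices when it is at least [weight H dn]. *)
Fixpoint solve k H dn pd : dtree n m :=
  if k is k'.+1 then
    if next_test H dn pd is Some t then
      Node t [seq (part t h, solve k' (part t h :&: H) (t |: dn)
                                     (plan H dn pd :\ t)) | h <- reps H t]
    else Leaf m (leaf_hyp H)
  else Leaf m (leaf_hyp H).

(** A bound on the number of nodes below: at each level the children share the hypotheses of [H],
    and at most [m - #|dn|] levels remain. The maximum with 1 keeps the weight positive on an empty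
    [H], as the recursion principle is applied to all states, valid or not. *)
Definition weight H dn := maxn 1 (#|H| * (m.+1 - #|dn|)).

Lemma weight_kids H dn pd t : next_test H dn pd = Some t ->
  \sum_(h <- reps H t) weight (part t h :&: H) (t |: dn) < weight H dn.
Proof.
rewrite /next_test; case: (leqP #|H| 1) => // H1; case: pickP => // s /= /andP[_ /andP[tdn _]] [<-].
have dnm : #|s |: dn| <= m by rewrite -[leqRHS]card_ord max_card.
rewrite cardsU1 tdn add1n in dnm.
rewrite (eq_big_seq (fun h => \sum_(g in part s h :&: H) (m - #|dn|))); last first.
  move=> h; rewrite mem_filter => /andP[/andP[hH _] _].
  rewrite sum_nat_const /weight cardsU1 tdn add1n subSS.
  apply/maxn_idPr; rewrite muln_gt0 subn_gt0 dnm andbT.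
  by apply/card_gt0P; exists h; rewrite inE mem_part.
rewrite sum_reps sum_nat_const /weight subSn ?(ltnW dnm) //.
rewrite leq_max mulnS -[X in X < _ + _]add0n ltn_add2r (leq_trans _ H1) ?orbT //.
Qed.

End Instance.

(** * Validity of the tree *)

Section Validity.
Variables (I : pcacdt) (sol : forall J : pcmssc, seq 'I_(sc_m J)).
Hypothesis sol_closed : forall J, precedence_closed_seq (sol J).
Local Notation n := (dt_n I).
Local Notation m := (dt_m I).
Implicit Types (H G : {set 'I_n}) (dn pd P : {set 'I_m}) (s t : 'I_m) (g h : 'I_n).

(** A prefix stays closed because predecessors come earlier in the sequence. *)
Lemma sol_pairs_closed H dn k p q : p \in take k (sol_pairs sol H dn) ->
  pair_prec dn q p -> q \in take k (sol_pairs sol H dn).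
Proof.
have [_ pc pi] := sol_closed (product_instance H dn).
rewrite /sol_pairs -!map_take => /mapP[j jC ->] qp.
have /tnthP[i iE] : q \in in_tuple (pair_tests I) := mem_pair_tests q.
have ij : sc_prec (p := product_instance H dn) i j by rewrite /= /product_prec -iE.
apply/mapP; exists i => //; have [->//|neq] := eqVneq i j.
have jS := mem_take jC; have iS := pc _ _ jS ij.
have := pi _ _ iS jS neq ij; rewrite in_take // in jC; rewrite in_take // => lt.
exact: ltn_trans jC.
Qed.

Definition closed_over dn P :=
  [disjoint P & dn] /\ forall s t, t \in P -> dt_prec s t -> (s \in P) || (s \in dn).

(** The second coordinate is constant on a row, and outside [dn] the order [avail_prec] is
    [dt_prec]: a predecessor of the first test gives a predecessor of the pair. *)
Lemma row_closed H dn k t :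
  closed_over dn (section_row dn (take k (sol_pairs sol H dn)) t).
Proof.
split; first by rewrite disjoint_subset; apply/subsetP => s; rewrite !inE => /andP[].
move=> s u; rewrite !inE => /andP[uS udn] su.
have [//|sdn] := boolP (s \in dn); rewrite ?orbT // orbF andbT.
apply: sol_pairs_closed uS _.
by rewrite /pair_prec /avail_prec /= eqxx sdn udn su !orbT.
Qed.

(** The first test [v] that covers [h] is kept, so it also witnesses the predecessors of the second
    test. *)
Lemma column_closed H dn k h :
  closed_over dn (section_column H dn (take k (sol_pairs sol H dn)) h).
Proof.
split; first by rewrite disjoint_subset; apply/subsetP => s; rewrite !inE => /andP[].
move=> s u; rewrite !inE => /andP[/existsP[v /andP[uS hv]] udn] su.
have [//|sdn] := boolP (s \in dn); rewrite ?orbT // orbF andbT.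
apply/existsP; exists v; rewrite hv andbT; apply: sol_pairs_closed uS _.
by rewrite /pair_prec /avail_prec /= eqxx sdn udn su !orbT.
Qed.

Lemma candidates_closed H dn P : P \in candidates sol H dn -> closed_over dn P.
Proof.
move=> /flatten_mapP[k _]; rewrite mem_cat => /orP[] /mapP[t _ ->].
  exact: row_closed.
exact: column_closed.
Qed.

Definition downset dn := forall s t, t \in dn -> dt_prec s t -> s \in dn.

Definition good dn P := P != set0 /\ closed_over dn P.

Lemma good_setC dn : dn != [set: _] -> good dn (~: dn).
Proof.
move=> dnT; split.
  by apply: contra dnT => /eqP E; rewrite -(setCK dn) E setC0.
split; first by rewrite disjoint_subset; apply/subsetP => s; rewrite !inE.
by move=> s t _ _; rewrite !inE; case: (s \in dn).
Qed.

Lemma select_good H dn : dn != [set: _] -> good dn (select sol H dn).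
Proof.
move=> dnT; rewrite /select.
case E: [seq P <- _ | _] => [|P r] /=; first exact: good_setC.
have : P \in [seq P <- candidates sol H dn | densest H (candidates sol H dn) P].
  by rewrite E mem_head.
rewrite mem_filter => /andP[/andP[P0 _] Pc]; split=> //.
exact: candidates_closed Pc.
Qed.

(** The invariant along a branch. By [valid_const] the tests already performed no longer split [H];
    hence they cover nothing, and removing them from a set of tests costs no coverage. *)
Record valid H dn pd : Prop := Valid {
  valid_H : H != set0;
  valid_const : forall t h, t \in dn -> h \in H -> H \subset part t h;
  valid_down : downset dn;
  valid_pd : pd = set0 \/ good dn pd }.

(** If every test had been performed, [H] would lie in a single part of each, against
    [dt_separated]. Thus the fallback of [select] is a nonempty set. *)
Lemma valid_dn H dn pd : valid H dn pd -> 1 < #|H| -> dn != [set: _].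
Proof.
move=> [H0 Hc _ _] /card_gt1P[g [h [gH hH gh]]].
have [t gt] := dt_separated gh.
apply/eqP => dnT; have /subsetP/(_ g gH) : H \subset part t h.
  by apply: Hc; rewrite ?dnT ?inE.
by rewrite mem_part_eq /part (negbTE gt).
Qed.

Lemma plan_good H dn pd : valid H dn pd -> 1 < #|H| ->
  good dn (plan sol H dn pd).
Proof.
move=> V H1; rewrite /plan; case: eqP => [_|pd0].
  exact/select_good/(valid_dn V).
by case: (valid_pd V).
Qed.

Lemma ready_exists dn P : good dn P -> exists2 t, t \in P & ready dn t.
Proof.
move=> [/set0Pn[t0 t0P] [PD Pc]].
have [rf asym tr] := dt_prec_po I.
(* A test of [P] with the fewest predecessors is minimal in [P], because a strict predecessor has
   strictly fewer of them by transitivity and antisymmetry. *)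
case: (arg_minnP (fun t => #|[set s | dt_prec s t]|) t0P) => t tP tmin.
exists t => //; apply/andP; split; first by rewrite (disjointFr PD).
apply/forallP => s; apply/implyP => /andP[st neq].
have /orP[sP|//] := Pc _ _ tP st.
have := tmin s sP; rewrite leqNgt => /negP[]; apply: proper_card.
apply/properP; split; first by apply/subsetP => u; rewrite !inE => /tr; apply.
exists t; rewrite !inE ?rf //; apply: contra neq => ts.
by apply/eqP/asym; rewrite st.
Qed.

Lemma next_testP H dn pd : valid H dn pd -> 1 < #|H| ->
  exists2 t, next_test sol H dn pd = Some t &
    (t \in plan sol H dn pd) && ready dn t.
Proof.
move=> V H1; rewrite /next_test leqNgt H1 /=; case: pickP => [t tP|none].
  by exists t.
have [t tP tr] := ready_exists (plan_good V H1).
by have := none t; rewrite tP tr.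
Qed.

Lemma next_test_some H dn pd t : next_test sol H dn pd = Some t ->
  [/\ 1 < #|H|, t \in plan sol H dn pd & ready dn t].
Proof.
rewrite /next_test; case: leqP => // H1; case: pickP => // s /andP[sP sr] [<-].
by [].
Qed.

Lemma valid_child H dn pd t h : valid H dn pd ->
  next_test sol H dn pd = Some t -> h \in H ->
  valid (part t h :&: H) (t |: dn) (plan sol H dn pd :\ t).
Proof.
move=> V Et hH; have [H1 tP /andP[tdn /forallP tr]] := next_test_some Et.
have [P0 [PD Pc]] := plan_good V H1; have [H0 Hc dc _] := V.
have tr' s : dt_prec s t -> s \in t |: dn.
  by move=> st; have := tr s; rewrite st !inE /=; case: eqP.
split.
- by apply/set0Pn; exists h; rewrite inE mem_part.
- move=> s g; rewrite !inE => /orP[/eqP->|sdn] /andP[gt gH].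
    by rewrite (eq_part gt) subsetIl.
  by apply: subset_trans (subsetIr _ _) _; exact: Hc.
- move=> s u; rewrite in_setU1 => /orP[/eqP->|udn]; first exact: tr'.
  by move=> su; rewrite inE (dc _ _ udn su) orbT.
- have [->|neq] := eqVneq (plan sol H dn pd :\ t) set0; [by left|right].
  split=> //; split.
    rewrite disjoint_subset; apply/subsetP => s; rewrite !inE => /andP[st sP].
    by rewrite (negbTE st) (disjointFr PD).
  move=> s u; rewrite !inE => /andP[ut uP] su.
  have := Pc _ _ uP su; case: (s == t) => //=.
Qed.

Lemma leaf_hyp_set H : #|H| = 1 -> H = [set leaf_hyp H].
Proof.
move=> /eqP/cards1P[h ->]; rewrite /leaf_hyp; case: pickP => [g|/(_ h)] /=.
  by rewrite inE => /eqP->.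
by rewrite inE eqxx.
Qed.

Lemma weight_gt0 H dn : 0 < weight H dn.
Proof. by rewrite leq_max. Qed.

Lemma weight_child H dn pd t h k : next_test sol H dn pd = Some t ->
  h \in reps H t -> weight H dn <= k.+1 ->
  weight (part t h :&: H) (t |: dn) <= k.
Proof.
move=> Et hr wk; rewrite -ltnS; apply: leq_trans wk.
apply: leq_ltn_trans (weight_kids Et).
by rewrite (big_rem h) //= leq_addr.
Qed.

Lemma mem_reps H t h : h \in reps H t -> rep H t h.
Proof. by rewrite mem_filter => /andP[]. Qed.

Lemma rep_mem H t h : rep H t h -> h \in H.
Proof. by case/andP. Qed.

Lemma unzip1_kids (A : Type) t (r : seq 'I_n) (D : 'I_n -> A) :
  unzip1 [seq (part t h, D h) | h <- r] = [seq part t h | h <- r].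
Proof. by rewrite /unzip1 -map_comp. Qed.

Lemma solve_identifies k H dn pd : weight H dn <= k -> valid H dn pd ->
  identifies H (solve sol k H dn pd).
Proof.
elim: k H dn pd => [|k IHk] H dn pd wk V.
  by have := weight_gt0 H dn; rewrite lt0n -leqn0 wk.
rewrite /=; case: (leqP #|H| 1) => [H1|H1].
  have -> : next_test sol H dn pd = None by rewrite /next_test H1.
  rewrite /= -leaf_hyp_set //; apply/eqP; rewrite eqn_leq H1 card_gt0.
  exact: valid_H V.
have [t Et tP] := next_testP V H1; rewrite Et /=; apply/and3P; split.
- rewrite unzip1_kids map_inj_in_uniq; first by rewrite filter_uniq ?enum_uniq.
  move=> g h /mem_reps rg /mem_reps rh eqp.
  by apply: rep_uniq rg rh _; rewrite mem_part_eq eqp.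
- apply/eqP/setP => B; rewrite unzip1_kids !inE; apply/mapP/andP.
    move=> [h /mem_reps/rep_mem hH ->]; split; first exact: part_in_test.
    by apply/set0Pn; exists h; rewrite inE mem_part.
  move=> [Bt /set0Pn[g]]; rewrite inE => /andP[gB gH].
  have [h rh gh] := rep_exists t gH; exists h; first by rewrite mem_filter rh mem_enum.
  by rewrite (test_part Bt gB) (eq_part gh).
- rewrite all_map; apply/allP => h hr /=; rewrite setIC.
  apply: IHk; first exact: weight_child Et hr wk.
  exact: valid_child V Et (rep_mem (mem_reps hr)).
Qed.

Lemma solve_precedence k H dn pd (q : seq 'I_m) : dn =i q ->
  precedence_closed_from q (solve sol k H dn pd).
Proof.
elim: k H dn pd q => [|k IHk] H dn pd q dq //=.
case Et: (next_test sol H dn pd) => [t|] //=.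
have [_ _ /andP[_ tr]] := next_test_some Et; apply/andP; split.
  apply/forallP => s; apply/implyP => /(implyP (forallP tr s)).
  by rewrite -dq.
rewrite all_map; apply/allP => h _ /=; apply: IHk => s.
by rewrite !inE dq.
Qed.

Lemma cost_node t (r : seq 'I_n) (D : 'I_n -> dtree n m) g h :
  h \in r -> g \in part t h ->
  {in r, forall k, g \in part t k -> k = h} ->
  cost (Node t [seq (part t k, D k) | k <- r]) g = (cost (D h) g).+1.
Proof.
move=> hr gh un /=; congr _.+1; elim: r hr un => //= k r IHr.
rewrite inE => hkr un; case: ifP => gk.
  by rewrite (un k (mem_head _ _) gk).
apply: IHr => [|l lr]; last by apply: un; rewrite inE lr orbT.
by case/orP: hkr gk => // /eqP<-; rewrite gh.
Qed.

(** The root test charges one unit to each hypothesis of [H], counted part by part. *)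
Lemma solve_cost k H dn pd t : next_test sol H dn pd = Some t ->
  \sum_(g in H) cost (solve sol k.+1 H dn pd) g =
  \sum_(h <- reps H t) (#|part t h :&: H| +
    \sum_(g in part t h :&: H) cost (solve sol k (part t h :&: H) (t |: dn)
       (plan sol H dn pd :\ t)) g).
Proof.
move=> Et; rewrite -(sum_reps H t); apply: eq_big_seq => h /mem_reps rh.
rewrite -sum1_card -big_split /=; apply: eq_bigr => g; rewrite inE => /andP[gh gH].
rewrite Et add1n (@cost_node t (reps H t) _ g h) //.
  by rewrite mem_filter rh mem_enum.
move=> l /mem_reps rl gl; apply: rep_uniq rl rh _.
by rewrite mem_part_eq -(eq_part gl) (eq_part gh).
Qed.

Lemma solve_leaf_cost k H dn pd g : #|H| <= 1 -> cost (solve sol k H dn pd) g = 0.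
Proof.
move=> H1; have Et : next_test sol H dn pd = None by rewrite /next_test H1.
by case: k => [|k] //=; rewrite Et.
Qed.

Lemma valid_start : valid [set: 'I_n] set0 set0.
Proof.
split.
- by apply/set0Pn; exists (Ordinal (dt_n_gt0 I)); rewrite inE.
- by move=> t h; rewrite inE.
- by move=> s t; rewrite inE.
- by left.
Qed.

End Validity.

(** Subtrees are nested inside a list, so an induction hypothesis for every child has to be produced
    by an inner recursion on that list. *)
Lemma dtree_nth_ind n m (P : dtree n m -> Prop) :
  (forall h, P (Leaf m h)) ->
  (forall t cs, (forall c0 i, i < size cs -> P (nth c0 cs i).2) -> P (Node t cs)) ->
  forall D, P D.
Proof.
move=> Pl Pn; fix IH 1 => -[h|t cs]; first exact: Pl.
apply: Pn => c0; elim: cs => [|[B D] cs IHcs] [|i] /=; [discriminate | discriminate | move=> _ | ].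
  exact: IH D.
exact: IHcs i.
Qed.

Lemma cost_nth n m (t : 'I_m) (cs : seq ({set 'I_n} * dtree n m)) c0 i h :
  i < size cs -> h \in (nth c0 cs i).1 ->
  (forall j, j < i -> h \notin (nth c0 cs j).1) ->
  cost (Node t cs) h = (cost (nth c0 cs i).2 h).+1.
Proof.
move=> lti hi nj /=; congr _.+1.
elim: cs i lti hi nj => //= c cs IHcs [|i] lti hi nj; first by rewrite hi.
have /negbTE /= -> := nj 0 isT.
exact: IHcs lti hi (fun j lj => nj j.+1 lj).
Qed.

(** * Approximation ratio *)

Section HeavyPath.
Variable I : pcacdt.
Local Notation n := (dt_n I).
Local Notation m := (dt_m I).
Implicit Types (H G : {set 'I_n}) (s t : 'I_m) (g h : 'I_n).

(** Two parts that each keep more than half of [H] must intersect, hence coincide. *)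
Lemma uncovered_part H t g h : g \in H :\: covered H t -> h \in H :\: covered H t ->
  g \in part t h.
Proof.
rewrite !inE => /andP[gc gH] /andP[hc hH].
rewrite gH /= -ltnNge in gc; rewrite hH /= -ltnNge in hc.
rewrite mem_part_sym; apply: contraTT isT => ngh.
have dis : [disjoint part t g :&: H & part t h :&: H].
  apply/pred0P => k /=; rewrite !inE; apply/negP => /andP[/andP[kg _] /andP[kh _]].
  by case/negP: ngh; rewrite mem_part_eq -(eq_part kg) (eq_part kh).
have := leq_card_setU (part t g :&: H) (part t h :&: H).
rewrite dis => -[_ /eqP cU].
have : #|(part t g :&: H) :|: (part t h :&: H)| <= #|H|.
  by apply: subset_leq_card; rewrite subUset !subsetIr.
move: gc hc; rewrite cU.
move: #|H| #|part t g :&: H| #|part t h :&: H| => a b c; lia.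
Qed.

(* [L] lists the tests met in [D] when every reply is the one that keeps more than
   half of [H], until half of [H] has left this path; each of the others pays for
   the whole of [L]. *)
Lemma heavy_path H : 1 < #|H| -> forall D G (q : seq 'I_m),
  identifies (I := I) G D -> precedence_closed_from (I := I) q D ->
  #|H| < #|G :&: H| * 2 ->
  exists L : seq 'I_m, [/\
    forall s t, t \in L -> dt_prec s t -> (s \in L) || (s \in q),
    #|(G :&: H) :\: covered_by H [set t in L]| * 2 <= #|H| &
    size L * #|H| <= (\sum_(h in G :&: H) cost D h) * 2].
Proof.
move=> H1; elim/dtree_nth_ind => [l|t cs IH] G q /=.
  (* A leaf cannot occur: one hypothesis is not more than half of [H]. *)
  move=> /eqP-> _ HW; have : #|[set l] :&: H| <= #|[set l]|.
    by apply: subset_leq_card; exact: subsetIl.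
  rewrite cards1; move: H1 HW; move: #|H| #|[set l] :&: H| => a b; lia.
move=> /and3P[ucs /eqP ecs acs] /andP[/forallP pt pcs] HW.
have tprec s : dt_prec s t -> (s == t) || (s \in q).
  by move=> st; have := pt s; rewrite st; case: (s == t).
have covU L : covered_by H [set u in t :: L] =
    covered H t :|: covered_by H [set u in L].
  rewrite /covered_by (_ : [set u in t :: L] = t |: [set u in L]); last first.
    by apply/setP => u; rewrite !inE.
  by rewrite bigcup_setU big_set1.
(* The path ends here if [t] alone brings the uncovered rest down to half of [H]. Each element of
   [G :&: H] pays at least this test, and these are more than half of [H]. *)
have [small|big] := leqP (#|(G :&: H) :\: covered H t| * 2) #|H|.
  exists [:: t]; split.
  - by move=> s u; rewrite inE => /eqP-> /tprec; rewrite inE.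
  - rewrite covU; apply: leq_trans small; rewrite leq_mul2r subset_leq_card ?orbT //.
    exact/setDS/subsetUl.
  - rewrite mul1n; apply: leq_trans (ltnW HW) _; rewrite leq_mul2r -sum1_card.
    by rewrite leq_sum ?orbT.
have /card_gt0P[h0] : 0 < #|(G :&: H) :\: covered H t| by lia.
rewrite !in_setD in_setI => /and3P[h0c h0G h0H]; set B := part t h0.
(* All hypotheses left uncovered by [t] give the same reply [B]; the path continues in that
   child. *)
have WB : (G :&: H) :\: covered H t = (G :&: B :&: H) :\: covered H t.
  apply/setP => g; rewrite !in_setD !in_setI.
  apply/and3P/andP => [[gc gG gH]|[gc /andP[/andP[gG _] gH]]] //.
  rewrite gc gG gH andbT; split=> //; apply: (@uncovered_part H).
    by rewrite in_setD gc.
  by rewrite in_setD h0c.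
have Bcs : B \in unzip1 cs.
  have : B \in [set:: unzip1 cs].
    rewrite ecs inE part_in_test; apply/set0Pn; exists h0.
    by rewrite inE mem_part.
  by rewrite inE.
pose i := index B (unzip1 cs); pose c0 : {set 'I_n} * dtree n m := (B, Leaf m h0).
have ics : i < size cs by rewrite -(size_map fst) index_mem.
have nthB : (nth c0 cs i).1 = B by rewrite -(nth_map c0 B) // nth_index.
have ci := all_nthP c0 acs i ics; have pi := all_nthP c0 pcs i ics.
rewrite nthB in ci.
have GB : #|H| < #|G :&: B :&: H| * 2.
  apply: leq_trans big _; rewrite WB leq_mul2r subset_leq_card ?orbT //.
  exact: subsetDl.
have [L [Lp Lc Lk]] := IH c0 i ics _ _ ci pi GB.
exists (t :: L); split.
- move=> s u; rewrite !inE => /orP[/eqP->|uL].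
    by move=> /tprec /orP[->|->]; rewrite ?orbT.
  by move=> /(Lp _ _ uL); rewrite inE => /or3P[] ->; rewrite ?orbT.
- apply: leq_trans Lc; rewrite leq_mul2r subset_leq_card ?orbT //.
  by rewrite covU -setDDl WB setDDl setDS // subsetUr.
- rewrite /= mulSn.
  have -> : \sum_(h in G :&: H) cost (Node t cs) h =
      #|G :&: H| + \sum_(h in G :&: H) (cost (Node t cs) h).-1.
    by rewrite -sum1_card -big_split /=; apply: eq_bigr => h _; rewrite add1n.
  (* The test [t] is paid by one unit from each element of [G :&: H], the rest of [L] by the
     remaining cost of the elements that go to [B]. *)
  rewrite mulnDl; apply: leq_add; first exact: ltnW.
  apply: leq_trans Lk _; rewrite leq_mul2r; apply/orP; right.
  rewrite [leqRHS](big_setID B) [X in _ <= X + _](eq_bigl (fun h => h \in G :&: B :&: H)); last first.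
    by move=> h; rewrite setIAC.
  apply: leq_trans (leq_addr _ _).
  apply: leq_sum => h; rewrite !inE => /andP[/andP[hG hB] hH].
  rewrite (@cost_nth _ _ t cs c0 i h) ?nthB // => j ji.
  have jcs : j < size cs := ltn_trans ji ics.
  have : (nth c0 cs j).1 \in [set:: unzip1 cs].
    by rewrite inE -(nth_map c0 B) // mem_nth // size_map.
  rewrite ecs inE => /andP[jt _]; apply/negP => hj.
  have : (nth c0 cs j).1 = B.
    by rewrite (test_part jt hj) /B; exact: eq_part.
  rewrite -(nth_map c0 B) // => E.
  by move: ji; rewrite /i -E index_uniq ?size_map // ltnn.
Qed.

End HeavyPath.

Lemma is_optimum_exists (S : Type) (feasible : S -> Prop) (cost : S -> nat) s :
  feasible s -> exists2 v, is_optimum feasible cost v & v <= cost s.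
Proof.
move=> fs; have ex : exists v, `[< exists2 r, feasible r & cost r = v >].
  by exists (cost s); apply/asboolP; exists s.
case: (ex_minnP ex) => v /asboolP vP vmin.
have le r : feasible r -> v <= cost r.
  by move=> fr; apply: vmin; apply/asboolP; exists r.
by exists v; [split | exact: le].
Qed.

(** * Precedence-closed sequences and their cover time *)

Section Cover.
Variable J : pcmssc.
Implicit Types (C : seq 'I_(sc_m J)) (P : {set 'I_(sc_m J)}).

(** Sorting by the number of predecessors is a linear extension: a strict predecessor has a strictly
    smaller [rank]. *)
Lemma closed_set_seq P :
  (forall s t, t \in P -> sc_prec s t -> s \in P) ->
  exists C, [/\ precedence_closed_seq C, C =i P & size C = #|P|].
Proof.
move=> Pc; have [rf asym tr] := sc_prec_po J.
pose rank (t : 'I_(sc_m J)) := #|[set s | sc_prec s t]|.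
pose le : rel 'I_(sc_m J) := fun s t => rank s <= rank t.
have CP : sort le (enum P) =i P by move=> t; rewrite mem_sort mem_enum.
exists (sort le (enum P)); split=> //; last by rewrite size_sort cardE.
split; first by rewrite sort_uniq enum_uniq.
  by move=> s t; rewrite !CP; exact: Pc.
move=> s t sC tC neq st; rewrite ltnNge; apply/negP => its.
have /(_ _ _ tC sC its) : {in sort le (enum P) &, forall x y,
    index x (sort le (enum P)) <= index y (sort le (enum P)) -> le x y}.
  apply: sorted_leq_index; first by move=> x y z; exact: leq_trans.
    by move=> x; exact: leqnn.
  by apply: sort_sorted => x y; exact: leq_total.
rewrite /le leqNgt => /negP[]; apply: proper_card; apply/properP; split.
  by apply/subsetP => u; rewrite !inE => /tr; apply.
exists t; rewrite !inE ?rf //; apply: contra neq => ts.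
by apply/eqP/asym; rewrite st.
Qed.

Lemma mem_cov C x : (x \in cov C) = has (fun t => x \in sc_set t) C.
Proof.
by rewrite /cov; elim: C => [|t C IHC]; rewrite ?big_nil ?big_cons !inE //= IHC.
Qed.

Lemma cover_time_leq C : cover_time C <= #|cov C| * size C.
Proof.
rewrite /cover_time -sum_nat_const; apply: leq_sum => x xC.
by rewrite /coverage_time xC -has_find -mem_cov.
Qed.

(* Beyond the first prefix covering half of [cov C], the other half pays for its
   length. *)
Lemma half_cover C : exists j, [/\ j <= size C,
  #|cov C| <= 2 * #|cov (take j C)| & j * #|cov C| <= 2 * cover_time C].
Proof.
have exC : #|cov C| <= 2 * #|cov (take (size C) C)| by rewrite take_size leq_pmull.
have ex : exists j, #|cov C| <= 2 * #|cov (take j C)| by exists (size C).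
case: (ex_minnP ex) => j jP jmin; exists j; split=> //; first exact: jmin.
case: j jP jmin => [|j] // _ jmin.
have lt : 2 * #|cov (take j C)| < #|cov C|.
  by rewrite ltnNge; apply/negP => /jmin; rewrite ltnn.
have sub : cov (take j C) \subset cov C.
  apply/subsetP => x; rewrite !mem_cov => /hasP[t tC xt].
  by apply/hasP; exists t => //; exact: mem_take tC.
(* By minimality the prefix of length [j] misses more than half of [cov C], and every element it
   misses has coverage time at least [j.+1], as positions count from 1. *)
have : j.+1 * #|cov C :\: cov (take j C)| <= cover_time C.
  rewrite /cover_time (big_setID (cov (take j C))) /= mulnC -sum_nat_const.
  apply: leq_trans (leq_addl _ _); apply: leq_sum => x; rewrite inE => /andP[xj xC].
  rewrite /coverage_time xC ltnS leqNgt; apply: contra xj.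
  move=> lt_find; rewrite mem_cov; apply/hasP.
  have hx : has (fun t => x \in sc_set t) C by rewrite -mem_cov.
  have lts : find (fun t => x \in sc_set t) C < size C by rewrite -has_find.
  have [t0 _ _] := hasP hx.
  exists (nth t0 C (find (fun t => x \in sc_set t) C)); last exact: (nth_find t0 hx).
  rewrite -(nth_take t0 lt_find); apply: mem_nth; rewrite size_take.
  by case: ifP.
have := cardsID (cov (take j C)) (cov C); rewrite (setIidPr sub) => <-.
move: lt; rewrite -(cardsID (cov (take j C)) (cov C)) (setIidPr sub).
move: #|_| #|_| (cover_time C) => a b T; nia.
Qed.

End Cover.

(** * Counting the sections of a set of pairs *)

Section Pairs.
Variable I : pcacdt.
Local Notation n := (dt_n I).
Local Notation m := (dt_m I).
Implicit Types (H G : {set 'I_n}) (dn pd P : {set 'I_m}) (s t : 'I_m) (g h : 'I_n).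

Definition pairs_covered H (S : seq ('I_m * 'I_m)) : {set 'I_n * 'I_n} :=
  [set u | has (fun p => pair_covered H p u) S].

Lemma card_pairs (T1 T2 : finType) (A : {set T1 * T2}) :
  #|A| = \sum_a #|[set b | (a, b) \in A]|.
Proof.
rewrite -sum1_card (eq_bigl (fun p => xpredT p.1 && ((p.1, p.2) \in A))).
  rewrite -(pair_big_dep xpredT (fun a b => (a, b) \in A) (fun _ _ => 1)) /=.
  by apply: eq_bigr => a _; rewrite -sum1_card; apply: eq_bigl => b; rewrite inE.
by case.
Qed.

(** Double counting of incidences: the sums count pairs from either side. *)
Lemma exchange_card (T1 T2 : finType) (F : T1 -> {set T2}) (G : T2 -> {set T1}) :
  (forall a b, b \in F a -> a \in G b) -> \sum_a #|F a| <= \sum_b #|G b|.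
Proof.
move=> FG.
under eq_bigr => a _ do rewrite -sum1_card.
rewrite (exchange_big_dep xpredT) //=; apply: leq_sum => b _.
rewrite -sum1_card [leqLHS]big_mkcond [leqRHS]big_mkcond /=.
by apply: leq_sum => a _; case: ifP => // /FG ->.
Qed.

(** First of three links leading from the covered pairs to the size of [S]: coverage of columns,
    then size of columns against coverage of rows, then size of rows. The passage from coverage to
    size is made twice, which is where a density enters squared. *)
Lemma card_pairs_covered H dn S : (forall t, t \in dn -> covered H t = set0) ->
  #|pairs_covered H S| = \sum_h #|covered_by H (section_column H dn S h)|.
Proof.
move=> cdn; rewrite card_pairs; apply: eq_bigr => h _; congr #|pred_of_set _|.
apply/setP => g; rewrite !inE; apply/hasP/bigcupP.
  move=> [[s t] stS /andP[/= hs gt]]; exists t => //; rewrite inE; apply/andP; split.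
    by apply/existsP; exists s; rewrite stS.
  by apply/negP => /cdn E; rewrite E inE in gt.
move=> [t]; rewrite inE => /andP[/existsP[s /andP[stS hs]] _] gt.
by exists (s, t) => //; rewrite /pair_covered hs.
Qed.

Lemma sum_columns H dn S : (forall t, t \in dn -> covered H t = set0) ->
  \sum_h #|section_column H dn S h| <=
  \sum_t #|covered_by H (section_row dn S t)|.
Proof.
move=> cdn; apply: exchange_card => h t; rewrite inE => /andP[/existsP[s]].
move=> /andP[stS hs] _; apply/bigcupP; exists s => //; rewrite inE stS /=.
by apply/negP => /cdn E; rewrite E inE in hs.
Qed.

Lemma sum_rows dn S : \sum_t #|section_row dn S t| <= size S.
Proof.
apply: (@leq_trans #|[set p in S]|); last by rewrite cardsE card_size.
rewrite card_pairs; apply: exchange_card => t s.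
by rewrite !inE => /andP[].
Qed.

End Pairs.

Section Density.
Variable I : pcacdt.
Local Notation n := (dt_n I).
Local Notation m := (dt_m I).
Implicit Types (H G : {set 'I_n}) (dn pd P : {set 'I_m}) (s t : 'I_m) (g h : 'I_n).
Local Open Scope ring_scope.

(* Density is multiplicative: if every section of [S] had density below [d], the
   density of [S] would be below [d ^+ 2]. *)
Lemma dense_section (R : realType) (d : R) H dn S : 0 < d ->
  (forall t, t \in dn -> covered H t = set0) ->
  (0 < #|pairs_covered H S|)%N ->
  d ^+ 2 * (size S)%:R <= #|pairs_covered H S|%:R ->
  exists P, [/\ P != set0, d * #|P|%:R <= #|covered_by H P|%:R &
    (exists t, P = section_row dn S t) \/ (exists h, P = section_column H dn S h)].
Proof.
move=> d0 cdn N0 dN.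
pose ok P := (P != set0) && (d * #|P|%:R <= #|covered_by H P|%:R).
have [/existsP[t /andP[P0 Pd]]|/existsPn nr] := boolP [exists t, ok (section_row dn S t)].
  by exists (section_row dn S t); split=> //; left; exists t.
have [/existsP[h /andP[P0 Pd]]|/existsPn nc] := boolP [exists h, ok (section_column H dn S h)].
  by exists (section_column H dn S h); split=> //; right; exists h.
exfalso.
have bound P : ~~ ok P -> #|covered_by H P|%:R <= d * #|P|%:R.
  rewrite /ok negb_and negbK -ltNge => /orP[/eqP->|/ltW//].
  by rewrite /covered_by big_set0 !cards0 mulr0.
have bound_lt P : ~~ ok P -> (0 < #|covered_by H P|)%N ->
    #|covered_by H P|%:R < d * #|P|%:R.
  rewrite /ok negb_and negbK -ltNge => /orP[/eqP->|//].
  by rewrite /covered_by big_set0 !cards0.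
have le1 : (\sum_h #|section_column H dn S h|)%:R <= d * (size S)%:R.
  apply: (@le_trans _ _ (\sum_t #|covered_by H (section_row dn S t)|)%:R).
    by rewrite ler_nat; exact: sum_columns.
  apply: (@le_trans _ _ (d * (\sum_t #|section_row dn S t|)%:R)).
    by rewrite !natr_sum mulr_sumr ler_sum // => t _; exact/bound/nr.
  by rewrite ler_pM2l // ler_nat sum_rows.
have lt2 : #|pairs_covered H S|%:R < d * (\sum_h #|section_column H dn S h|)%:R.
  (* One strict inequality is needed for the contradiction. It comes from a hypothesis whose column
     covers something, since an empty column gives only equality. *)
  move: N0; rewrite (card_pairs_covered _ cdn) lt0n sum_nat_eq0 => /forallPn[h /= h0].
  rewrite !natr_sum mulr_sumr (bigD1 h) //= [ltRHS](bigD1 h) //=.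
  apply: ltr_leD; first by apply: bound_lt; rewrite ?nc // lt0n.
  by apply: ler_sum => g _; exact/bound/nc.
have le2 : d * (\sum_h #|section_column H dn S h|)%:R <= d ^+ 2 * (size S)%:R.
  by rewrite expr2 -mulrA ler_pM2l.
by have := lt_le_trans lt2 (le_trans le2 dN); rewrite ltxx.
Qed.

Lemma densest_exists H (cs : seq {set 'I_m}) P0 : P0 \in cs -> P0 != set0 ->
  exists2 P, P \in cs & densest H cs P.
Proof.
move=> P0c P00; pose f P : rat := #|covered_by H P|%:R / #|P|%:R.
case: (@Order.TotalTheory.arg_maxP _ _ _ P0
  (fun P => (P \in cs) && (P != set0)) f); first by rewrite P0c.
move=> P /andP[Pc Pn] Pmax; exists P => //; rewrite /densest Pn; apply/allP => Q Qc.
have [->|Q0] := eqVneq Q set0; first by rewrite /covered_by big_set0 cards0.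
have : f Q <= f P by apply: Pmax; rewrite Qc Q0.
rewrite /f.
have pos T : T != set0 -> 0 < #|T|%:R :> rat by rewrite ltr0n card_gt0.
rewrite ler_pdivrMr ?pos // mulrAC ler_pdivlMr ?pos //.
by rewrite -!natrM ler_nat.
Qed.

Lemma covered_sub H t : covered H t \subset H.
Proof. by apply/subsetP => h; rewrite inE => /andP[]. Qed.

Lemma covered_by_sub H P : covered_by H P \subset H.
Proof. by apply/bigcupsP => t _; exact: covered_sub. Qed.

Lemma covered_const H t : H != set0 -> (forall h, h \in H -> H \subset part t h) ->
  covered H t = set0.
Proof.
move=> H0 Hc; apply/setP => h; rewrite !inE; apply/negP => /andP[hH].
rewrite (setIidPr (Hc h hH)) leqNgt => /negP[].
by rewrite -[X in (X < _)%N]addn0 ltn_add2l card_gt0.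
Qed.

Lemma size_pair_universe H : size (pair_universe H) = (#|coverable H| * #|coverable H|)%N.
Proof. by rewrite size_allpairs -!cardE. Qed.

Lemma card_cov_product H dn (C : seq 'I_(sc_m (product_instance H dn))) :
  #|cov C| = #|pairs_covered H [seq tnth (in_tuple (pair_tests I)) j | j <- C]|.
Proof.
have /tuple_uniqP inj : uniq (in_tuple (pair_universe H)) := pair_universe_uniq H.
rewrite -(card_imset _ inj); apply: eq_card => u; rewrite !inE.
apply/imsetP/idP => [[x]|].
  rewrite (mem_cov C) => /hasP[j jC]; rewrite inE => ju ->.
  by apply/hasP; exists (tnth (in_tuple (pair_tests I)) j); rewrite ?map_f.
move=> /hasP[p /mapP[j jC ->]] /andP[u1 u2].
have /tnthP[x ux] : u \in in_tuple (pair_universe H).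
  case: u u1 u2 => g h /= gs ht; rewrite mem_pair_universe.
  by apply/andP; split; apply/bigcupP; [exists (tnth (in_tuple (pair_tests I)) j).1
    | exists (tnth (in_tuple (pair_tests I)) j).2].
exists x => //; rewrite (mem_cov C); apply/hasP; exists j => //.
by rewrite inE -ux; apply/andP.
Qed.

End Density.

Section SelectDensity.
Variable I : pcacdt.
Local Notation n := (dt_n I).
Local Notation m := (dt_m I).
Implicit Types (H G : {set 'I_n}) (dn pd P : {set 'I_m}) (s t : 'I_m) (g h : 'I_n).

Lemma valid_covered H dn pd t : valid H dn pd -> t \in dn -> covered H t = set0.
Proof. by move=> [H0 Hc _ _] tdn; apply: covered_const => // h; exact: Hc. Qed.

(** The path is followed from the root of the whole tree, so its tests may include some of [dn].
    These are dropped: they cover nothing, and closedness is only required relative to [dn]. *)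
Lemma closed_dense_set H dn pd (D : dtree n m) : valid H dn pd -> 1 < #|H| ->
  precedence_closed_dtree D ->
  exists P, [/\ closed_over dn P, #|H| <= 2 * #|covered_by H P| &
    #|P| * #|H| <= 2 * \sum_(h in H) cost D h].
Proof.
move=> V H1 [iD cD].
have [] := heavy_path H1 iD cD; first by rewrite setTI; lia.
move=> L; rewrite setTI => -[Lp Lc Lk]; exists ([set t in L] :\: dn); split.
- split; first by rewrite disjoint_subset; apply/subsetP => t; rewrite !inE => /andP[].
  move=> s t; rewrite !inE => /andP[_ tL] /(Lp _ _ tL); rewrite in_nil orbF => ->.
  by rewrite andbT orNb.
- have -> : covered_by H ([set t in L] :\: dn) = covered_by H [set t in L].
    apply/setP => h; apply/bigcupP/bigcupP => -[t].
      by rewrite inE => /andP[_ tL] ht; exists t.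
    move=> tL ht; exists t => //; rewrite inE tL andbT; apply/negP => tdn.
    by move: ht; rewrite (valid_covered V tdn) inE.
  have := cardsID (covered_by H [set t in L]) H.
  rewrite (setIidPr (covered_by_sub _ _)); move: Lc.
  by move: #|_ :\: _| #|covered_by _ _| #|H| => a b c; lia.
- rewrite [leqRHS]mulnC; apply: leq_trans Lk; rewrite leq_mul2r.
  apply/orP; right; apply: leq_trans (subset_leq_card (subsetDl _ _)) _.
  by rewrite cardsE card_size.
Qed.

(** The square of a closed set is closed for the product order; a linear extension of it makes it a
    sequence. *)
Lemma product_closed_seq H dn P : closed_over dn P ->
  exists C : seq 'I_(sc_m (product_instance H dn)),
    [/\ precedence_closed_seq C, #|cov C| = #|covered_by H P| ^ 2 &
        size C = #|P| ^ 2].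
Proof.
move=> [PD Pc]; pose f := tnth (in_tuple (pair_tests I)).
have /tuple_uniqP inj : uniq (in_tuple (pair_tests I)) := pair_tests_uniq I.
pose Q : {set 'I_(sc_m (product_instance H dn))} := [set j | f j \in setX P P].
have fQ p : p \in setX P P -> exists2 j, j \in Q & f j = p.
  move=> pP; have /tnthP[j pj] : p \in in_tuple (pair_tests I) := mem_pair_tests p.
  by exists j; [rewrite inE /f -pj | rewrite /f -pj].
have [] := @closed_set_seq (product_instance H dn) Q.
  move=> i j; rewrite !inE => /andP[j1 j2].
  rewrite /= /product_prec /pair_prec -/f => /andP[a1 a2].
  have down s t : t \in P -> avail_prec dn s t -> s \in P.
    move=> tP /orP[/eqP->//|/and3P[sdn _ st]].
    by have := Pc _ _ tP st; rewrite (negbTE sdn) orbF.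
  by rewrite (down _ _ j1 a1) (down _ _ j2 a2).
move=> C [Cc CQ sC]; exists C; split=> //.
- rewrite card_cov_product -mulnn -cardsX; apply: eq_card => -[g h]; rewrite !inE.
  apply/hasP/andP => /=.
    move=> [p /mapP[j jC ->]] /andP[gs ht]; move: jC; rewrite CQ !inE => /andP[s t].
    by split; apply/bigcupP; [exists (f j).1 | exists (f j).2].
  move=> [/bigcupP[s sP gs] /bigcupP[t tP ht]].
  have [j jQ jE] := fQ (s, t) ltac:(by rewrite inE sP).
  exists (s, t); last by rewrite /pair_covered gs.
  by rewrite -jE map_f // CQ.
- rewrite sC -mulnn -cardsX -(card_imset _ inj); apply: eq_card => p.
  apply/imsetP/idP => [[j]|/fQ[j jQ <-]]; last by exists j.
  by rewrite inE => jP ->.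
Qed.

Variables (R : realType) (alpha beta : R).
Variable sol : forall J : pcmssc, seq 'I_(sc_m J).
Hypothesis alpha1 : (1 <= alpha)%R.
Hypothesis beta1 : (1 <= beta)%R.
Hypothesis sol_ok : forall J, bicriteria_solution alpha beta (sol J).

Local Open Scope ring_scope.

(** Dividing by [#|H|] gives the form in which it is used: the cost [#|P| * #|H|] of performing the
    chosen set is charged to the reference tree [D], in proportion to the covered fraction of [H].
    The constant is 32 from the density of a section, times 2 from [closed_dense_set]. *)
Lemma select_density H dn pd (D : dtree n m) : valid H dn pd -> (1 < #|H|)%N ->
  precedence_closed_dtree D ->
  #|select sol H dn|%:R * #|H|%:R ^+ 2 <=
  64%:R * (alpha * beta) * (\sum_(h in H) cost D h)%:R *
    #|covered_by H (select sol H dn)|%:R :> R.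
Proof.
move=> V H1 pD; have cdn t := @valid_covered H dn pd t V.
have [Q [Qc Qcov Qk]] := closed_dense_set V H1 pD.
have [C0 [C0c C0cov C0size]] := product_closed_seq H Qc.
have cH : (#|covered_by H Q| <= #|H|)%N by exact/subset_leq_card/covered_by_sub.
have VH : (#|coverable H| <= #|H|)%N.
  by apply: subset_leq_card; apply/bigcupsP => t _; exact: covered_sub.
have cV : (#|covered_by H Q| <= #|coverable H|)%N.
  apply: subset_leq_card; apply/bigcupsP => t _.
  exact: (bigcup_sup t).
have feas : pcmssc_feasible C0.
  split=> //; rewrite C0cov /= size_pair_universe ler_pdivrMl ?ltr0n //.
  rewrite -natrM ler_nat; move: VH Qcov.
  by move: #|coverable H| #|covered_by H Q| #|H| => a b c; nia.
have [v vopt vle] := @is_optimum_exists _ _ (@cover_time _) _ feas.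
have [solc solcov soltime] := sol_ok (product_instance H dn).
set C := sol (product_instance H dn) in solc solcov soltime.
have [j [jC jhalf jtime]] := half_cover C.
pose S := take j (sol_pairs sol H dn).
have covS : #|pairs_covered H S| = #|cov (take j C)|.
  by rewrite card_cov_product map_take.
have sizeS : (size S <= j)%N by rewrite size_take; case: ltnP.
have {}soltime := soltime v vopt.
(* The square of [Q] is feasible, has [#|Q| ^ 2] pairs of tests and covers at most [#|H| ^ 2]
   pairs. *)
have vbound : (v <= (#|H| * #|Q|) ^ 2)%N.
  apply: leq_trans vle _; apply: leq_trans (cover_time_leq _) _.
  by rewrite C0cov C0size -expnMn leq_exp2r // leq_mul2r cH orbT.
have {}solcov : #|coverable H|%:R ^+ 2 <= 4%:R * beta * #|cov C|%:R :> R.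
  move: #|cov C|%:R solcov => N; rewrite /= size_pair_universe ler_pdivrMr ?(lt_le_trans ltr01) //.
  rewrite fmorphV rmorph_nat ler_pdivrMl ?ltr0n // natrM -expr2.
  by rewrite [N * beta]mulrC mulrA.
pose a : R := #|H|%:R; pose q : R := #|Q|%:R; pose N : R := #|cov C|%:R.
have a0 : 0 < a by rewrite ltr0n (ltn_trans _ H1).
have q0 : 0 < q.
  rewrite ltr0n card_gt0; apply/eqP => Q0; move: Qcov.
  rewrite Q0 /covered_by big_set0 cards0 muln0 leqn0 => /eqP E.
  by rewrite E in H1.
have [al0 be0] : 0 < alpha /\ 0 < beta by split; exact: lt_le_trans ltr01 _.
(* 16 is 4 from the required fraction times 4 because [coverable H] may be only half of [H],
   squared. *)
have aN : a ^+ 2 <= 16%:R * beta * N.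
  have aV : a <= 2%:R * #|coverable H|%:R.
    by rewrite -natrM ler_nat (leq_trans Qcov) // leq_mul2l cV orbT.
  have : a ^+ 2 <= (2%:R * #|coverable H|%:R) ^+ 2.
    by rewrite ler_pXn2r ?nnegrE ?mulr_ge0 ?ler0n ?(ltW a0).
  by rewrite exprMn; move: solcov; rewrite -/N; lra.
have N0 : 0 < N.
  have : 0 < 16%:R * beta * N by apply: lt_le_trans aN; rewrite exprn_gt0.
  by rewrite pmulr_rgt0 // mulr_gt0 ?ltr0n.
have jN : j%:R * N <= 2%:R * alpha * (a * q) ^+ 2.
  have le1 : j%:R * N <= 2%:R * (cover_time C)%:R by rewrite -!natrM ler_nat.
  have le2 : v%:R <= (a * q) ^+ 2 by rewrite -natrM -natrX ler_nat.
  apply: le_trans le1 _; rewrite -mulrA ler_pM2l ?ltr0n //.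
  by apply: le_trans soltime _; rewrite ler_pM2l.
have NS : N <= 2%:R * #|pairs_covered H S|%:R by rewrite /N covS -natrM ler_nat.
(* The square root of the density guaranteed for [S] is a / (32 sqrt(alpha) beta q), where 32^2 = 2
   * 2 * 16^2: the factors come from the half prefix, counted twice, and from [aN], used twice. *)
pose d : R := a / (32%:R * (alpha * beta) * q).
have D0 : 0 < 32%:R * (alpha * beta) * q by rewrite !mulr_gt0.
have d0 : 0 < d by exact: divr_gt0.
have dE : d * (32%:R * (alpha * beta) * q) = a.
  by rewrite divfK // gt_eqF.
have dj : d ^+ 2 * j%:R <= N / 2%:R.
  pose e := d * q; have e0 : 0 < e by exact: mulr_gt0.
  have eE : 32%:R * (alpha * beta) * e = a by rewrite /e mulrCA mulrC -dE; ring.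
  have aeN : 2%:R * alpha * (a * e) <= N.
    rewrite -(ler_pM2l (x := 16%:R * beta)) ?mulr_gt0 //.
    apply: le_trans aN; rewrite le_eqVlt; apply/orP; left; apply/eqP.
    by rewrite expr2 -{2}eE; ring.
  have aeN2 : (2%:R * alpha * (a * e)) ^+ 2 <= N ^+ 2.
    have ae0 : 0 < 2%:R * alpha * (a * e) by do 2?apply: mulr_gt0 => //; rewrite ?ltr0n ?mulr_gt0.
    by apply: lerXn2r; rewrite // nnegrE ltW.
  rewrite -(ler_pM2r N0) -mulrA; apply: (@le_trans _ _ (2%:R * alpha * (a * e) ^+ 2)).
    apply: le_trans (_ : d ^+ 2 * (2%:R * alpha * (a * q) ^+ 2) <= _).
      by rewrite ler_pM2l ?exprn_gt0.
    by rewrite le_eqVlt; apply/orP; left; apply/eqP; rewrite /e; ring.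
  (* Since [1 <= alpha], one factor [alpha] may become its square, as [aeN2] requires; here a square
     root of [alpha] is given away. *)
  have : alpha * (a * e) ^+ 2 <= alpha ^+ 2 * (a * e) ^+ 2.
    apply: ler_wpM2r; first exact: sqr_ge0.
    by rewrite expr2 ler_peMl // ltW.
  have : (2%:R * alpha * (a * e)) ^+ 2 = 4%:R * (alpha ^+ 2 * (a * e) ^+ 2) by ring.
  have : N / 2%:R * N = N ^+ 2 / 2%:R by ring.
  move: aeN2; lra.
have dS : d ^+ 2 * (size S)%:R <= #|pairs_covered H S|%:R.
  apply: le_trans (_ : d ^+ 2 * j%:R <= _); first by rewrite ler_pM2l ?exprn_gt0 // ler_nat.
  by apply: le_trans dj _; rewrite ler_pdivrMr ?ltr0n // mulrC.
have S0 : (0 < #|pairs_covered H S|)%N.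
  by rewrite -(ltr0n R); move: NS N0; lra.
have [P0 [P00 P0d P0S]] := dense_section d0 cdn S0 dS.
have P0c : P0 \in candidates sol H dn.
  apply/flatten_mapP; exists j; first by rewrite mem_iota /= ltnS size_map.
  rewrite mem_cat; apply/orP; case: P0S => [[t ->]|[h ->]]; [left|right].
    by apply/mapP; exists t; rewrite ?mem_enum.
  by apply/mapP; exists h; rewrite ?mem_enum.
have [P1 P1c P1d] := densest_exists H P0c P00.
set P := select sol H dn.
(* A densest nonempty candidate exists, so the fallback of [select] is not taken. *)
have : P \in [seq P <- candidates sol H dn | densest H (candidates sol H dn) P].
  rewrite /P /select; case E: [seq P <- _ | _] => [|P2 r] /=; last by rewrite mem_head.
  have : P1 \in [seq P <- candidates sol H dn | densest H (candidates sol H dn) P].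
    by rewrite mem_filter P1d.
  by rewrite E.
rewrite mem_filter => /andP[/andP[_ /allP/(_ P0 P0c) PP0] _].
have P0pos : 0 < #|P0|%:R :> R by rewrite ltr0n card_gt0.
have dP : d * #|P|%:R <= #|covered_by H P|%:R.
  rewrite -(ler_pM2r P0pos); apply: (@le_trans _ _ (#|covered_by H P0|%:R * #|P|%:R)).
    by rewrite mulrAC ler_wpM2r ?ler0n.
  by rewrite -!natrM ler_nat.
have qa : q * a <= 2%:R * (\sum_(h in H) cost D h)%:R by rewrite -!natrM ler_nat.
have aP : a * #|P|%:R <= 32%:R * (alpha * beta) * q * #|covered_by H P|%:R.
  by rewrite -dE (mulrC d) -[leLHS]mulrA ler_pM2l.
apply: (@le_trans _ _ (32%:R * (alpha * beta) * (q * a) * #|covered_by H P|%:R)).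
  have := aP; rewrite -(ler_pM2r a0) => le; apply: le_trans (le_trans le _).
    by rewrite le_eqVlt; apply/orP; left; apply/eqP; rewrite /a; ring.
  by rewrite le_eqVlt; apply/orP; left; apply/eqP; rewrite /a; ring.
apply: ler_wpM2r; first exact: ler0n.
have : 32%:R * (alpha * beta) * (q * a) <=
    32%:R * (alpha * beta) * (2%:R * (\sum_(h in H) cost D h)%:R).
  by rewrite ler_pM2l // !mulr_gt0.
by move/le_trans; apply; rewrite le_eqVlt; apply/orP; left; apply/eqP; ring.
Qed.

End SelectDensity.

(** * Logarithmic potential and total cost *)

Section Ratio.
Variable I : pcacdt.
Local Notation n := (dt_n I).
Local Notation m := (dt_m I).
Implicit Types (H G : {set 'I_n}) (dn pd P : {set 'I_m}) (s t : 'I_m) (g h : 'I_n).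
Variables (R : realType) (alpha beta : R).
Variable sol : forall J : pcmssc, seq 'I_(sc_m J).
Hypothesis alpha1 : (1 <= alpha)%R.
Hypothesis beta1 : (1 <= beta)%R.
Hypothesis sol_ok : forall J, bicriteria_solution alpha beta (sol J).
Variable D : dtree n m.
Hypothesis D_ok : precedence_closed_dtree D.
Local Open Scope ring_scope.

Let sol_closed J : precedence_closed_seq (sol J).
Proof. by case: (sol_ok J). Qed.

Lemma ln2_le1 : ln 2%:R <= 1 :> R.
Proof. by rewrite (_ : 2%:R = 1 + 1) ?le_ln1Dx //; lra. Qed.

Lemma ln2_ge : 2%:R^-1 <= ln 2%:R :> R.
Proof.
(* The inequality ln (1 + x) <= x at x = -1/2. *)
have := @le_ln1Dx R (- 2%:R^-1).
rewrite (_ : 1 + - 2%:R^-1 = 2%:R^-1); last by lra.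
rewrite lnV ?posrE ?ltr0n //; have : -1 < - 2%:R^-1 :> R by lra.
by move=> -> /(_ isT); lra.
Qed.

(* An upper bound for [ln] of the size of what is left of [H] after performing all
   of [P], whatever the replies. *)
Definition block_bound H P : R :=
  ln #|H|%:R - ln 2%:R * (#|covered_by H P|%:R / #|H|%:R).

Lemma covered_ratio_le1 H P : #|covered_by H P|%:R / #|H|%:R <= 1 :> R.
Proof.
have [->|H0] := eqVneq #|H| 0%N; first by rewrite invr0 mulr0.
rewrite ler_pdivrMr ?ltr0n ?lt0n // mul1r ler_nat.
exact/subset_leq_card/covered_by_sub.
Qed.

(** Needed when a branch reaches a single hypothesis while tests of its block are still pending. *)
Lemma block_bound_ge0 H P : (1 < #|H|)%N -> 0 <= block_bound H P.
Proof.
move=> H1; have := covered_ratio_le1 H P; have := ln2_ge.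
have : ln 2%:R <= ln #|H|%:R :> R.
  by rewrite ler_ln ?posrE ?ltr0n ?(ltn_trans _ H1) // ler_nat.
rewrite /block_bound; set c := _ / _; set a := ln #|H|%:R; set b := ln 2%:R => h1 h2 h3.
have : b * c <= b * 1 by rewrite ler_wpM2l //; lra.
lra.
Qed.

(** Either [H'] avoids the covered set, so that |H'| <= |H| - c, and ln (1 - x) <= - x together with
    ln 2 <= 1 gives the bound; or it contains an element covered by some test of [P], so that |H'|
    <= |H| / 2, and the covered ratio is at most 1. *)
Lemma ln_part H H' P : H' != set0 -> H' \subset H -> (1 < #|H|)%N ->
  (forall t h, t \in P -> h \in H' -> H' \subset part t h) ->
  ln #|H'|%:R <= block_bound H P.
Proof.
move=> H'0 HH H1 Pc.
have H'pos : 0 < #|H'|%:R :> R by rewrite ltr0n card_gt0.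
have Hpos : 0 < #|H|%:R :> R by rewrite ltr0n (ltn_trans _ H1).
have l2 := ln2_ge; have l21 := ln2_le1; have c1 := covered_ratio_le1 H P.
have c0 : 0 <= #|covered_by H P|%:R / #|H|%:R :> R by rewrite divr_ge0.
rewrite /block_bound; have [dis|] := boolP [disjoint H' & covered_by H P].
  have le1 : #|H'|%:R / #|H|%:R - 1 <= - (#|covered_by H P|%:R / #|H|%:R) :> R.
    rewrite lerBlDr -lerBlDl opprK -mulrDl ler_pdivrMr // mul1r -natrD ler_nat.
    have := leq_card_setU H' (covered_by H P); rewrite dis => -[_ /eqP <-].
    by apply: subset_leq_card; rewrite subUset HH covered_by_sub.
  have r0 : 0 < #|H'|%:R / #|H|%:R :> R by rewrite divr_gt0.
  have /le_ln1Dx : -1 < #|H'|%:R / #|H|%:R - 1 :> R by lra.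
  rewrite (_ : 1 + (#|H'|%:R / #|H|%:R - 1) = #|H'|%:R / #|H|%:R); last by lra.
  rewrite ln_div ?posrE // => le2.
  move: le1 c0 c1 le2; set c := #|covered_by H P|%:R / _; set x := _ / _.
  set w := ln 2%:R in l2 l21 * => le1 c0 c1 le2; have : w * c <= c by rewrite ler_piMl //; lra.
  lra.
move=> /pred0Pn[h /andP[/= hH' /bigcupP[t tP]]]; rewrite inE => /andP[hH small].
have le1 : (#|H'| * 2 <= #|H|)%N.
  rewrite muln2 -addnn; apply: leq_trans small; apply: leq_add;
  by apply: subset_leq_card; rewrite subsetI Pc.
have : ln (#|H'| * 2)%:R <= ln #|H|%:R :> R.
  rewrite ler_ln ?ler_nat // posrE.
  by rewrite natrM mulr_gt0.
rewrite natrM lnM ?posrE //.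
set c := _ / _ in c0 c1 *; set w := ln 2%:R in l2 l21 *.
have : w * c <= w * 1 by rewrite ler_wpM2l //; lra.
lra.
Qed.

Let K : R := 64%:R * (alpha * beta) / ln 2%:R.
(** The cost in the fixed tree [D], restricted to [H]; it is not the optimum of the subproblem, but
    it adds up exactly over the parts of [H]. *)
Let opt H : R := (\sum_(h in H) cost D h)%:R.

Let K_ge0 : 0 <= K.
Proof.
have l2 := ln2_ge; rewrite /K divr_ge0 //; last by lra.
by rewrite !mulr_ge0 ?ler0n // (le_trans ler01).
Qed.

Definition solve_sum k H dn pd : R :=
  (\sum_(g in H) cost (solve sol k H dn pd) g)%:R.

(** [H0] and [P] stand for the hypotheses at which the current block was chosen and for the chosen
    set. They stay fixed inside the block while [H] and [pd] shrink, so the logarithmic factor is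
    common to all branches. *)
Definition block_ok k := forall H dn pd H0 P, (weight H dn <= k)%N ->
  valid H dn pd -> pd != set0 -> H \subset H0 -> (1 < #|H0|)%N ->
  P \subset dn :|: pd ->
  solve_sum k H dn pd <= #|pd|%:R * #|H|%:R + K * opt H * block_bound H0 P.

Lemma solve_sum_leaf k H dn pd : (#|H| <= 1)%N -> solve_sum k H dn pd = 0.
Proof.
move=> H1; rewrite /solve_sum big1 // => g _; exact: solve_leaf_cost.
Qed.

Lemma fresh_ok k H dn : block_ok k -> (weight H dn <= k)%N ->
  valid H dn set0 -> solve_sum k H dn set0 <= K * opt H * ln #|H|%:R.
Proof.
move=> bk wk V.
have Kopt : 0 <= K * opt H by rewrite mulr_ge0 // ler0n.
have [H1|H1] := leqP #|H| 1.
  rewrite solve_sum_leaf // mulr_ge0 // ln_ge0 // ler1n card_gt0.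
  exact: valid_H V.
have dnT := valid_dn V H1; have sg := select_good sol_closed H dnT.
(* With nothing pending the plan is the selected set, so the tree is the one obtained with that set
   pending from the start. *)
have -> : solve_sum k H dn set0 = solve_sum k H dn (select sol H dn).
  rewrite /solve_sum; congr _%:R; apply: eq_bigr => g _; congr (cost _ g).
  case: (k) => //= k'; rewrite /next_test /plan eqxx.
  by case: eqP sg => // -> [/eqP].
have V' : valid H dn (select sol H dn).
  by case: V => *; split=> //; right.
apply: le_trans (bk _ _ _ H (select sol H dn) wk V' _ _ H1 _) _ => //.
- by case: sg.
- exact: subsetUr.
(* What remains is that performing the block costs no more than the drop in potential. The [ln 2] of
   the drop cancels the one in [K], leaving [select_density]. *)
rewrite /block_bound mulrBr addrCA -[leRHS]addr0 lerD2l subr_le0.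
have Hpos : 0 < #|H|%:R :> R by rewrite ltr0n (ltn_trans _ H1).
rewrite -(ler_pM2r Hpos); apply: le_trans (_ : _ <= 64%:R * (alpha * beta) * opt H *
    #|covered_by H (select sol H dn)|%:R) _.
  have := select_density alpha1 beta1 sol_ok V H1 D_ok.
  by rewrite expr2 mulrA.
have l2 : ln 2%:R != 0 :> R by rewrite gt_eqF //; have := ln2_ge; lra.
rewrite /K le_eqVlt; apply/orP; left; apply/eqP; field.
by rewrite l2 gt_eqF.
Qed.

Lemma block_okP k : block_ok k.
Proof.
elim: k => [|k bk] H dn pd H0 P wk V pd0 HH H01 Pd.
  by have := weight_gt0 H dn; rewrite lt0n -leqn0 wk.
have Kopt G : 0 <= K * opt G by rewrite mulr_ge0 // ler0n.
have [H1|H1] := leqP #|H| 1.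
  rewrite solve_sum_leaf //; apply: addr_ge0; first by rewrite mulr_ge0 ?ler0n.
  by apply: mulr_ge0 (Kopt H) _; exact: block_bound_ge0.
have [t Et tP] := next_testP sol_closed V H1.
have planE : plan sol H dn pd = pd by rewrite /plan (negbTE pd0).
have tpd : t \in pd by case/andP: tP; rewrite planE.
rewrite /solve_sum (solve_cost k Et) planE natr_sum.
(* The bound is distributed over the replies: one of the [#|pd|] units per hypothesis pays for [t],
   and [opt] is additive. *)
have -> : #|pd|%:R * #|H|%:R + K * opt H * block_bound H0 P =
    \sum_(h <- reps H t) (#|part t h :&: H|%:R + (#|pd :\ t|%:R *
      #|part t h :&: H|%:R + K * opt (part t h :&: H) * block_bound H0 P)).
  rewrite big_split big_split /= -mulr_sumr -!mulr_suml -mulr_sumr -!natr_sum.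
  rewrite /opt sum_reps (cardsD1 t pd) tpd add1n.
  have -> : (\sum_(h <- reps H t) #|part t h :&: H| = #|H|)%N.
    rewrite -[RHS]sum1_card -(sum_reps H t); apply: eq_bigr => h _.
    by rewrite sum1_card.
  by rewrite -natr1; ring.
rewrite big_seq_cond [leRHS]big_seq_cond; apply: ler_sum => h.
rewrite andbT => hr; rewrite natrD lerD2l.
have hH := rep_mem (mem_reps hr).
have V' := valid_child sol_closed V Et hH; rewrite planE in V'.
have wk' := weight_child Et hr wk.
have sub' : part t h :&: H \subset H0 by exact: subset_trans (subsetIr _ _) HH.
(* If tests are still pending, [H0] and [P] carry over. If [t] was the last one, all of [P] has been
   performed, a new block starts, and [ln_part] bounds the logarithm of what is left. *)
have [p0|p0] := eqVneq (pd :\ t) set0; last first.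
  apply: bk => //; apply: subset_trans Pd _; apply/subsetP => s; rewrite !inE.
  by case: (s == t) => //=; rewrite ?orbT.
rewrite p0 in V' *; rewrite cards0 mul0r add0r.
apply: le_trans (fresh_ok bk wk' V') _.
apply: ler_wpM2l => //; apply: ln_part => //; first exact: valid_H V'.
move=> s g sP; apply: (valid_const V'); move: (subsetP Pd s sP); rewrite !inE.
move/setP/(_ s): p0; rewrite !inE; case: (s == t) => //= ->.
by rewrite orbF.
Qed.

Lemma solve_ratio k : (weight [set: 'I_n] (set0 : {set 'I_m}) <= k)%N ->
  (cost_A (solve sol k [set: 'I_n] set0 set0))%:R <=
  K * (cost_A D)%:R * ln n%:R.
Proof.
move=> wk; have := fresh_ok (block_okP (k := k)) wk (valid_start I).
rewrite /solve_sum /opt cardsT card_ord /cost_A.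
have sumT (F : 'I_n -> nat) : (\sum_(g in [set: 'I_n]) F g = \sum_(g < n) F g)%N.
  by apply: eq_bigl => g; rewrite inE.
by rewrite !sumT.
Qed.

End Ratio.

(** The argument of the logarithm is 1 + x with x = 1 / (5 beta - 1), so the inverse of the
    logarithm is at least 5 beta - 1 >= 4 beta; and ln 2 >= 1/2 turns 64 / ln 2 into 128 = 32 *
    4. *)
Lemma ratio_bound (R : realType) (alpha beta : R) :
  (1 <= alpha -> 1 <= beta ->
   64%:R * (alpha * beta) / ln 2%:R <=
     32%:R * (alpha / ln (5 * beta / (5 * beta - 1))) :> R)%R.
Proof.
move=> a1 b1; have l2 := ln2_ge R.
pose x : R := ((5 * beta - 1)^-1)%R.
have b0 : (0 < 5 * beta - 1 :> R)%R by lra.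
have x0 : (0 < x)%R by rewrite invr_gt0.
have -> : (5 * beta / (5 * beta - 1) = 1 + x)%R.
  by rewrite /x; field; rewrite gt_eqF.
have lx : (ln (1 + x) <= x)%R by apply: le_ln1Dx; lra.
have l0 : (0 < ln (1 + x))%R by rewrite ln_gt0 // ltrDl.
have le1 : (64%:R * (alpha * beta) / ln 2%:R <= 128%:R * (alpha * beta) :> R)%R.
  rewrite ler_pdivrMr; last by lra.
  have : (0 <= 128%:R * (alpha * beta) :> R)%R.
    by rewrite !mulr_ge0 // (le_trans ler01).
  move=> h; have := ler_wpM2l h l2; lra.
apply: le_trans le1 _.
have le2 : (4%:R * beta <= (ln (1 + x))^-1)%R.
  apply: (@le_trans _ _ (x^-1)%R); first by rewrite /x invrK; lra.
  by rewrite lef_pV2.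
have := ler_wpM2l (le_trans ler01 a1) le2; lra.
Qed.

(** * Running time *)

Lemma pt_setI_mem X (E : X -> seq data) (n : X -> nat)
    (A B : forall x, {set 'I_(n x)}) (i : forall x, 'I_(n x)) :
  polytime E (fun x => enc_bool (i x \in A x)) ->
  polytime E (fun x => enc_bool (i x \in B x)) ->
  polytime E (fun x => enc_bool (i x \in A x :&: B x)).
Proof. by move=> HA HB; apply: pt_ext (pt_and HA HB) => x; rewrite inE. Qed.

Lemma pt_eq_ord X (E : X -> seq data) (n : X -> nat) (i j : forall x, 'I_(n x)) :
  polytime E (fun x => enc_nat (i x)) -> polytime E (fun x => enc_nat (j x)) ->
  polytime E (fun x => enc_bool (i x == j x)).
Proof. by move=> Hi Hj; apply: pt_ext (pt_eqn Hi Hj) => x; rewrite val_eqE. Qed.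

Lemma pt_size_seq X (E : X -> seq data) (s : X -> seq data) :
  polytime E (fun x => enc_seq (s x)) -> polytime E (fun x => enc_nat (size (s x))).
Proof.
move=> Hs; apply: (pt_ext (f := fun x => enc_seq [seq DNil | _ <- s x])).
  by move=> x; congr enc_seq; elim: (s x) => //= a r ->.
apply: (pt_map (A := fun=> data) (ea := fun=> id) (f := fun _ _ => DNil)).
  by apply: pt_ext Hs => x; rewrite map_id.
exact: pt_const.
Qed.

Lemma pt_take X (E : X -> seq data) (k : X -> nat) (s : X -> seq data) :
  polytime E (fun x => enc_nat (k x)) -> polytime E (fun x => enc_seq (s x)) ->
  polytime E (fun x => enc_seq (take (k x) (s x))).
Proof.
move=> Hk Hs.
have Hm := pt_if (pt_leq Hk (pt_size_seq Hs)) Hk (pt_size_seq Hs).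
pose mn x := if k x <= size (s x) then k x else size (s x).
apply: (pt_ext (f := fun x => enc_seq [seq nth DNil (s x) i | i <- iota 0 (mn x)])).
  move=> x; rewrite /mn; congr enc_seq; case: (leqP (k x)) => le.
    by rewrite map_nth_iota0.
  by rewrite map_nth_iota0 // take_size take_oversize // ltnW.
apply: (pt_map (A := fun=> nat) (ea := fun=> enc_nat) (f := fun x => nth DNil (s x))).
  by apply: pt_iota; apply: pt_ext Hm => x; rewrite /mn; case: ifP.
apply: (pt_nth (s := fun y : {_ : X & nat} => s (tag y))); first by pt_var.
exact: (pt_weaken tag (fun y : {_ : X & nat} => enc_nat (tagged y)) Hs).
Qed.

Lemma pt_enum_set X (E : X -> seq data) (n : X -> nat) (A : forall x, {set 'I_(n x)}) :
  polytime E (fun x => enc_nat (n x)) ->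
  polytime (ord_env E (n := n)) (fun y => enc_bool (tagged y \in A (tag y))) ->
  polytime E (fun x => enc_seq [seq enc_nat i | i : 'I_(n x) <- enum (A x)]).
Proof.
move=> Hn HA; apply: pt_ext (pt_filter (pt_enum_ord Hn) HA) => x.
by rewrite {2}/enum_mem -enumT.
Qed.

Definition enc_pair (A B : Type) (ea : A -> data) (eb : B -> data) (p : A * B) : data :=
  DCons (ea p.1) (eb p.2).

Lemma pt_allpairs X (E : X -> seq data) (A B : X -> Type) (ea : forall x, A x -> data)
    (eb : forall x, B x -> data) (l : forall x, seq (A x)) (r : forall x, seq (B x)) :
  polytime E (fun x => enc_seq [seq ea x a | a <- l x]) ->
  polytime E (fun x => enc_seq [seq eb x b | b <- r x]) ->
  polytime E (fun x => enc_seq [seq enc_pair (ea x) (eb x) p |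
    p <- [seq (a, b) | a <- l x, b <- r x]]).
Proof.
move=> Hl Hr; apply: (pt_ext (f := fun x => enc_seq (flatten
    [seq [seq DCons (ea x a) (eb x b) | b <- r x] | a <- l x]))).
  move=> x; congr enc_seq; rewrite map_flatten -map_comp; congr flatten.
  by apply: eq_map => a; rewrite /= -map_comp.
apply: pt_flatten; apply: (pt_ext (f := fun x => enc_seq
    [seq enc_seq [seq DCons (ea x a) (eb x b) | b <- r x] | a <- l x])).
  by move=> x; rewrite -map_comp.
apply: (pt_map (f := fun x a => enc_seq [seq DCons (ea x a) (eb x b) | b <- r x]) Hl).
have Hr' := pt_weaken tag (fun y : {x : X & A x} => ea (tag y) (tagged y)) Hr.
apply: (pt_map (A := fun y => B (tag y)) (ea := fun y => eb (tag y))
  (l := fun y => r (tag y)) (f := fun y b => DCons (ea (tag y) (tagged y)) (eb (tag y) b)) Hr').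
by apply: pt_cons; pt_var.
Qed.

(** Replaces a table indexed by positions in a list of pairs by a map over that list, which the
    programs can traverse. *)
Lemma map_tnth_seq (T S : Type) (f : T -> S) (s : seq T) :
  [seq f (tnth (in_tuple s) j) | j <- enum 'I_(size s)] = [seq f a | a <- s].
Proof. by rewrite (map_comp f) map_tnth_enum. Qed.

(** States only that the four components of an instance are computable, not where they sit, so it
    persists when bound variables are pushed onto the environment. *)
Record instance_env X (E : X -> seq data) (I : X -> pcacdt) : Prop := InstanceEnv {
  env_n : polytime E (fun x => enc_nat (dt_n (I x)));
  env_m : polytime E (fun x => enc_nat (dt_m (I x)));
  env_tests : polytime E (fun x =>
    enc_seq [seq enc_test (dt_test t) | t <- enum 'I_(dt_m (I x))]);
  env_rel : polytime E (fun x => enc_rel (@dt_prec (I x))) }.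

Lemma weaken_instance X Y (E : X -> seq data) I (u : Y -> X) (a : Y -> data) :
  instance_env E I -> instance_env (fun y => a y :: E (u y)) (fun y => I (u y)).
Proof.
case=> En Em Et Er.
by split; [exact: (pt_weaken u a En) | exact: (pt_weaken u a Em)
         | exact: (pt_weaken u a Et) | exact: (pt_weaken u a Er)].
Qed.

Section Selection.
Variable sol : forall J : pcmssc, seq 'I_(sc_m J).

Lemma pt_part X (E : X -> seq data) I (t : forall x, 'I_(dt_m (I x)))
    (g h : forall x, 'I_(dt_n (I x))) :
  instance_env E I -> polytime E (fun x => enc_nat (t x)) ->
  polytime E (fun x => enc_nat (g x)) -> polytime E (fun x => enc_nat (h x)) ->
  polytime E (fun x => enc_bool (g x \in part (t x) (h x))).
Proof.
move=> [_ _ Ht _] tE gE hE; apply: pt_mem gE.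
apply: (pt_tab_nth (F := fun x k => enc_set (part (t x) k)) _ hE).
exact: (pt_tab_nth (F := fun x k => enc_test (dt_test k)) Ht tE).
Qed.

Definition hyp_env X (E : X -> seq data) I (H : forall x, {set 'I_(dt_n (I x))}) :=
  instance_env E I /\ polytime E (fun x => enc_set (H x)).

Lemma weaken_hyp X Y (E : X -> seq data) I H (u : Y -> X) (a : Y -> data) :
  hyp_env E (I := I) H -> hyp_env (fun y => a y :: E (u y)) (fun y => H (u y)).
Proof.
by case=> IE HE; split; [exact: (weaken_instance u a IE) | exact: (pt_weaken u a HE)].
Qed.

Lemma pt_card_set X (E : X -> seq data) (n : X -> nat) (A : forall x, {set 'I_(n x)}) :
  polytime E (fun x => enc_nat (n x)) -> polytime E (fun x => enc_set (A x)) ->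
  polytime E (fun x => enc_nat #|A x|).
Proof.
move=> Hn HA; apply: pt_card => //.
by apply: pt_mem; [exact: pt_weaken HA | pt_var].
Qed.

Lemma pt_covered X (E : X -> seq data) I H (h : forall x, 'I_(dt_n (I x)))
    (t : forall x, 'I_(dt_m (I x))) : hyp_env E H ->
  polytime E (fun x => enc_nat (h x)) -> polytime E (fun x => enc_nat (t x)) ->
  polytime E (fun x => enc_bool (h x \in covered (H x) (t x))).
Proof.
move=> HE hE tE; have [IE SE] := HE.
apply: (pt_ext (f := fun x => enc_bool ((h x \in H x) &&
  (#|part (t x) (h x) :&: H x| + #|part (t x) (h x) :&: H x| <= #|H x|)))).
  by move=> x; rewrite [in RHS]inE.
apply: pt_and; first exact: pt_mem.
have nE := env_n IE.
have cE : polytime E (fun x => enc_nat #|part (t x) (h x) :&: H x|).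
  apply: (@pt_card _ _ _ nE (fun x => part (t x) (h x) :&: H x)).
  apply: pt_setI_mem; last by apply: pt_mem; [exact: pt_weaken SE | pt_var].
  by apply: pt_part; [exact: weaken_instance | exact: pt_weaken tE | pt_var | exact: pt_weaken hE].
by apply: pt_leq; [exact: pt_add | exact: pt_card_set].
Qed.

Definition enc_ord n (i : 'I_n) : data := enc_nat i.

Definition enc_ord2 n m (p : 'I_n * 'I_m) : data :=
  enc_pair (@enc_ord n) (@enc_ord m) p.

Lemma pt_ord2_fst X (E : X -> seq data) (n m : X -> nat)
    (p : forall x, ('I_(n x) * 'I_(m x))%type) :
  polytime E (fun x => enc_ord2 (p x)) -> polytime E (fun x => enc_nat (p x).1).
Proof. exact: pt_head. Qed.

Lemma pt_ord2_snd X (E : X -> seq data) (n m : X -> nat)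
    (p : forall x, ('I_(n x) * 'I_(m x))%type) :
  polytime E (fun x => enc_ord2 (p x)) -> polytime E (fun x => enc_nat (p x).2).
Proof. exact: pt_behead. Qed.

Lemma pt_avail_prec X (E : X -> seq data) I (dn : forall x, {set 'I_(dt_m (I x))})
    (s t : forall x, 'I_(dt_m (I x))) : instance_env E I ->
  polytime E (fun x => enc_set (dn x)) ->
  polytime E (fun x => enc_nat (s x)) -> polytime E (fun x => enc_nat (t x)) ->
  polytime E (fun x => enc_bool (avail_prec (dn x) (s x) (t x))).
Proof.
move=> IE dE sE tE; apply: pt_or; first exact: pt_eq_ord.
apply: pt_and; first by apply: pt_not; exact: pt_mem.
apply: pt_and; first by apply: pt_not; exact: pt_mem.
exact: (pt_rel (r := fun x => @dt_prec (I x)) (env_rel IE)).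
Qed.

(** The environment is the list whose encoding is [enc_pcmssc J] by definition, so an encoded
    instance can be passed to the solver as it is. *)
Definition solver_time := polytime (fun J : pcmssc =>
  [:: enc_nat (sc_n J); enc_nat (sc_m J);
     enc_seq [seq enc_set (sc_set t) | t <- enum 'I_(sc_m J)];
     enc_rel (@sc_prec J);
     enc_binary `|numq (sc_frac J)|%N;
     enc_binary `|denq (sc_frac J)|%N]) (fun J => enc_cover (sol J)).

Section SelectTime.
Variables (X : Type) (E : X -> seq data) (I : X -> pcacdt).
Variables (H : forall x, {set 'I_(dt_n (I x))}) (dn : forall x, {set 'I_(dt_m (I x))}).
Hypothesis HE : hyp_env E H.
Hypothesis dE : polytime E (fun x => enc_set (dn x)).

Let IE : instance_env E I. Proof. by case: HE. Qed.
Let SE : polytime E (fun x => enc_set (H x)). Proof. by case: HE. Qed.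

Lemma pt_coverable : polytime E (fun x => enc_set (coverable (H x))).
Proof.
have nE := env_n IE; apply: (pt_set nE (A := fun x => coverable (H x))).
have HE1 := weaken_hyp tag (fun y : {x : X & 'I_(dt_n (I x))} =>
  enc_nat (tagged y : 'I_(dt_n (I (tag y))))) HE.
apply: (pt_ext (f := fun y : {x : X & 'I_(dt_n (I x))} => enc_bool [exists t,
    (tagged y : 'I_(dt_n (I (tag y)))) \in covered (H (tag y)) t])).
  move=> y; congr enc_bool; apply/existsP/bigcupP.
    by move=> [t ht]; exists t.
  by move=> [t _ ht]; exists t.
have mE1 : polytime (ord_env E (n := fun x => dt_n (I x)))
    (fun y => enc_nat (dt_m (I (tag y)))) := env_m (proj1 HE1).
apply: (pt_exists mE1 (b := fun y t =>
  (tagged y : 'I_(dt_n (I (tag y)))) \in covered (H (tag y)) t)).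
apply: pt_covered; [exact: (weaken_hyp tag _ HE1) | by pt_var | by pt_var].
Qed.

Lemma pt_pair_universe : polytime E (fun x =>
  enc_seq [seq enc_ord2 u | u <- pair_universe (H x)]).
Proof.
have nE := env_n IE; have VE := pt_coverable.
have eE : polytime E (fun x => enc_seq [seq enc_ord i | i <- enum (coverable (H x))]).
  apply: (pt_enum_set (A := fun x => coverable (H x)) nE).
  by apply: pt_mem; [exact: (pt_weaken tag _ VE) | pt_var].
exact: (pt_allpairs eE eE).
Qed.

Lemma pt_pair_tests : polytime E (fun x =>
  enc_seq [seq enc_ord2 p | p <- pair_tests (I x)]).
Proof.
have eE : polytime E (fun x => enc_seq [seq enc_ord i | i <- enum 'I_(dt_m (I x))]).
  exact: (pt_enum_ord (env_m IE)).
exact: (pt_allpairs eE eE).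
Qed.

Lemma pt_product_sets : polytime E (fun x => enc_seq
  [seq enc_set (product_set (H x) j) | j <- enum 'I_(size (pair_tests (I x)))]).
Proof.
pose row_of x (p : 'I_(dt_m (I x)) * 'I_(dt_m (I x))) := enc_seq
  [seq enc_bool (pair_covered (H x) p u) | u <- pair_universe (H x)].
apply: (pt_ext (f := fun x => enc_seq [seq row_of x p | p <- pair_tests (I x)])).
  move=> x; rewrite -(map_tnth_seq (row_of x)); congr enc_seq.
  apply: eq_map => j; rewrite /row_of /enc_set -map_tnth_seq; congr enc_seq.
  by apply: eq_map => i; rewrite inE.
apply: (pt_map (f := row_of) pt_pair_tests); rewrite /row_of.
pose A x := ('I_(dt_m (I x)) * 'I_(dt_m (I x)))%type.
pose e1 (y : {x : X & A x}) := enc_ord2 (tagged y : A (tag y)).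
have HE1 := weaken_hyp tag e1 HE.
have UE1 := pt_weaken tag e1 pt_pair_universe.
apply: (pt_map (A := fun y => ('I_(dt_n (I (tag y))) * 'I_(dt_n (I (tag y))))%type)
  (ea := fun y => @enc_ord2 _ _) (l := fun y => pair_universe (H (tag y)))
  (f := fun y u => enc_bool (pair_covered (H (tag y)) (tagged y) u)) UE1).
have HE2 := weaken_hyp tag (fun y : {y : {x : X & A x} &
  ('I_(dt_n (I (tag y))) * 'I_(dt_n (I (tag y))))%type} => enc_ord2 (tagged y)) HE1.
set E2 := fun y => _ :: _.
have uE : polytime E2 (fun y => enc_ord2 (tagged y)) by pt_var.
have pE : polytime E2 (fun y => enc_ord2 (tagged (tag y))) by pt_var.
rewrite /pair_covered; apply: pt_and; apply: pt_covered => //.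
- exact: (pt_ord2_fst uE).
- exact: (pt_ord2_fst pE).
- exact: (pt_ord2_snd uE).
- exact: (pt_ord2_snd pE).
Qed.

Lemma pt_product_prec : polytime E (fun x => enc_rel (@product_prec (I x) (dn x))).
Proof.
pose A x := ('I_(dt_m (I x)) * 'I_(dt_m (I x)))%type.
pose row_of x (p : A x) := enc_seq
  [seq enc_bool (pair_prec (dn x) p q) | q <- pair_tests (I x)].
apply: (pt_ext (f := fun x => enc_seq [seq row_of x p | p <- pair_tests (I x)])).
  move=> x; rewrite -(map_tnth_seq (row_of x)); congr enc_seq.
  by apply: eq_map => j; rewrite /row_of -map_tnth_seq.
apply: (pt_map (f := row_of) pt_pair_tests); rewrite /row_of.
pose e1 (y : {x : X & A x}) := enc_ord2 (tagged y : A (tag y)).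
have IE1 := weaken_instance tag e1 IE; have dE1 := pt_weaken tag e1 dE.
have TE1 := pt_weaken tag e1 pt_pair_tests.
apply: (pt_map (A := fun y => A (tag y))
  (ea := fun y => @enc_ord2 _ _) (l := fun y => pair_tests (I (tag y)))
  (f := fun y q => enc_bool (pair_prec (dn (tag y)) (tagged y) q)) TE1).
pose e2 (y : {y : {x : X & A x} & A (tag y)}) := enc_ord2 (tagged y : A (tag (tag y))).
have IE2 := weaken_instance tag e2 IE1; have dE2 := pt_weaken tag e2 dE1.
have qE : polytime (fun y => e2 y :: e1 (tag y) :: E (tag (tag y)))
  (fun y => enc_ord2 (tagged y : A (tag (tag y)))) by pt_var.
have pE : polytime (fun y => e2 y :: e1 (tag y) :: E (tag (tag y)))
  (fun y => enc_ord2 (tagged (tag y) : A (tag (tag y)))) by pt_var.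
rewrite /pair_prec; apply: pt_and; apply: pt_avail_prec => //.
- exact: (pt_ord2_fst pE).
- exact: (pt_ord2_fst qE).
- exact: (pt_ord2_snd pE).
- exact: (pt_ord2_snd qE).
Qed.

Lemma pt_product_instance :
  polytime E (fun x => enc_pcmssc (product_instance (H x) (dn x))).
Proof.
have us : polytime E (fun x => enc_nat (size (pair_universe (H x)))).
  apply: pt_ext (pt_size_seq pt_pair_universe) => x.
  by rewrite size_map.
have ts : polytime E (fun x => enc_nat (size (pair_tests (I x)))).
  apply: pt_ext (pt_size_seq pt_pair_tests) => x.
  by rewrite size_map.
apply: pt_cons us _; apply: pt_cons ts _.
apply: pt_cons pt_product_sets _; apply: pt_cons pt_product_prec _.
exact: (pt_const E (enc_seq [:: enc_binary `|numq 4%:R^-1|%N;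
                                enc_binary `|denq 4%:R^-1|%N])).
Qed.

Hypothesis sol_time : solver_time.

Lemma pt_sol_pairs : polytime E (fun x =>
  enc_seq [seq enc_ord2 p | p <- sol_pairs sol (H x) (dn x)]).
Proof.
have CE := pt_call (u := fun x => product_instance (H x) (dn x)) sol_time
  pt_product_instance.
apply: (pt_ext (f := fun x => enc_seq [seq enc_ord2 (tnth (in_tuple (pair_tests (I x))) j)
    | j <- sol (product_instance (H x) (dn x))])).
  by move=> x; rewrite /sol_pairs -map_comp.
apply: (pt_map (A := fun x => 'I_(size (pair_tests (I x)))) (ea := fun x => @enc_ord _)
  (f := fun x j => enc_ord2 (tnth (in_tuple (pair_tests (I x))) j)) CE).
pose J (y : {x : X & 'I_(size (pair_tests (I x)))}) : 'I_(size (pair_tests (I (tag y)))) :=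
  tagged y.
have TE := pt_weaken tag (fun y => enc_ord (J y)) pt_pair_tests.
have jE : polytime (fun y => enc_ord (J y) :: E (tag y)) (fun y => enc_nat (J y)) by pt_var.
apply: pt_ext (pt_nth jE TE) => y.
rewrite (nth_map (tnth (in_tuple (pair_tests (I (tag y)))) (J y))) ?ltn_ord //.
by rewrite -[nth _ _ _](tnth_nth _ (in_tuple (pair_tests (I (tag y))))).
Qed.

End SelectTime.

Lemma pt_mem_pairs X (E : X -> seq data) (m : X -> nat)
    (S : forall x, seq ('I_(m x) * 'I_(m x))) (s t : forall x, 'I_(m x)) :
  polytime E (fun x => enc_seq [seq enc_ord2 p | p <- S x]) ->
  polytime E (fun x => enc_nat (s x)) -> polytime E (fun x => enc_nat (t x)) ->
  polytime E (fun x => enc_bool ((s x, t x) \in S x)).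
Proof.
move=> SE sE tE.
apply: (pt_ext (f := fun x => enc_bool (has (fun p => (p.1 == s x) && (p.2 == t x)) (S x)))).
  move=> x; congr enc_bool; apply/hasP/idP => [[[a b] pS /andP[/eqP<- /eqP<-]]|stS] //.
  by exists (s x, t x); rewrite ?eqxx.
apply: (pt_has (b := fun x p => (p.1 == s x) && (p.2 == t x)) SE).
pose p (y : {x : X & ('I_(m x) * 'I_(m x))%type}) : 'I_(m (tag y)) * 'I_(m (tag y)) := tagged y.
have pE : polytime (fun y => enc_ord2 (p y) :: E (tag y)) (fun y => enc_ord2 (p y)) by pt_var.
apply: pt_and; apply: pt_eq_ord.
- exact: (pt_ord2_fst pE).
- exact: (pt_weaken tag (fun y => enc_ord2 (p y)) sE).
- exact: (pt_ord2_snd pE).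
- exact: (pt_weaken tag (fun y => enc_ord2 (p y)) tE).
Qed.

Lemma pt_section_row X (E : X -> seq data) I (dn : forall x, {set 'I_(dt_m (I x))})
    (S : forall x, seq ('I_(dt_m (I x)) * 'I_(dt_m (I x)))) (t : forall x, 'I_(dt_m (I x))) :
  instance_env E I -> polytime E (fun x => enc_set (dn x)) ->
  polytime E (fun x => enc_seq [seq enc_ord2 p | p <- S x]) ->
  polytime E (fun x => enc_nat (t x)) ->
  polytime E (fun x => enc_set (section_row (dn x) (S x) (t x))).
Proof.
move=> IE dE SE tE; apply: (pt_set (env_m IE) (A := fun x => section_row (dn x) (S x) (t x))).
pose s (y : {x : X & 'I_(dt_m (I x))}) : 'I_(dt_m (I (tag y))) := tagged y.
have sE : polytime (fun y => enc_nat (s y) :: E (tag y)) (fun y => enc_nat (s y)) by pt_var.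
apply: (pt_ext (f := fun y => enc_bool (((s y, t (tag y)) \in S (tag y)) &&
    (s y \notin dn (tag y))))).
  by move=> y; rewrite [in RHS]inE.
apply: pt_and.
  apply: (pt_mem_pairs (S := fun y => S (tag y)) _ sE).
    exact: (pt_weaken tag (fun y => enc_nat (s y)) SE).
  exact: (pt_weaken tag (fun y => enc_nat (s y)) tE).
apply: pt_not; apply: (pt_mem (A := fun y => dn (tag y)) _ sE).
exact: (pt_weaken tag (fun y => enc_nat (s y)) dE).
Qed.

Lemma pt_section_column X (E : X -> seq data) I (H : forall x, {set 'I_(dt_n (I x))})
    (dn : forall x, {set 'I_(dt_m (I x))})
    (S : forall x, seq ('I_(dt_m (I x)) * 'I_(dt_m (I x)))) (h : forall x, 'I_(dt_n (I x))) :
  hyp_env E H -> polytime E (fun x => enc_set (dn x)) ->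
  polytime E (fun x => enc_seq [seq enc_ord2 p | p <- S x]) ->
  polytime E (fun x => enc_nat (h x)) ->
  polytime E (fun x => enc_set (section_column (H x) (dn x) (S x) (h x))).
Proof.
move=> HE dE SE hE; have IE := proj1 HE.
apply: (pt_set (env_m IE) (A := fun x => section_column (H x) (dn x) (S x) (h x))).
pose t (y : {x : X & 'I_(dt_m (I x))}) : 'I_(dt_m (I (tag y))) := tagged y.
pose e1 y := enc_nat (t y).
have tE : polytime (fun y => e1 y :: E (tag y)) (fun y => enc_nat (t y)) by pt_var.
have dE1 := pt_weaken tag e1 dE; have SE1 := pt_weaken tag e1 SE.
have hE1 := pt_weaken tag e1 hE; have HE1 := weaken_hyp tag e1 HE.
apply: (pt_ext (f := fun y => enc_bool ([exists s, ((s, t y) \in S (tag y)) &&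
    (h (tag y) \in covered (H (tag y)) s)] && (t y \notin dn (tag y))))).
  by move=> y; rewrite [in RHS]inE.
apply: pt_and; last first.
  by apply: pt_not; exact: (pt_mem (A := fun y => dn (tag y)) dE1 tE).
apply: (pt_exists (env_m (proj1 HE1)) (b := fun y s => ((s, t y) \in S (tag y)) &&
    (h (tag y) \in covered (H (tag y)) s))).
pose s (z : {y : {x : X & 'I_(dt_m (I x))} & 'I_(dt_m (I (tag y)))}) :
  'I_(dt_m (I (tag (tag z)))) := tagged z.
pose e2 z := enc_nat (s z).
have sE : polytime (fun z => e2 z :: e1 (tag z) :: E (tag (tag z))) (fun z => enc_nat (s z)).
  by pt_var.
apply: pt_and.
  apply: (pt_mem_pairs (S := fun z => S (tag (tag z))) _ sE).
    exact: (pt_weaken tag e2 SE1).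
  exact: (pt_weaken tag e2 tE).
apply: pt_covered (weaken_hyp tag e2 HE1) _ sE.
exact: (pt_weaken tag e2 hE1).
Qed.

Lemma pt_card_covered_by X (E : X -> seq data) I (H : forall x, {set 'I_(dt_n (I x))})
    (P : forall x, {set 'I_(dt_m (I x))}) : hyp_env E H ->
  polytime E (fun x => enc_set (P x)) ->
  polytime E (fun x => enc_nat #|covered_by (H x) (P x)|).
Proof.
move=> HE PE; have IE := proj1 HE.
apply: (@pt_card _ _ _ (env_n IE) (fun x => covered_by (H x) (P x))).
pose h (y : {x : X & 'I_(dt_n (I x))}) : 'I_(dt_n (I (tag y))) := tagged y.
pose e1 y := enc_nat (h y).
have hE : polytime (fun y => e1 y :: E (tag y)) (fun y => enc_nat (h y)) by pt_var.
have PE1 := pt_weaken tag e1 PE; have HE1 := weaken_hyp tag e1 HE.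
apply: (pt_ext (f := fun y => enc_bool [exists t, (t \in P (tag y)) &&
    (h y \in covered (H (tag y)) t)])).
  move=> y; congr enc_bool; apply/existsP/bigcupP.
    by move=> [t /andP[tP ht]]; exists t.
  by move=> [t tP ht]; exists t; rewrite tP.
apply: (pt_exists (env_m (proj1 HE1)) (b := fun y t => (t \in P (tag y)) &&
    (h y \in covered (H (tag y)) t))).
pose t (z : {y : {x : X & 'I_(dt_n (I x))} & 'I_(dt_m (I (tag y)))}) :
  'I_(dt_m (I (tag (tag z)))) := tagged z.
pose e2 z := enc_nat (t z).
have tE : polytime (fun z => e2 z :: e1 (tag z) :: E (tag (tag z))) (fun z => enc_nat (t z)).
  by pt_var.
apply: pt_and.
  by apply: (pt_mem (A := fun z => P (tag (tag z))) _ tE); exact: (pt_weaken tag e2 PE1).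
apply: pt_covered (weaken_hyp tag e2 HE1) _ tE.
exact: (pt_weaken tag e2 hE).
Qed.

Lemma pt_odflt X (E : X -> seq data) (A : X -> Type) (ea : forall x, A x -> data)
    (o : forall x, option (A x)) (d : forall x, A x) :
  polytime E (fun x => enc_option (ea x) (o x)) -> polytime E (fun x => ea x (d x)) ->
  polytime E (fun x => ea x (odflt (d x) (o x))).
Proof.
move=> oE dE; apply: pt_ext (pt_if_nil oE dE (pt_head oE)) => x.
by case: (o x).
Qed.

Lemma pt_set_eq0 X (E : X -> seq data) (n : X -> nat) (A : forall x, {set 'I_(n x)}) :
  polytime E (fun x => enc_nat (n x)) -> polytime E (fun x => enc_set (A x)) ->
  polytime E (fun x => enc_bool (A x == set0)).
Proof.
move=> nE AE; apply: pt_ext (pt_leq (pt_card_set nE AE) (pt_const _ (enc_nat 0))) => x.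
by rewrite leqn0 cards_eq0.
Qed.

Hypothesis sol_time : solver_time.

Section PlanTime.
Variables (X : Type) (E : X -> seq data) (I : X -> pcacdt).
Variables (H : forall x, {set 'I_(dt_n (I x))}) (dn pd : forall x, {set 'I_(dt_m (I x))}).
Hypothesis HE : hyp_env E H.
Hypothesis dE : polytime E (fun x => enc_set (dn x)).
Hypothesis pE : polytime E (fun x => enc_set (pd x)).

Let IE : instance_env E I. Proof. by case: HE. Qed.

Lemma pt_candidates : polytime E (fun x =>
  enc_seq [seq enc_set P | P <- candidates sol (H x) (dn x)]).
Proof.
have SE := pt_sol_pairs HE dE sol_time.
pose S x := sol_pairs sol (H x) (dn x).
pose rows x k := [seq enc_set (section_row (dn x) (take k (S x)) t) | t <- enum 'I_(dt_m (I x))].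
pose cols x k := [seq enc_set (section_column (H x) (dn x) (take k (S x)) h)
  | h <- enum 'I_(dt_n (I x))].
apply: (pt_ext (f := fun x => enc_seq (flatten
    [seq rows x k ++ cols x k | k <- iota 0 (size (S x)).+1]))).
  move=> x; congr enc_seq; rewrite /candidates map_flatten -map_comp; congr flatten.
  by apply: eq_map => k; rewrite /= map_cat; congr (_ ++ _); rewrite -map_comp; exact: eq_map.
apply: pt_flatten; apply: (pt_ext (f := fun x => enc_seq
    [seq enc_seq (rows x k ++ cols x k) | k <- iota 0 (size (S x)).+1])).
  move=> x; by rewrite -[in RHS]map_comp.
have sE : polytime E (fun x => enc_nat (size (S x)).+1).
  by apply: pt_succ; apply: pt_ext (pt_size_seq SE) => x; rewrite size_map.
apply: (pt_map (A := fun=> nat) (ea := fun=> enc_nat)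
  (f := fun x k => enc_seq (rows x k ++ cols x k)) (pt_iota sE)).
pose k (y : {_ : X & nat}) : nat := tagged y; pose e1 y := enc_nat (k y).
have kE : polytime (fun y => e1 y :: E (tag y)) (fun y => enc_nat (k y)) by pt_var.
have HE1 := weaken_hyp tag e1 HE; have IE1 := proj1 HE1.
have dE1 := pt_weaken tag e1 dE.
have SE1 : polytime (fun y => e1 y :: E (tag y)) (fun y =>
    enc_seq [seq enc_ord2 p | p <- take (k y) (S (tag y))]).
  by apply: pt_ext (pt_take kE (pt_weaken tag e1 SE)) => y; rewrite map_take.
apply: pt_cat.
- apply: (pt_map (f := fun y t => enc_set (section_row (dn (tag y)) (take (k y) (S (tag y))) t))
    (pt_enum_ord (env_m IE1))).
  pose t (z : {y : {_ : X & nat} & 'I_(dt_m (I (tag y)))}) : 'I_(dt_m (I (tag (tag z)))) :=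
    tagged z.
  pose e2 z := enc_nat (t z).
  apply: (pt_section_row (S := fun z => take (k (tag z)) (S (tag (tag z))))
    (weaken_instance tag e2 IE1) (pt_weaken tag e2 dE1) (pt_weaken tag e2 SE1)).
  by pt_var.
- apply: (pt_map (f := fun y h => enc_set (section_column (H (tag y)) (dn (tag y))
    (take (k y) (S (tag y))) h)) (pt_enum_ord (env_n IE1))).
  pose h (z : {y : {_ : X & nat} & 'I_(dt_n (I (tag y)))}) : 'I_(dt_n (I (tag (tag z)))) :=
    tagged z.
  pose e2 z := enc_nat (h z).
  apply: (pt_section_column (S := fun z => take (k (tag z)) (S (tag (tag z))))
    (weaken_hyp tag e2 HE1) (pt_weaken tag e2 dE1) (pt_weaken tag e2 SE1)).
  by pt_var.
Qed.

Lemma pt_select : polytime E (fun x => enc_set (select sol (H x) (dn x))).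
Proof.
have CE := pt_candidates.
apply: (pt_odflt (A := fun x => {set 'I_(dt_m (I x))}) (ea := fun x => @enc_set _)
  (d := fun x => ~: dn x)).
- apply: (pt_ohead_filter (b := fun x P => densest (H x) (candidates sol (H x) (dn x)) P) CE).
  pose P (y : {x : X & {set 'I_(dt_m (I x))}}) : {set 'I_(dt_m (I (tag y)))} := tagged y.
  pose e1 y := enc_set (P y).
  have PE : polytime (fun y => e1 y :: E (tag y)) (fun y => enc_set (P y)) by pt_var.
  have HE1 := weaken_hyp tag e1 HE; have IE1 := proj1 HE1.
  apply: pt_and; first by apply: pt_not; exact: pt_set_eq0 (env_m IE1) PE.
  apply: (pt_all (b := fun y Q => #|covered_by (H (tag y)) Q| * #|P y| <=
    #|covered_by (H (tag y)) (P y)| * #|Q|) (pt_weaken tag e1 CE)).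
  pose Q (z : {y : {x : X & {set 'I_(dt_m (I x))}} & {set 'I_(dt_m (I (tag y)))}}) :
    {set 'I_(dt_m (I (tag (tag z))))} := tagged z.
  pose e2 z := enc_set (Q z).
  have QE : polytime (fun z => e2 z :: e1 (tag z) :: E (tag (tag z)))
    (fun z => enc_set (Q z)) by pt_var.
  have PE2 := pt_weaken tag e2 PE.
  have HE2 := weaken_hyp tag e2 HE1; have mE2 := env_m (proj1 HE2).
  apply: pt_leq; apply: pt_mul.
  + exact: pt_card_covered_by HE2 QE.
  + exact: (pt_card_set (A := fun z => P (tag z)) mE2 PE2).
  + exact: (pt_card_covered_by (P := fun z => P (tag z)) HE2 PE2).
  + exact: pt_card_set mE2 QE.
- apply: (pt_set (env_m IE) (A := fun x => ~: dn x)).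
  pose t (y : {x : X & 'I_(dt_m (I x))}) : 'I_(dt_m (I (tag y))) := tagged y.
  apply: (pt_ext (f := fun y => enc_bool (t y \notin dn (tag y)))).
    by move=> y; rewrite inE.
  apply: pt_not; apply: (pt_mem (A := fun y => dn (tag y))); last by pt_var.
  exact: (pt_weaken tag (fun y => enc_nat (t y)) dE).
Qed.

Lemma pt_plan : polytime E (fun x => enc_set (plan sol (H x) (dn x) (pd x))).
Proof.
apply: pt_ext (pt_if (pt_set_eq0 (env_m IE) pE) pt_select pE) => x.
by rewrite /plan; case: ifP.
Qed.

Lemma pt_ready (s : forall x, 'I_(dt_m (I x))) : polytime E (fun x => enc_nat (s x)) ->
  polytime E (fun x => enc_bool (ready (dn x) (s x))).
Proof.
move=> sE; apply: pt_and; first by apply: pt_not; exact: pt_mem.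
apply: (pt_forall (env_m IE) (b := fun x t =>
  dt_prec t (s x) && (t != s x) ==> (t \in dn x))).
pose t (y : {x : X & 'I_(dt_m (I x))}) : 'I_(dt_m (I (tag y))) := tagged y.
pose e1 y := enc_nat (t y).
have tE : polytime (fun y => e1 y :: E (tag y)) (fun y => enc_nat (t y)) by pt_var.
have sE1 := pt_weaken tag e1 sE.
apply: (pt_ext (f := fun y => enc_bool (~~ (dt_prec (t y) (s (tag y)) && (t y != s (tag y)))
  || (t y \in dn (tag y))))); first by move=> y; rewrite -implybE.
apply: pt_or; last first.
  by apply: (pt_mem (A := fun y => dn (tag y)) _ tE); exact: (pt_weaken tag e1 dE).
apply/pt_not/pt_and; last by apply: pt_not; exact: (pt_eq_ord (j := fun y => s (tag y)) tE sE1).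
exact: (pt_rel (r := fun y => @dt_prec (I (tag y))) (j := fun y => s (tag y))
  (pt_weaken tag e1 (env_rel IE)) tE sE1).
Qed.

End PlanTime.

End Selection.

(** * The construction of the tree as a polynomial-time recursion *)

Section Solver.
Variable sol : forall J : pcmssc, seq 'I_(sc_m J).
Hypothesis sol_time : solver_time sol.

(** A node of the recursion together with its instance, so that one program serves all instances.
    [st_label] is the reply on the edge from the parent: each call returns it paired with its
    subtree, which is already an entry in the list of children of the parent. *)
Record state : Type := State {
  st_inst : pcacdt;
  st_label : {set 'I_(dt_n st_inst)};
  st_hyps : {set 'I_(dt_n st_inst)};
  st_done : {set 'I_(dt_m st_inst)};
  st_pend : {set 'I_(dt_m st_inst)} }.

Definition state_env (x : state) : seq data :=
  [:: enc_set (st_label x); enc_set (st_hyps x); enc_set (st_done x);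
      enc_set (st_pend x); enc_nat (dt_n (st_inst x)); enc_nat (dt_m (st_inst x));
      enc_seq [seq enc_test (dt_test t) | t <- enum 'I_(dt_m (st_inst x))];
      enc_rel (@dt_prec (st_inst x))].

Definition st_plan (x : state) := plan sol (st_hyps x) (st_done x) (st_pend x).
Definition st_next (x : state) := next_test sol (st_hyps x) (st_done x) (st_pend x).

Definition child (x : state) (t : 'I_(dt_m (st_inst x))) (h : 'I_(dt_n (st_inst x))) :=
  State (part t h) (part t h :&: st_hyps x) (t |: st_done x) (st_plan x :\ t).

Definition children (x : state) : seq state :=
  if st_next x is Some t then [seq child t h | h <- reps (st_hyps x) t] else [::].

Definition build (x : state) (rs : seq data) : data :=
  DCons (enc_set (st_label x))
    (if st_next x is Some t then enc_seq [:: enc_bool true; enc_nat t; enc_seq rs]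
     else enc_seq [:: enc_bool false; enc_nat (leaf_hyp (st_hyps x))]).

Definition st_weight (x : state) : nat := weight (st_hyps x) (st_done x).

Lemma state_instance_env : instance_env state_env st_inst.
Proof. by split; pt_var. Qed.

Lemma state_hyp_env : hyp_env state_env st_hyps.
Proof. by split; [exact: state_instance_env | pt_var]. Qed.

Let doneE : polytime state_env (fun x => enc_set (st_done x)).
Proof. by pt_var. Qed.

Lemma pt_st_plan : polytime state_env (fun x => enc_set (st_plan x)).
Proof. by apply: (pt_plan sol_time state_hyp_env doneE); pt_var. Qed.

Lemma pt_st_next : polytime state_env (fun x => enc_option (@enc_ord _) (st_next x)).
Proof.
have nE := env_n state_instance_env; have mE := env_m state_instance_env.
have HE : polytime state_env (fun x => enc_set (st_hyps x)) by pt_var.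
apply: (pt_ext (f := fun x => if #|st_hyps x| <= 1 then DNil else
   enc_option (@enc_ord _) [pick t | (t \in st_plan x) && ready (st_done x) t])).
  by move=> x; rewrite /st_next /next_test; case: ifP.
apply: pt_if; [|exact: pt_const|].
  by apply: (pt_leq (j := fun=> 1) _ (pt_const _ (enc_nat 1))); exact: (pt_card_set nE HE).
apply: (pt_pick mE (b := fun x t => (t \in st_plan x) && ready (st_done x) t)).
pose t (y : {x : state & 'I_(dt_m (st_inst x))}) : 'I_(dt_m (st_inst (tag y))) := tagged y.
pose e1 y := enc_nat (t y).
have tE : polytime (fun y => e1 y :: state_env (tag y)) (fun y => enc_nat (t y)) by pt_var.
apply: pt_and.
  by apply: (pt_mem (A := fun y => st_plan (tag y)) _ tE); exact: (pt_weaken tag e1 pt_st_plan).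
apply: (pt_ready (H := fun y => st_hyps (tag y)) _ _ tE).
  exact: (weaken_hyp tag e1 state_hyp_env).
exact: (pt_weaken tag e1 doneE).
Qed.

Lemma pt_leaf_hyp : polytime state_env (fun x => enc_nat (leaf_hyp (st_hyps x))).
Proof.
have nE := env_n state_instance_env.
apply: (pt_odflt (A := fun x => 'I_(dt_n (st_inst x))) (ea := fun x => @enc_ord _)
  (o := fun x => [pick h in st_hyps x]) (d := fun x => Ordinal (dt_n_gt0 (st_inst x)))).
  apply: (pt_pick nE (b := fun x h => h \in st_hyps x)).
  apply: pt_mem; last by pt_var.
  by pt_var.
exact: (pt_const _ (enc_nat 0)).
Qed.

Lemma pt_child (Y : Type) (F : Y -> seq data) (x : Y -> state)
    (t : forall y, 'I_(dt_m (st_inst (x y)))) (h : forall y, 'I_(dt_n (st_inst (x y)))) :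
  polytime F (fun y => enc_seq (state_env (x y))) ->
  polytime F (fun y => enc_nat (t y)) -> polytime F (fun y => enc_nat (h y)) ->
  polytime F (fun y => enc_seq (state_env (child (t y) (h y)))).
Proof.
move=> xE tE hE; pose up f Hf := pt_call (u := x) (f := f) Hf xE.
have IE : instance_env F (fun y => st_inst (x y)).
  have [En Em Et Er] := state_instance_env.
  by split; [exact: up En | exact: up Em | exact: up Et | exact: up Er].
have partE : polytime F (fun y => enc_set (part (t y) (h y))).
  apply: (pt_tab_nth (F := fun y k => enc_set (part (t y) k)) _ hE).
  exact: (pt_tab_nth (F := fun y k => enc_test (dt_test k)) (env_tests IE) tE).
have HE : polytime F (fun y => enc_set (st_hyps (x y))).
  by apply: (up (fun x => enc_set (st_hyps x))); pt_var.
have dE := up _ doneE; have plE := up _ pt_st_plan.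
apply: (pt_cons partE); apply: pt_cons.
  apply: (pt_set (env_n IE) (A := fun y => part (t y) (h y) :&: st_hyps (x y))).
  apply: pt_setI_mem; (apply: pt_mem; last by pt_var).
    exact: (pt_weaken tag _ partE).
  exact: (pt_weaken tag _ HE).
pose s (z : {y : Y & 'I_(dt_m (st_inst (x y)))}) : 'I_(dt_m (st_inst (x (tag z)))) := tagged z.
pose e1 z := enc_nat (s z).
have sE : polytime (fun z => e1 z :: F (tag z)) (fun z => enc_nat (s z)) by pt_var.
have tE1 := pt_weaken tag e1 tE.
have stE : polytime (fun z => e1 z :: F (tag z)) (fun z => enc_bool (s z == t (tag z))).
  exact: (pt_eq_ord (j := fun z => t (tag z)) sE tE1).
apply: pt_cons.
  apply: (pt_set (env_m IE) (A := fun y => t y |: st_done (x y))).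
  apply: (pt_ext (f := fun z => enc_bool ((s z == t (tag z)) || (s z \in st_done (x (tag z)))))).
    by move=> z; rewrite !inE.
  apply: pt_or stE _; apply: (pt_mem (A := fun z => st_done (x (tag z))) _ sE).
  exact: (pt_weaken tag e1 dE).
apply: pt_cons.
  apply: (pt_set (env_m IE) (A := fun y => st_plan (x y) :\ t y)).
  apply: (pt_ext (f := fun z => enc_bool ((s z != t (tag z)) && (s z \in st_plan (x (tag z)))))).
    by move=> z; rewrite !inE.
  apply: pt_and; first exact: pt_not.
  apply: (pt_mem (A := fun z => st_plan (x (tag z))) _ sE).
  exact: (pt_weaken tag e1 plE).
case: IE => En Em Et Er; apply: pt_cons En _; apply: pt_cons Em _; apply: pt_cons Et _.
exact: pt_cons Er (pt_const _ DNil).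
Qed.

Lemma pt_children :
  polytime state_env (fun x => enc_seq [seq enc_seq (state_env y) | y <- children x]).
Proof.
pose sq x := seq_of_opt (st_next x).
have sE : polytime state_env (fun x => enc_seq [seq enc_ord t | t <- sq x]).
  by apply: pt_ext pt_st_next => x; rewrite /sq; case: (st_next x).
pose kids x t := [seq enc_seq (state_env (child t h)) | h <- reps (st_hyps x) t].
apply: (pt_ext (f := fun x => enc_seq (flatten [seq kids x t | t <- sq x]))).
  move=> x; rewrite /sq /children; case: (st_next x) => [t|] //=.
  by rewrite cats0 /kids -map_comp.
apply: pt_flatten; apply: (pt_ext (f := fun x => enc_seq [seq enc_seq (kids x t) | t <- sq x])).
  by move=> x; rewrite -[in RHS]map_comp.
apply: (pt_map (A := fun x => 'I_(dt_m (st_inst x))) (ea := fun x => @enc_ord _)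
  (f := fun x t => enc_seq (kids x t)) sE).
pose t (y : {x : state & 'I_(dt_m (st_inst x))}) : 'I_(dt_m (st_inst (tag y))) := tagged y.
pose e1 y := enc_nat (t y).
have tE : polytime (fun y => e1 y :: state_env (tag y)) (fun y => enc_nat (t y)) by pt_var.
have IE1 := weaken_instance tag e1 state_instance_env.
have HE : polytime state_env (fun x => enc_set (st_hyps x)) by pt_var.
have HE1 := pt_weaken tag e1 HE.
have xE1 : polytime (fun y => e1 y :: state_env (tag y))
  (fun y => enc_seq (state_env (tag y))) := pt_behead (pt_env _).
have rE : polytime (fun y => e1 y :: state_env (tag y))
    (fun y => enc_seq [seq enc_nat h | h : 'I_(dt_n (st_inst (tag y))) <- reps (st_hyps (tag y)) (t y)]).
  apply: (pt_filter (pt_enum_ord (env_n IE1)) (b := fun y h => rep (st_hyps (tag y)) (t y) h)).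
  pose h (z : {y : {x : state & 'I_(dt_m (st_inst x))} & 'I_(dt_n (st_inst (tag y)))}) :
    'I_(dt_n (st_inst (tag (tag z)))) := tagged z.
  pose e2 z := enc_nat (h z).
  have hE : polytime (fun z => e2 z :: e1 (tag z) :: state_env (tag (tag z)))
    (fun z => enc_nat (h z)) by pt_var.
  have HE2 := pt_weaken tag e2 HE1; have tE2 := pt_weaken tag e2 tE.
  have IE2 := weaken_instance tag e2 IE1.
  apply: pt_and; first exact: (pt_mem (A := fun z => st_hyps (tag (tag z))) HE2 hE).
  apply: (pt_forall (env_n IE2) (b := fun z g =>
    (g \in st_hyps (tag (tag z))) && (g \in part (t (tag z)) (h z)) ==> (h z <= g))).
  pose g (w : {z : {y : {x : state & 'I_(dt_m (st_inst x))} & 'I_(dt_n (st_inst (tag y)))}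
    & 'I_(dt_n (st_inst (tag (tag z))))}) : 'I_(dt_n (st_inst (tag (tag (tag w))))) := tagged w.
  pose e3 w := enc_nat (g w).
  have gE : polytime (fun w => e3 w :: e2 (tag w) :: e1 (tag (tag w)) :: state_env (tag (tag (tag w))))
    (fun w => enc_nat (g w)) by pt_var.
  have hE3 := pt_weaken tag e3 hE.
  apply: (pt_ext (f := fun w => enc_bool (~~ ((g w \in st_hyps (tag (tag (tag w)))) &&
      (g w \in part (t (tag (tag w))) (h (tag w)))) || (h (tag w) <= g w)))).
    by move=> w; rewrite -implybE.
  apply: pt_or; last exact: pt_leq hE3 gE.
  apply/pt_not/pt_and.
    exact: (pt_mem (A := fun w => st_hyps (tag (tag (tag w)))) (pt_weaken tag e3 HE2) gE).
  exact: (pt_part (t := fun w => t (tag (tag w))) (h := fun w => h (tag w))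
    (weaken_instance tag e3 IE2) (pt_weaken tag e3 tE2) gE hE3).
apply: (pt_map (f := fun y h => enc_seq (state_env (child (t y) h))) rE).
pose h (z : {y : {x : state & 'I_(dt_m (st_inst x))} & 'I_(dt_n (st_inst (tag y)))}) :
    'I_(dt_n (st_inst (tag (tag z)))) := tagged z.
pose e2 z := enc_nat (h z).
apply: (pt_child (x := fun z => tag (tag z)) (t := fun z => t (tag z)) (h := h)).
- exact: (pt_weaken tag e2 xE1).
- exact: (pt_weaken tag e2 tE).
- by pt_var.
Qed.

Lemma pt_build : polytime (fun z : state * seq data => enc_seq z.2 :: state_env z.1)
  (fun z => build z.1 z.2).
Proof.
pose e1 (z : state * seq data) := enc_seq z.2.
have nE := pt_weaken fst e1 pt_st_next; have lE := pt_weaken fst e1 pt_leaf_hyp.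
apply: pt_cons; first by pt_var.
apply: (pt_ext (f := fun z => if enc_option (@enc_ord _) (st_next z.1) is DNil
    then enc_seq [:: enc_bool false; enc_nat (leaf_hyp (st_hyps z.1))]
    else enc_seq [:: enc_bool true; if enc_option (@enc_ord _) (st_next z.1) is DCons a _
       then a else DNil; enc_seq z.2])).
  by move=> z; case: (st_next z.1).
apply: (pt_if_nil nE); (apply: pt_cons; first exact: pt_const).
  by apply: pt_cons lE _; exact: pt_const.
apply: pt_cons; first exact: pt_head nE.
by apply: pt_cons (pt_const _ DNil); pt_var.
Qed.

(** Fuel of at least the weight keeps both recursions away from their defaults, which differ. *)
Lemma tree_rec_solve k x : st_weight x <= k ->
  tree_rec children build k x = DCons (enc_set (st_label x))
    (enc_dtree (solve sol k (st_hyps x) (st_done x) (st_pend x))).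
Proof.
elim: k x => [|k IHk] x wk; first by have := weight_gt0 (st_hyps x) (st_done x);
  rewrite lt0n -leqn0 wk.
rewrite /= /build /children; case Et: (st_next x) => [t|] /=; move: (Et); rewrite /st_next => ->;
  last by [].
congr (DCons _ (DCons _ (DCons _ (DCons (enc_seq _) _)))).
rewrite -!map_comp; apply/eq_in_map => h hr /=.
by rewrite IHk //; exact: weight_child Et hr wk.
Qed.

Lemma data_size_set n (A : {set 'I_n}) : data_size (enc_set A) <= n * 4 + 1.
Proof.
have := data_size_map_leq (f := fun x : 'I_n => enc_bool (x \in A)) (enum 'I_n)
  (fun x => data_size_bool (x \in A)).
by rewrite size_enum_ord addn1.
Qed.

Let inst_size (x : state) := data_size (enc_pcacdt (st_inst x)).

Lemma inst_size_n x : dt_n (st_inst x) <= inst_size x.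
Proof. by rewrite /inst_size /= data_size_nat; lia. Qed.

Lemma inst_size_m x : dt_m (st_inst x) <= inst_size x.
Proof. by rewrite /inst_size /= !data_size_nat; lia. Qed.

Lemma pt_solve : polytime state_env (fun x => tree_rec children build (st_weight x) x).
Proof.
have bM : poly_bounded (env_size state_env) inst_size.
  apply: pb_le (pb_id _) => x; rewrite /env_size /inst_size /=; lia.
have bn : poly_bounded inst_size (fun x => dt_n (st_inst x)).
  by apply: pb_le (pb_id _); exact: inst_size_n.
have bm : poly_bounded inst_size (fun x => dt_m (st_inst x)).
  by apply: pb_le (pb_id _); exact: inst_size_m.
(* The measure shared by all nodes is the size of the encoded instance, which children inherit. The
   last function bounds what a node adds to its results: its label, and the index of a test or of a
   hypothesis. *)
apply: (@pt_tree_rec _ children build state_env inst_size st_weight (fun x =>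
  dt_n (st_inst x) * 4 + 1 + (dt_n (st_inst x) * 2 + dt_m (st_inst x) * 2 + 20)))
  => //.
- exact: pt_children.
- exact: pt_build.
- move=> x rs; rewrite /build; have := data_size_set (st_label x).
  case: (st_next x) => [t|] /=; rewrite data_size_nat.
    by have := ltn_ord t; lia.
  by have := ltn_ord (leaf_hyp (st_hyps x)); lia.
- move=> x i; rewrite /children; case: (st_next x) => [t|] //=.
  rewrite size_map => lti; have [h0 _] : exists h : 'I_(dt_n (st_inst x)), true.
    by exists (leaf_hyp (st_hyps x)).
  by rewrite (nth_map h0).
- move=> x; rewrite /children; case Et: (st_next x) => [t|]; last first.
    by rewrite big_nil; exact: weight_gt0.
  by rewrite big_map; exact: weight_kids Et.
- apply: (pb_le (g2 := fun x => inst_size x +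
    2 * (dt_n (st_inst x) * 4 + 1) + 2 * (dt_m (st_inst x) * 4 + 1) + 10)); last by pb.
  move=> x; rewrite /env_size /inst_size /=.
  have := data_size_set (st_label x); have := data_size_set (st_hyps x).
  have := data_size_set (st_done x); have := data_size_set (st_pend x); lia.
- apply: (pb_le (g2 := fun x => 1 + dt_n (st_inst x) * (dt_m (st_inst x)).+1)); last by pb.
  move=> x; rewrite /st_weight /weight geq_max leq_addr /=.
  apply: leq_trans (leq_addl _ _); apply: leq_mul; last exact: leq_subr.
  by rewrite -[leqRHS]card_ord max_card.
- by pb.
Qed.

Definition pcacdt_env (I : pcacdt) : seq data :=
  [:: enc_nat (dt_n I); enc_nat (dt_m I);
     enc_seq [seq enc_test (dt_test t) | t <- enum 'I_(dt_m I)]; enc_rel (@dt_prec I)].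

(** The label [setT] is a placeholder, removed from the final result. *)
Definition start (I : pcacdt) : state := State [set: 'I_(dt_n I)] setT set0 set0.

Definition decision_tree (I : pcacdt) : dtree (dt_n I) (dt_m I) :=
  solve sol (st_weight (start I)) setT set0 set0.

Lemma pt_decision_tree : polytime pcacdt_env (fun I => enc_dtree (decision_tree I)).
Proof.
have startE : polytime pcacdt_env (fun I => enc_seq (state_env (start I))).
  have nE : polytime pcacdt_env (fun I => enc_nat (dt_n I)) by pt_var.
  have mE : polytime pcacdt_env (fun I => enc_nat (dt_m I)) by pt_var.
  have TE : polytime pcacdt_env (fun I => enc_set [set: 'I_(dt_n I)]).
    apply: (pt_set nE (A := fun I => [set: 'I_(dt_n I)])).
    by apply: pt_ext (pt_const _ (enc_bool true)) => y; rewrite inE.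
  have ZE : polytime pcacdt_env (fun I => enc_set (set0 : {set 'I_(dt_m I)})).
    apply: (pt_set mE (A := fun I => (set0 : {set 'I_(dt_m I)}))).
    by apply: pt_ext (pt_const _ (enc_bool false)) => y; rewrite inE.
  apply: (pt_cons TE); apply: (pt_cons TE); apply: (pt_cons ZE); apply: (pt_cons ZE).
  exact: pt_env.
have := pt_behead (pt_call (u := start) pt_solve startE); apply: pt_ext => I.
by rewrite tree_rec_solve.
Qed.

End Solver.

(** Choice turns the solver program into a function. Its number of steps does not bound the size of
    its answer; this bound comes from precedence-closed sequences having no repetition, hence at
    most [sc_m J] indices. *)
Lemma solver_exists (R : realType) (alpha beta : R) (A : term) :
  pcmssc_bicriteria_algorithm alpha beta A ->
  exists sol : forall J : pcmssc, seq 'I_(sc_m J),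
    solver_time sol /\ forall J, bicriteria_solution alpha beta (sol J).
Proof.
move=> [cA [q Hq]].
have ex J : {y | exists i, [/\ evaluates i (App A (quote (enc_pcmssc J)))
    (quote (enc_cover y)), i <= q.[data_size (enc_pcmssc J)]%R &
    bicriteria_solution alpha beta y]} := cid (Hq J).
exists (fun J => sval (ex J)); split; last first.
  by move=> J; case: (svalP (ex J)) => i [].
exists A => //.
exists (fun J => q.[data_size (enc_pcmssc J)]%R + (sc_m J * (sc_m J * 2 + 2)).+1).
  have bm : poly_bounded (fun J => data_size (enc_pcmssc J)) sc_m.
    apply: pb_le (pb_id _) => J; rewrite /= !data_size_nat; lia.
  by apply: pb_add; [apply: pb_horner; exact: pb_id | pb].
move=> J; case: (svalP (ex J)) => i [Ei iq [[uC _ _] _ _]]; split.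
  by exists i => //; apply: leq_trans iq (leq_addr _ _).
apply: leq_trans (leq_addl _ _).
have := @data_size_map_leq _ (fun t : 'I_(sc_m J) => enc_nat t) (sval (ex J)) (sc_m J * 2 + 1).
rewrite /enc_cover => le; apply: leq_trans (le _) _.
  by move=> t; rewrite data_size_nat; have := ltn_ord t; lia.
rewrite ltnS -addnS leq_mul2r; apply/orP; right.
by rewrite -(card_uniqP uC) -[leqRHS]card_ord max_card.
Qed.

Local Open Scope ring_scope.

Theorem theorem9 (R : realType) :
  exists2 c : R, 0 < c &
    forall alpha beta : R, 1 <= alpha -> 1 <= beta ->
      (exists A : term, pcmssc_bicriteria_algorithm alpha beta A) ->
      exists B : term,
        pcacdt_approximation_algorithm
          (fun n : nat =>
             c * (alpha / ln (5 * beta / (5 * beta - 1)) * ln n%:R)) B.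
Proof.
(* The constant left by [ratio_bound]. *)
exists 32%:R; first by rewrite ltr0n.
move=> alpha beta alpha1 beta1 [A /solver_exists[sol [solT sol_ok]]].
have sol_closed J : precedence_closed_seq (sol J) by case: (sol_ok J).
have [B cB [T [q bT] HT]] := pt_decision_tree solT.
exists B; split=> //; exists q => I; have [[i iT Ei] _] := HT I.
exists (decision_tree sol I), i; split=> //; first exact: leq_trans iT (bT I).
have V := valid_start I; split.
  split; first exact: (solve_identifies sol_closed (leqnn _) V).
  by apply: solve_precedence => t; rewrite inE in_nil.
move=> v [[D Dok Dv] _].
have := solve_ratio alpha1 beta1 sol_ok Dok (leqnn _).
rewrite Dv => /le_trans; apply.
rewrite [leLHS]mulrAC; apply: ler_wpM2r; first exact: ler0n.
rewrite [leRHS]mulrA; apply: ler_wpM2r; first by rewrite ln_ge0 // ler1n dt_n_gt0.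
exact: ratio_bound.
Qed.
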